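(* (i) The permutohedral variety $\chi(P_e^2)$ can be isomorphically mapped to a variety in the orbit space $G_{5,2}/T^5$. (ii) For $n\ge6$, the permutohedral variety $\chi(P_e^{n-3})$ can be mapped by a birational morphism to a variety in the orbit space $G_{n,2}/T^n$.
   Context: $\chi(P_e^{m})$ denotes the toric variety over the $m$-dimensional permutohedron $P_e^m$; it is the Losev-Manin space $\overline{L}_{0,m+3,2}$. $G_{n,2}$ is the Grassmannian of $2$-dimensional subspaces of $\mathbb{C}^n$ with Plücker coordinates $P^I$, $|I|=2$, and the canonical actions of $(\mathbb{C}^* )^n$ and of the compact torus $T^n$. The moment map $\mu(L)=\frac{1}{\sum_I|P^I(L)|^2}\sum_I|P^I(L)|^2\Lambda_I$ ($\Lambda_I$ the indicator vector of $I$) has image $\Delta_{n,2}=\{x\in[0,1]^n : \sum x_i=2\}$ and induces $\hat\mu:G_{n,2}/T^n\to\Delta_{n,2}$. Strata: $W_\sigma=\{L : P^I(L)\ne 0\iff I\in\sigma\}\neq\emptyset$; $P_\sigma=\mathrm{conv}(\Lambda_I, I\in\sigma)$, $\mu(W_\sigma)=\mathring{P}_\sigma$; $F_\sigma=W_\sigma/(\mathbb{C}^* )^n$. Chambers: $C_\omega=\bigcap_{\sigma\in\omega}\mathring{P}_\sigma\ne\emptyset$ with $C_\omega\cap\mathring{P}_\sigma=\emptyset$ for $\sigma\notin\omega$. The varieties in the orbit space meant here are the spaces of parameters $F_\omega=\bigcup_{\sigma\in\omega}F_\sigma\cong\hat\mu^{-1}(x)\subset G_{n,2}/T^n$, $x\in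 C_\omega\subset\mathring{\Delta}_{n,2}$, with the variety structure of the categorical quotient of $\bigcup_{\sigma\in\omega}W_\sigma$ by $(\mathbb{C}^* )^n$, identified with the GIT quotient of $(\mathbb{C}P^1)^n$ by the diagonal $PGL_2(\mathbb{C})$ with fractional linearisation in $C_\omega$. *)

(* Defs.v *)
(* Based on MathComp, MathComp-Analysis and real-closed; the complex numbers are
   R[i] for R : realType.                                                     *)
From HB Require Import structures.
From mathcomp Require Export all_boot all_order all_algebra perm.
From mathcomp Require Export all_classical all_reals all_analysis.
From mathcomp Require Export complex.
Export numFieldNormedType.Exports.

Set Implicit Arguments.
Unset Strict Implicit.
Unset Printing Implicit Defensive.

Import Order.TTheory GRing.Theory Num.Theory.
#[global] Open Scope classical_set_scope.
#[global] Open Scope ring_scope.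

(* Varieties over K are handled in the classical way, as spaces with functions:
   a set of points, its Zariski open subsets, and for each open U the K-valued
   functions that are regular on U.  A function is a total map on the ambient
   type T, but only its values on U matter.                                   *)
Record space_with_functions (K : fieldType) (T : Type) := SpaceWithFunctions {
  points : set T;
  zopen : set (set T);
  regular : set T -> set (T -> K) }.

Definition morphism (K : fieldType) (S T : Type)
    (X : space_with_functions K S) (Y : space_with_functions K T)
    (phi : S -> T) : Prop :=
  (forall x, points X x -> points Y (phi x)) /\
  forall V, zopen Y V ->
    zopen X (points X `&` phi @^-1` V) /\
    forall f, regular Y V f -> regular X (points X `&` phi @^-1` V) (f \o phi).

Definition isomorphism (K : fieldType) (S T : Type)
    (X : space_with_functions K S) (Y : space_with_functions K T)
    (phi : S -> T) : Prop :=
  morphism X Y phi /\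
  exists psi : T -> S,
    [/\ morphism Y X psi,
        forall x, points X x -> psi (phi x) = x &
        forall y, points Y y -> phi (psi y) = y].

Definition subspace_with_functions (K : fieldType) (T : Type)
    (X : space_with_functions K T) (D : set T) : space_with_functions K T := {|
  points := points X `&` D;
  zopen := [set U | exists2 V, zopen X V & U = V `&` D];
  regular := fun U => [set f : T -> K | forall x, U x -> exists V g,
    [/\ zopen X V, V x, regular X V g &
        forall y, (U `&` V) y -> f y = g y]] |}.

Definition zdense (K : fieldType) (T : Type) (X : space_with_functions K T)
    (D : set T) : Prop :=
  forall U, zopen X U -> U !=set0 -> U `&` D !=set0.

Definition birational_morphism (K : fieldType) (S T : Type)
    (X : space_with_functions K S) (Y : space_with_functions K T)
    (phi : S -> T) : Prop :=
  morphism X Y phi /\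
  exists (U : set S) (V : set T),
    [/\ zopen X U, zdense X U, zopen Y V, zdense Y V &
        isomorphism (subspace_with_functions X U)
                    (subspace_with_functions Y V) phi].

(* The K-algebra of functions generated by a set of coordinate functions. *)
Inductive polyfun (K : fieldType) (T : Type) (coord : set (T -> K)) :
    (T -> K) -> Prop :=
  | polyfun_cst c : polyfun coord (fun=> c)
  | polyfun_coord x : coord x -> polyfun coord x
  | polyfun_add f g :
      polyfun coord f -> polyfun coord g -> polyfun coord (fun t => f t + g t)
  | polyfun_mul f g :
      polyfun coord f -> polyfun coord g -> polyfun coord (fun t => f t * g t).

(* The Zariski structure of a subset D of an affine space: regular functions
   are locally quotients of polynomials in the coordinates.                   *)
Definition zariski (K : fieldType) (T : Type) (D : set T)
    (coord : set (T -> K)) : space_with_functions K T := {|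
  points := D;
  zopen := [set U | U `<=` D /\ forall x, U x -> exists b,
    [/\ polyfun coord b, b x != 0 & forall y, D y -> b y != 0 -> U y]];
  regular := fun U => [set f : T -> K | forall x, U x -> exists a b,
    [/\ polyfun coord a, polyfun coord b, b x != 0 &
        forall y, U y -> b y != 0 -> f y = a y / b y]] |}.

(* The quotient of X along q, in the category of spaces with functions: open
   sets and regular functions downstairs are those which are so upstairs.     *)
Definition quotient_space (K : fieldType) (S T : Type)
    (X : space_with_functions K S) (q : S -> T) : space_with_functions K T := {|
  points := q @` points X;
  zopen := [set U | U `<=` q @` points X /\ zopen X (points X `&` q @^-1` U)];
  regular := fun U =>
    [set f : T -> K | regular X (points X `&` q @^-1` U) (f \o q)] |}.

(* The structure of X carried over to D along a bijection p from D to X. *)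
Definition transport (K : fieldType) (S T : Type) (D : set S) (p : S -> T)
    (X : space_with_functions K T) : space_with_functions K S := {|
  points := D;
  zopen := [set U | U `<=` D /\ zopen X (p @` U)];
  regular := fun U => [set f : S -> K | exists2 h, regular X (p @` U) h &
    forall y, U y -> f y = h (p y)] |}.

Definition orbit_of (G X : Type) (act : G -> X -> X) (D : set G) (x : X) :
    set X :=
  [set act g x | g in D].

Section convexity.
Variables (R : realType) (n : nat).
Implicit Type A : set 'rV[R]_n.

Definition conv_hull A : set 'rV[R]_n :=
  smallest (@convex_set R 'rV[R]_n) A.

Definition affine_set A : Prop :=
  forall (x y : 'rV[R]_n) (t : R), A x -> A y -> A (t *: x + (1 - t) *: y).

Definition affine_hull A : set 'rV[R]_n := smallest affine_set A.

Definition rel_interior A : set 'rV[R]_n :=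
  [set x : 'rV[R]_n | A x /\ \forall y \near x, affine_hull A y -> A y].

End convexity.

Section toric.
Variables (R : realType) (d : nat) (P : set 'rV[R]_d).

Definition lattice_point_of_dilate (k : nat) (a : 'rV[int]_d) : Prop :=
  exists2 x, P x & map_mx intr a = k%:R *: x.

(* The toric variety of a lattice polytope P is Proj C[S], where S is the graded
   semigroup of the (k, a) with a a lattice point of k P.  A point of Spec C[S]
   is a homomorphism from S to the multiplicative monoid C, extended here by 0
   outside S; the irrelevant ideal cuts out the homomorphisms vanishing in all
   positive degrees, and Proj is the quotient of the rest by the grading action
   of the nonzero scalars.                                                    *)
Definition polytope_cone : set (nat -> 'rV[int]_d -> R[i]) :=
  [set g | [/\ g 0%N 0 = 1,
    forall k l a b, lattice_point_of_dilate k a ->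
      lattice_point_of_dilate l b -> g (k + l)%N (a + b) = g k a * g l b,
    forall k a, ~ lattice_point_of_dilate k a -> g k a = 0 &
    exists k a, (0 < k)%N /\ g k a != 0]].

Definition cone_coord : set ((nat -> 'rV[int]_d -> R[i]) -> R[i]) :=
  [set c | exists k a, c = fun g => g k a].

Definition grading_act (s : R[i]) (g : nat -> 'rV[int]_d -> R[i]) :
    nat -> 'rV[int]_d -> R[i] :=
  fun k a => s ^+ k * g k a.

Definition toric_variety :
    space_with_functions R[i] (set (nat -> 'rV[int]_d -> R[i])) :=
  quotient_space (zariski polytope_cone cone_coord)
    (orbit_of grading_act [set s | s != 0]).

End toric.

(* The m-dimensional permutohedron, in R^(m+1). *)
Definition permutohedron (R : realType) (m : nat) : set 'rV[R]_m.+1 :=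
  conv_hull [set \row_i (s i).+1%:R | s in [set: 'S_m.+1]].

Section grassmannian.
Variables (R : realType) (n : nat).
Local Notation V := 'rV[R[i]]_n.
Local Notation subspace := {vspace 'rV[R[i]]_n}.
Implicit Types (L : subspace) (I : {set 'I_n}) (sigma : {set {set 'I_n}})
  (omega : set {set {set 'I_n}}) (x : 'rV[R]_n).

Definition grassmannian_points : set subspace := [set L | \dim L = 2%N].

Definition frames : set 'M[R[i]]_(2, n) := [set A | \rank A = 2%N].

Definition entry_coord : set ('M[R[i]]_(2, n) -> R[i]) :=
  [set c | exists i j, c = fun A : 'M[R[i]]_(2, n) => A i j].

Definition row_span (A : 'M[R[i]]_(2, n)) : subspace :=
  <<[:: row 0%R A; row 1%R A]>>%VS.

(* G_{n,2} as the quotient by GL_2 of the space of frames. *)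
Definition grassmannian : space_with_functions R[i] subspace :=
  quotient_space (zariski frames entry_coord) row_span.

(* Pluecker coordinates are defined up to a common factor, fixed here by the
   choice of a basis of L; enum I lists I increasingly, and the value is 0 when
   I does not have two elements.                                              *)
Definition pluecker L I : R[i] :=
  if enum I is [:: i; j] then
    (vbasis L)`_0 0 i * (vbasis L)`_1 0 j
    - (vbasis L)`_0 0 j * (vbasis L)`_1 0 i
  else 0.

Definition sq_abs (z : R[i]) : R := complex.Re z ^+ 2 + complex.Im z ^+ 2.

Definition Lambda I : 'rV[R]_n := \row_i (i \in I)%:R.

Definition moment_map L : 'rV[R]_n :=
  (\sum_(I : {set 'I_n} | #|I| == 2%N) sq_abs (pluecker L I))^-1 *:
  \sum_(I : {set 'I_n} | #|I| == 2%N) sq_abs (pluecker L I) *: Lambda I.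

Definition torus_act (t : V) L : subspace :=
  (linfun (mulmxr (diag_mx t)) @: L)%VS.

Definition complex_torus : set V := [set t : V | forall i, t 0 i != 0].
Definition compact_torus : set V := [set t : V | forall i, sq_abs (t 0 i) = 1].

(* G_{n,2} / T^n *)
Definition orbit_space : set (set subspace) :=
  [set orbit_of torus_act compact_torus L | L in grassmannian_points].

(* The moment map is T^n-invariant; xget picks any element of the orbit. *)
Definition moment_map_hat (O : set subspace) : 'rV[R]_n :=
  moment_map (xget 0%VS O).

Definition moment_fibre x : set (set subspace) :=
  orbit_space `&` moment_map_hat @^-1` [set x].

Definition hypersimplex : set 'rV[R]_n :=
  [set x : 'rV[R]_n | (forall i, 0 <= x 0 i <= 1) /\ \sum_i x 0 i = 2].

Definition stratum sigma : set subspace :=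
  [set L | grassmannian_points L /\
           forall I, (pluecker L I != 0) = (I \in sigma)].

Definition is_stratum sigma : Prop := stratum sigma !=set0.

Definition matroid_polytope sigma : set 'rV[R]_n :=
  conv_hull [set Lambda I | I in [set I | I \in sigma]].

Definition chamber omega : set 'rV[R]_n :=
  \bigcap_(sigma in omega) rel_interior (matroid_polytope sigma).

Definition is_chamber omega : Prop :=
  [/\ forall sigma, omega sigma -> is_stratum sigma,
      chamber omega !=set0 &
      forall sigma, is_stratum sigma -> ~ omega sigma ->
        chamber omega `&` rel_interior (matroid_polytope sigma) = set0].

(* The space of parameters F_omega: the quotient by (C^* )^n of the union of the
   strata in omega, viewed in G_{n,2}.  Its points are the orbits in that union,
   that is the union of the F_sigma.                                          *)
Definition parameter_space omega :
    space_with_functions R[i] (set subspace) :=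
  quotient_space
    (subspace_with_functions grassmannian
       (\bigcup_(sigma in omega) stratum sigma))
    (orbit_of torus_act complex_torus).

(* The (C^* )^n-orbit containing a T^n-orbit.  For x in the chamber of omega this
   is a bijection from the fibre over x to F_omega.                           *)
Definition complexify (O : set subspace) : set subspace :=
  \bigcup_(L in O) orbit_of torus_act complex_torus L.

(* F_omega, realised as the fibre over x inside the orbit space. *)
Definition orbit_space_variety omega x :
    space_with_functions R[i] (set subspace) :=
  transport (moment_fibre x) complexify (parameter_space omega).

End grassmannian.

(* Main.v *)
(* In both parts [omega] consists of the strata whose polytope contains a generic
   weight vector in its relative interior: for two columns of weight 11/20 and
   three of weight 3/10 when n = 5, and for one column of weight (n-1)/n and n-1
   of weight (n+1)/(n(n-1)) when n >= 6.  Weights summing to 2 make a frame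
   stable when parallel columns have total weight less than 1, and Brewer's
   sampling formula then exhibits the weight vector as a positive combination of
   the vertices of the polytope of the frame.  The strict convexity of
   [u |-> \sum_I |P^I|^2 exp(u . (Lambda_I - x))] makes each fibre of the moment
   map a set of representatives for the stable (C^* )^n-orbits, so F_omega is the
   quotient of the stable frames.

   Sending two columns to 0 and infinity turns a stable frame into points
   z_i = q_i / p_i of P^1 for the other n - 2 columns, up to a common scalar.
   The monomials z^a in the permutohedron give the point of the toric variety; the
   coordinates of a chart at a vertex s are the ratios z_i / z_j for s_j = s_i + 1.
   For n = 5 at most one z_i is 0 and at most one is infinity, and the chart
   coordinates recover z.  For n >= 6 the z_i are finite and not all 0, so
   F_omega is P^(n-3), with homogeneous coordinates the g(1, s + e_i - e_top),
   where s_top is maximal; the resulting morphism is an isomorphism over the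
   torus.                                                                      *)
Require Import Defs.
From mathcomp Require Import ring lra zify.
Set Implicit Arguments.
Unset Strict Implicit.
Unset Printing Implicit Defensive.
Import Order.TTheory GRing.Theory Num.Theory.

(** * Quotients of Zariski spaces *)

(** The two varieties arise from different towers of quotients, open subspaces and transports. Both
    are brought to one common form, an open part of an affine Zariski space with a quotient map, so
    that a morphism only has to be exhibited as a polynomial map upstairs near each point; working
    with homogeneous coordinates absorbs the denominators.

    The result concerns every point of the chamber, not only the weight vector. Stability depends on
    the signs of [csum x S - 1] alone, and these are constant on the chamber: frames whose only
    coincidence is that the columns of [S] are parallel have their strata in the chamber when [S] is
    light enough, and their polytopes detect the sign.

    Everything about frames is expressed by minors, which both the change of frame and the torus
    multiply by nonzero factors. *)

Definition presented (K : fieldType) (S T : Type) (X : space_with_functions K T)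
    (E : set S) (coord : set (S -> K)) (D : set S) (q : S -> T) : Prop :=
  [/\ zopen (zariski E coord) D,
      points X = q @` D,
      forall W, zopen X W <->
        W `<=` q @` D /\ zopen (zariski E coord) (D `&` q @^-1` W) &
      forall W f, zopen X W -> regular X W f <->
        regular (zariski E coord) (D `&` q @^-1` W) (f \o q)].

Section Presented.
Variable K : fieldType.

Lemma zopen_zariskiI (S : Type) (E : set S) (coord : set (S -> K)) U V :
  zopen (zariski E coord) U -> zopen (zariski E coord) V ->
  zopen (zariski E coord) (U `&` V).
Proof.
move=> [UE hU] [VE hV]; split=> [x [/UE]//|x [/hU[b [pb b0 hb]] /hV[c [pc c0 hc]]]].
exists (fun t => b t * c t); split; [exact: polyfun_mul|by rewrite mulf_neq0|].
by move=> y Ey; rewrite mulf_eq0 negb_or => /andP[by0 cy0]; split; [apply: hb|apply: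
  hc].
Qed.

Lemma presented_zariski (S : Type) (E : set S) (coord : set (S -> K)) :
  presented (zariski E coord) E coord E id.
Proof.
split.
- split=> // x _; exists (fun=> 1).
  by split; [exact: polyfun_cst|rewrite oner_neq0|].
- by rewrite image_id.
- move=> W; rewrite image_id preimage_id; split=> [WE|[WE]].
    by have WE' := WE.1; rewrite (setIidr WE'); split.
  by rewrite (setIidr WE).
- by move=> W f [WE _]; rewrite preimage_id (setIidr WE).
Qed.

Lemma presented_quotient (S T T' : Type) (X : space_with_functions K T)
    (E : set S) (coord : set (S -> K)) D q (r : T -> T') :
  presented X E coord D q ->
  presented (quotient_space X r) E coord D (r \o q).
Proof.
move=> [Dop pX oX rX].
have im : r @` points X = (r \o q) @` D by rewrite pX image_comp.
have pre W : D `&` q @^-1` (points X `&` r @^-1` W) = D `&` (r \o q) @^-1` W.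
  apply/seteqP; split=> [y [Dy [_ ?]]|y [Dy ?]]; split=> //.
  by split=> //; rewrite pX; exists y.
split=> //.
- move=> W; rewrite -im; split=> [[WE /oX[_]]|[WE h]]; first by rewrite pre.
  by split=> //; apply/oX; rewrite pre; split=> // y [+ _]; rewrite pX.
- by move=> W f [_ h]; have := rX _ (f \o r) h; rewrite pre.
Qed.

(** Subspaces are the one construction whose regular functions are redefined locally, so local
    agreement with a regular [g] has to be turned back into a fraction upstairs. The ambient set [E]
    stays fixed and only the open part shrinks. *)
Lemma presented_subspace (S T : Type) (X : space_with_functions K T)
    (E : set S) (coord : set (S -> K)) D q U :
  presented X E coord D q -> zopen X U ->
  presented (subspace_with_functions X U) E coord (D `&` q @^-1` U) q.
Proof.
move=> [Dop pX oX rX] Uop; have [UD Uop'] := (oX U).1 Uop.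
have im : q @` (D `&` q @^-1` U) = q @` D `&` U.
  apply/seteqP; split=> [_ [y [Dy Uy] <-]|_ [[y Dy <-] Uy]].
    by split=> //; exists y.
  by exists y.
have sub W : W `<=` U -> (D `&` q @^-1` U) `&` q @^-1` W = D `&` q @^-1` W.
  move=> WU; apply/seteqP; split=> [y [[]]//|y [Dy Wy]].
  by split=> //; split=> //; exact: WU.
have subopen W : zopen (subspace_with_functions X U) W <-> zopen X W /\ W `<=` U.
  split=> [[V Vop ->]|[Wop WU]]; last by exists W => //; rewrite (setIidl WU).
  split; last by move=> ? [].
  have [VD Vop'] := (oX V).1 Vop.
  apply/oX; split; first by move=> y [/VD].
  rewrite (_ : _ `&` _ = (D `&` q @^-1` V) `&` (D `&` q @^-1` U)).
    exact: zopen_zariskiI.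
  by apply/seteqP; split=> [y [? []]|y [[? ?] []]].
split=> //.
- by rewrite im /= pX.
- move=> W; rewrite im; split.
    move=> /subopen[/oX[WD Wop] WU]; split; last by rewrite sub.
    by move=> y Wy; split; [exact: WD|exact: WU].
  move=> [WU]; rewrite sub; last by move=> y /WU[].
  move=> h; apply/subopen; split; last by move=> y /WU[].
  by apply/oX; split=> // y /WU[].
- move=> W f /subopen[Wop WU]; rewrite sub//; split; last first.
    by move=> h x Wx; exists W, f; split=> //; apply/rX.
  move=> h y [Dy Wy]; have [V [g [Vop Vy /(rX _ _ Vop) rg fg]]] := h _ Wy.
  have [_ [_ hV]] := (oX V).1 Vop.
  have [c [pc c0 hc]] := hV y (conj Dy Vy).
  have [a [b [pa pb b0 hab]]] := rg y (conj Dy Vy).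
  (* On [E], [c] vanishes outside the preimage of [V]: multiplying numerator and denominator by it
     confines the fraction to the region where [f] agrees with [g]. *)
  exists (fun t => a t * c t), (fun t => b t * c t); split.
  + exact: polyfun_mul.
  + exact: polyfun_mul.
  + by rewrite mulf_neq0.
  + move=> z [Dz Wz]; rewrite mulf_eq0 negb_or => /andP[bz cz].
    have [_ Vz] : (D `&` q @^-1` V) z by apply: hc => //; apply: Dop.1.
    by rewrite /= fg// -mulf_div divff// mulr1; exact: hab.
Qed.

Lemma presented_transport (S S' T : Type) (X : space_with_functions K T)
    (E : set S) (coord : set (S -> K)) D q (D' : set S') (p : S' -> T)
    (r : T -> S') :
  presented X E coord D q ->
  (forall s, D' s -> points X (p s)) -> set_inj D' p ->
  (forall t, points X t -> D' (r t) /\ p (r t) = t) ->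
  presented (transport D' p X) E coord D (r \o q).
Proof.
move=> [Dop pX oX rX] pD pinj rP.
have rq y : D y -> D' (r (q y)) /\ p (r (q y)) = q y.
  by move=> Dy; apply: rP; rewrite pX; exists y.
have im : (r \o q) @` D = D'.
  apply/seteqP; split=> [_ [y Dy <-]|s Ds]; first by case: (rq _ Dy).
  have := pD _ Ds; rewrite pX => -[y Dy ys]; exists y => //=.
  by apply: pinj; rewrite ?inE//; case: (rq _ Dy) => // _ ->.
have pre W : W `<=` D' -> D `&` q @^-1` (p @` W) = D `&` (r \o q) @^-1` W.
  move=> WD; apply/seteqP; split=> [y [Dy [s Ws sq]]|y [Dy Wy]]; split=> //.
    have e : s = r (q y); last by rewrite e in Ws.
    apply: pinj; rewrite ?inE; last by rewrite (rq _ Dy).2.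
    - exact: WD.
    - exact: (rq _ Dy).1.
  by exists (r (q y)) => //; exact: (rq _ Dy).2.
split=> //.
- move=> W; rewrite im; split=> -[WD h]; split=> //.
    by move/oX: h => [_]; rewrite pre.
  apply/oX; rewrite pre//; split=> // _ [s Ws <-].
  by rewrite -pX; apply: pD; exact: WD.
- move=> W f [WD Wop]; split.
    move=> [h /(rX _ _ Wop)]; rewrite pre// => hr fh y Wy.
    have [a [b [pa pb b0 hab]]] := hr _ Wy.
    exists a, b; split=> // z [Dz Wz] bz /=.
    by rewrite fh// (rq _ Dz).2; exact: hab.
  move=> h; exists (f \o r).
    by apply/rX => //; rewrite pre.
  move=> y Wy /=; congr f; apply: pinj; rewrite ?inE; first exact: WD.
    by apply: (rP _ _).1; apply: pD; exact: WD.
  by rewrite (rP _ (pD _ (WD _ Wy))).2.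
Qed.

Lemma polyfun_comp (S S' : Type) (coord : set (S -> K)) (coord' : set (S' -> K))
    (h : S -> S') f :
  (forall c, coord' c -> polyfun coord (c \o h)) ->
  polyfun coord' f -> polyfun coord (f \o h).
Proof.
move=> hc; elim=> {f} [c|c /hc//|f g _ hf _ hg|f g _ hf _ hg].
- exact: polyfun_cst.
- exact: (polyfun_add hf hg).
- exact: (polyfun_mul hf hg).
Qed.

(** [h] is polynomial everywhere and [b] only marks a region where it lands in [D']. Denominators
    are cleared beforehand by the scalings that [q'] divides out. *)
Definition local_lift (S S' T T' : Type) (coord : set (S -> K)) (D : set S)
    (q : S -> T) (coord' : set (S' -> K)) (D' : set S') (q' : S' -> T')
    (phi : T -> T') : Prop :=
  forall g, D g -> exists b h, [/\ polyfun coord b, b g != 0,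
    forall c, coord' c -> polyfun coord (c \o h) &
    forall g', D g' -> b g' != 0 -> D' (h g') /\ q' (h g') = phi (q g')].

Section Lifts.
Variables (S S' T T' : Type) (X : space_with_functions K T)
  (Y : space_with_functions K T').
Variables (E : set S) (coord : set (S -> K)) (D : set S) (q : S -> T).
Variables (E' : set S') (coord' : set (S' -> K)) (D' : set S') (q' : S' -> T').
Hypotheses (pX : presented X E coord D q) (pY : presented Y E' coord' D' q').

Lemma lift_morphism phi :
  local_lift coord D q coord' D' q' phi -> morphism X Y phi.
Proof.
case: pX pY => [Dop eX oX rX] [Dop' eY oY rY] lift; split.
  rewrite eX eY => _ [g Dg <-]; have [b [h [_ b0 _ /(_ g Dg b0)[Dh <-]]]] := lift g Dg.
  by exists (h g).
move=> V Vop; have [VD [_ Vop']] := (oY V).1 Vop.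
have pre : D `&` q @^-1` (points X `&` phi @^-1` V) = D `&` (phi \o q) @^-1` V.
  apply/seteqP; split=> [y [Dy [_ ?]]|y [Dy ?]]; split=> //.
  by split=> //; rewrite eX; exists y.
have preop : zopen X (points X `&` phi @^-1` V).
  apply/oX; split; first by rewrite eX => ? [].
  rewrite pre; split=> [y [Dy _]|g [Dg Vg]]; first exact: Dop.1.
  have [b [h [pb b0 ph hb]]] := lift g Dg.
  have [Dh hg] := hb g Dg b0.
  have [|b' [pb' b'0 hb']] := Vop' (h g); first by split=> //=; rewrite hg.
  have [c [pc c0 hc]] := Dop.2 g Dg.
  (* [c] keeps the point in [D], [b] makes the lift valid there, and [b' \o h] keeps its image in
     the preimage of [V]. *)
  exists (fun t => c t * (b t * b' (h t))); split.
  - by apply: polyfun_mul => //; apply: polyfun_mul => //; exact: polyfun_comp pb'.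
  - by rewrite !mulf_neq0.
  - move=> y Ey; rewrite !mulf_eq0 !negb_or => /and3P[cy b_y b'y].
    have Dy := hc _ Ey cy; have [Dhy hy] := hb _ Dy b_y.
    split=> //=; rewrite -hy.
    by case: (hb' (h y) (Dop'.1 _ Dhy) b'y).
split=> // f /(rY _ _ Vop) rf; apply/rX => //; rewrite pre => g [Dg Vg].
have [b [h [pb b0 ph hb]]] := lift g Dg.
have [Dh hg] := hb g Dg b0.
have [|a' [b' [pa' pb' b'0 hab]]] := rf (h g); first by split=> //=; rewrite hg.
exists (fun t => b t * a' (h t)), (fun t => b t * b' (h t)); split.
- by apply: polyfun_mul => //; exact: polyfun_comp pa'.
- by apply: polyfun_mul => //; exact: polyfun_comp pb'.
- by rewrite !mulf_neq0.
- move=> y [Dy Vy]; rewrite !mulf_eq0 !negb_or => /andP[b_y b'y].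
  have [Dhy hy] := hb _ Dy b_y.
  rewrite /= -hy -mulf_div divff// mul1r; apply: hab => //; split=> //.
  by rewrite /preimage /= hy.
Qed.

End Lifts.

(** The inverse is chosen pointwise; the lifts in the opposite direction make it a morphism and also
    give surjectivity. *)
Lemma lift_isomorphism (S S' T' : Type) (T : choiceType) (X : space_with_functions K T)
  (Y : space_with_functions K T') (t0 : T)
  (E : set S) (coord : set (S -> K)) (D : set S) (q : S -> T)
  (E' : set S') (coord' : set (S' -> K)) (D' : set S') (q' : S' -> T') phi :
  presented X E coord D q -> presented Y E' coord' D' q' ->
  local_lift coord D q coord' D' q' phi ->
  (forall g g', D g -> D g' -> phi (q g) = phi (q g') -> q g = q g') ->
  (forall A, D' A -> exists b h, [/\ polyfun coord' b, b A != 0,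
    forall c, coord c -> polyfun coord' (c \o h) &
    forall A', D' A' -> b A' != 0 -> D (h A') /\ phi (q (h A')) = q' A']) ->
  isomorphism X Y phi.
Proof.
move=> pX pY lift inj lift'; split; first exact: (lift_morphism pX pY).
pose psi t' := xget t0 [set t | points X t /\ phi t = t'].
have [_ eX _ _] := pX; have [_ eY _ _] := pY.
have psiK t : points X t -> psi (phi t) = t.
  move=> Xt; have [|] := @xgetPex _ t0 [set t1 | points X t1 /\ phi t1 = phi t];
    first by exists t.
  rewrite -/(psi _); move: (psi _) Xt => u; rewrite eX => -[g Dg <-] [g' Dg' <-].
  by move/(inj _ _ Dg' Dg).
have Xq g : D g -> points X (q g) by rewrite eX; exists g.
exists psi; split=> //.
- apply: (lift_morphism pY pX) => A D'A.
  have [b [h [pb b0 ph hb]]] := lift' A D'A; exists b, h; split=> // A' DA' bA'.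
  have [Dh <-] := hb _ DA' bA'; split=> //; rewrite psiK//; exact: Xq.
- move=> y; rewrite eY => -[A D'A <-].
  have [b [h [_ b0 _ /(_ A D'A b0)[Dh <-]]]] := lift' A D'A.
  by rewrite psiK//; exact: Xq.
Qed.

(** A nonempty open set contains the image of a basic open set, so density amounts to avoiding the
    zeros of one polynomial function. *)
Lemma presented_zdense (S T : Type) (X : space_with_functions K T)
    (E : set S) (coord : set (S -> K)) D q U :
  presented X E coord D q ->
  (forall g b, D g -> polyfun coord b -> b g != 0 ->
    exists g', [/\ D g', b g' != 0 & U (q g')]) ->
  zdense X U.
Proof.
move=> [Dop eX oX _] h W /oX[WD [_ Wop]] [_ /[dup] /WD[g Dg <-] Wg].
have [b [pb b0 hb]] := Wop g (conj Dg Wg).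
have [g' [Dg' b'0 Ug']] := h g b Dg pb b0.
by exists (q g'); split=> //; case: (hb g' (Dop.1 _ Dg') b'0).
Qed.

End Presented.

(** * Convex hulls and relative interiors *)

Lemma sum_row_mx (K : nmodType) (I : finType) (P : pred I) m n1 n2
    (A : I -> 'M[K]_(m, n1)) (B : I -> 'M[K]_(m, n2)) :
  \sum_(i | P i) row_mx (A i) (B i) =
  row_mx (\sum_(i | P i) A i) (\sum_(i | P i) B i).
Proof.
elim/big_rec3: _ => [|i b a s _ ->]; first by rewrite row_mx0.
by rewrite add_row_mx.
Qed.

Section ConvexHull.
Variables (R : realType) (n : nat).
Implicit Types (A V Q : set 'rV[R]_n) (x y z : 'rV[R]_n).

Lemma conv_hull_sub V : V `<=` conv_hull V.
Proof. exact: sub_gen_smallest. Qed.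

Lemma conv_hull_ind V Q :
  (forall x y (t : R), 0 <= t <= 1 -> Q x -> Q y -> Q (t *: x + (1 - t) *: y)) ->
  V `<=` Q -> conv_hull V `<=` Q.
Proof.
move=> cQ VQ; apply: smallest_sub => // x y t; rewrite !inE => Qx Qy.
apply: (cQ x y t%:num) => //; apply/andP; split; [exact: ge0|exact: le1].
Qed.

Lemma conv_hull_conv V x y (t : R) : 0 <= t <= 1 ->
  conv_hull V x -> conv_hull V y -> conv_hull V (t *: x + (1 - t) *: y).
Proof.
move=> /andP[t0 t1] hx hy Q [cQ VQ].
have := cQ x y (Itv01 t0 t1); rewrite !inE; apply.
  by apply: hx; split.
by apply: hy; split.
Qed.

Lemma conv_hull_sum (T : finType) (P : pred T) (v : T -> 'rV[R]_n) (c : T -> R) V :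
  (forall t, P t -> 0 <= c t) -> (forall t, P t -> V (v t)) ->
  \sum_(t | P t) c t = 1 -> conv_hull V (\sum_(t | P t) c t *: v t).
Proof.
move=> c0 hv c1.
(* Partial sums are normalised by their total, so that adding a term is a two-point combination. *)
suff h (s : seq T) : 0 < \sum_(t <- s | P t) c t ->
    conv_hull V ((\sum_(t <- s | P t) c t)^-1 *: \sum_(t <- s | P t) c t *: v t).
  by have := h (index_enum T); rewrite c1 invr1 scale1r; apply.
elim: s => [|t s IH]; first by rewrite big_nil ltxx.
rewrite !big_cons; case: ifP => // Pt.
set S := \sum_(j <- s | P j) c j in IH *.
have S0 : 0 <= S by apply: sumr_ge0.
have [S_eq0|S_neq0] := eqVneq S 0.
  rewrite [X in _ *: (_ + X)]big1_seq ?addr0; last first.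
    move=> i /andP[Pi si]; apply/eqP; rewrite scaler_eq0; apply/orP; left.
    move/eqP: S_eq0; rewrite /S psumr_eq0; last by move=> j; exact: c0.
    by move=> /allP/(_ _ si); rewrite Pi.
  rewrite S_eq0 addr0 => ct; rewrite scalerA mulVf ?gt_eqF// scale1r.
  by apply: conv_hull_sub; exact: hv.
have Spos : 0 < S by rewrite lt_neqAle eq_sym S_neq0.
move=> cS.
have -> : (c t + S)^-1 *: (c t *: v t + \sum_(j <- s | P j) c j *: v j) =
    (c t / (c t + S)) *: v t +
    (1 - c t / (c t + S)) *: (S^-1 *: \sum_(j <- s | P j) c j *: v j).
  rewrite scalerDr !scalerA mulrC; congr (_ + _ *: _).
  by field; rewrite S_neq0 gt_eqF.
apply: conv_hull_conv; last exact: IH.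
  apply/andP; split; first by rewrite divr_ge0 ?c0// ltW.
  by rewrite ler_pdivrMr// mul1r lerDl.
by apply: conv_hull_sub; exact: hv.
Qed.

Lemma conv_hull_combo (T : finType) (P : pred T) (v : T -> 'rV[R]_n) x :
  conv_hull [set v t | t in [set t | P t]] x ->
  exists c : T -> R, [/\ forall t, P t -> 0 <= c t, \sum_(t | P t) c t = 1 &
    x = \sum_(t | P t) c t *: v t].
Proof.
move: x; apply: conv_hull_ind => [x y t /andP[t0 t1]|_ [t Pt <-]].
  move=> [c [c0 c1 ->]] [d [d0 d1 ->]].
  exists (fun i => t * c i + (1 - t) * d i); split.
  - by move=> i Pi; rewrite addr_ge0 ?mulr_ge0 ?c0 ?d0// subr_ge0.
  - by rewrite big_split /= -!mulr_sumr c1 d1; ring.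
  - rewrite !scaler_sumr -big_split /=; apply: eq_bigr => i _.
    by rewrite [RHS]scalerDl !scalerA.
exists (fun i => (i == t)%:R); split.
- by move=> i _; rewrite ler0n.
- by rewrite (bigD1 t)//= eqxx big1 ?addr0// => i /andP[_ /negbTE->].
- rewrite (bigD1 t)//= eqxx scale1r big1 ?addr0// => i /andP[_ /negbTE->].
  by rewrite scale0r.
Qed.

Lemma affine_hull_combo (T : finType) (P : pred T) (v : T -> 'rV[R]_n) x :
  affine_hull (conv_hull [set v t | t in [set t | P t]]) x ->
  exists c : T -> R, \sum_(t | P t) c t = 1 /\ x = \sum_(t | P t) c t *: v t.
Proof.
move: x; apply: smallest_sub => [x y t [c [c1 ->]] [d [d1 ->]]|x].
  exists (fun i => t * c i + (1 - t) * d i); split.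
    by rewrite big_split /= -!mulr_sumr c1 d1; ring.
  rewrite !scaler_sumr -big_split /=; apply: eq_bigr => i _.
  by rewrite [RHS]scalerDl !scalerA.
by move=> /conv_hull_combo[c [_ c1 ->]]; exists c.
Qed.

(* The coefficients of nearby points of the affine hull are corrected by a
   linear, hence continuous, partial inverse of the combination map.          *)
Lemma rel_interior_combo (T : finType) (P : pred T) (v : T -> 'rV[R]_n)
    (c : T -> R) :
  (forall t, P t -> 0 < c t) -> \sum_(t | P t) c t = 1 ->
  rel_interior (conv_hull [set v t | t in [set t | P t]])
    (\sum_(t | P t) c t *: v t).
Proof.
move=> c0 c1; set V := [set _ | _ in _]; pose x : 'rV[R]_n := \sum_(t | P t) c t *: v
  t; rewrite -/x.
have Vv t : P t -> V (v t) by move=> Pt; exists t.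
split; first by apply: conv_hull_sum => // t /c0/ltW.
(* The extra column of ones records the sum of the coefficients: solving for [(y - x, 0)] gives
   corrections that move [x] to [y] and sum to 0. *)
pose B : 'M[R]_(#|T|, n + 1) := \matrix_i
  (if P (enum_val i) then row_mx (v (enum_val i)) 1 else 0).
have BE (e : 'rV[R]_#|T|) : e *m B =
    \sum_(t | P t) e 0 (enum_rank t) *: row_mx (v t) 1.
  rewrite mulmx_sum_row (reindex (@enum_rank T)) /=; last first.
    by exists enum_val => ? _; rewrite ?enum_rankK ?enum_valK.
  rewrite [RHS]big_mkcond; apply: eq_bigr => t _.
  by rewrite rowK enum_rankK; case: ifP; rewrite ?scaler0.
pose e y := row_mx (y - x) 0 *m pinvmx B.
have FF : Filter (nbhs x) := nbhs_filter x.
have near_e : forall t, \forall y \near x, P t -> 0 < c t + e y 0 (enum_rank t).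
  move=> t; case: (boolP (P t)) => [Pt|_]; last by apply: (filterE (F := nbhs x)).
  have cont : (fun y => c t + e y 0 (enum_rank t)) @ x --> c t + e x 0 (enum_rank t).
    apply: cvgD; first exact: cvg_cst.
    under eq_cvg do rewrite /e mxE.
    rewrite /e mxE; apply: (cvg_big (op := +%R)).
      by move=> u; exact: add_continuous.
    move=> j _; apply: cvgM; last exact: cvg_cst.
    case: (split_ordP j) => k ->.
      under eq_cvg do rewrite row_mxEl !mxE.
      rewrite row_mxEl !mxE; apply: cvgB; last exact: cvg_cst.
      exact: coord_continuous.
    under eq_cvg do rewrite row_mxEr.
    rewrite row_mxEr; exact: cvg_cst.
  have pos : 0 < c t + e x 0 (enum_rank t).
    by rewrite /e subrr row_mx0 mul0mx mxE addr0 c0.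
  have h := cvgr_gt _ cont _ pos.
  by apply: filterS (h _) => y.
have : \forall y \near x, forall t, P t -> 0 < c t + e y 0 (enum_rank t).
  exact: (@filter_forall _ T (fun t y => P t -> 0 < c t + e y 0 (enum_rank t)) _ FF
    near_e).
apply: filterS => y hy /affine_hull_combo[d [d1 yE]].
have [eB] : e y *m B = row_mx (y - x) 0.
  rewrite /e mulmxKpV//.
  have -> : row_mx (y - x) 0 = (\row_i (d (enum_val i) - c (enum_val i))) *m B.
    rewrite BE; apply/esym; under eq_bigr do rewrite mxE enum_rankK scale_row_mx.
    rewrite sum_row_mx; congr row_mx.
      rewrite yE /x -sumrB; apply: eq_bigr => t _; exact: scalerBl.
    by rewrite -scaler_suml sumrB d1 c1 subrr scale0r.
  exact: submxMl.
move: eB; rewrite BE; under eq_bigr do rewrite scale_row_mx.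
rewrite sum_row_mx => /eq_row_mx[e1 e2].
have -> : y = \sum_(t | P t) (c t + e y 0 (enum_rank t)) *: v t.
  under eq_bigr do rewrite scalerDl.
  by rewrite big_split /= e1 -/x addrC subrK.
apply: conv_hull_sum => //; first by move=> t /hy/ltW.
rewrite big_split /= c1; move/eqP: e2.
by rewrite -scaler_suml scaler_eq0 oner_eq0 orbF => /eqP ->; rewrite addr0.
Qed.

(** Used to make inequalities strict: if a linear inequality on [A] is tight at the relative
    interior point [x] but not at [z], prolonging the segment from [z] beyond [x] violates it. *)
Lemma rel_interior_push A x z : rel_interior A x -> A z ->
  exists2 e : R, 0 < e & A (x + e *: (x - z)).
Proof.
move=> [Ax near_x] Az.
have cont : (fun e : R => x + e *: (x - z)) @ 0 --> x + 0 *: (x - z).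
  by apply: cvgD; [exact: cvg_cst|apply: cvgZr_tmp; exact: cvg_id].
rewrite scale0r addr0 in cont.
have /nbhs_ballP[d /= d0 hd] := cont _ near_x.
exists (d / 2); first by rewrite divr_gt0.
apply: (hd (d / 2)).
  rewrite /ball /= sub0r normrN gtr0_norm ?divr_gt0//.
  by rewrite ltr_pdivrMr// mulr_natr mulr2n ltrDl.
have -> : x + d / 2 *: (x - z) = (1 + d / 2) *: x + (1 - (1 + d / 2)) *: z.
  rewrite [1 - _](_ : _ = - (d / 2)); last by ring.
  by rewrite scalerBr scalerDl scale1r scaleNr addrA.
by move=> B [aB AB]; apply: aB; apply: AB.
Qed.

End ConvexHull.

(** * Exponential weights with prescribed mean *)

Section Gibbs.
Variables (R : realType) (n : nat).
Implicit Types (x u : 'rV[R]_n).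

Definition dotr u x : R := \sum_j u 0 j * x 0 j.

Lemma dotrB u x y : dotr u (x - y) = dotr u x - dotr u y.
Proof. by rewrite /dotr -sumrB; apply: eq_bigr => j _; rewrite !mxE mulrBr. Qed.

Lemma dotrZ u a x : dotr u (a *: x) = a * dotr u x.
Proof. by rewrite /dotr mulr_sumr; apply: eq_bigr => j _; rewrite !mxE mulrCA. Qed.

Lemma dotr_sum (T : finType) (P : pred T) u (v : T -> 'rV[R]_n) :
  dotr u (\sum_(t | P t) v t) = \sum_(t | P t) dotr u (v t).
Proof.
rewrite /dotr exchange_big; apply: eq_bigr => j _.
by rewrite summxE mulr_sumr.
Qed.

Lemma dotr_delta j x : dotr (\row_i (i == j)%:R) x = x 0 j.
Proof.
rewrite /dotr (bigD1 j)//= mxE eqxx mul1r big1 ?addr0// => i /negbTE ij.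
by rewrite mxE ij mul0r.
Qed.

(** Subtract exp(u . x) times the first equation from the second and pair with [u]: the sum of the
    [d t] vanishes, while each is nonnegative because exp is increasing. *)
Lemma gibbs_unique (T : finType) (P : pred T) (v : T -> 'rV[R]_n) (w : T -> R)
    x u :
  (forall t, P t -> 0 < w t) ->
  \sum_(t | P t) w t *: (v t - x) = 0 ->
  \sum_(t | P t) (w t * expR (dotr u (v t))) *: (v t - x) = 0 ->
  forall t, P t -> dotr u (v t) = dotr u x.
Proof.
move=> w0 e1 e2.
pose d t := w t * ((expR (dotr u (v t)) - expR (dotr u x)) * (dotr u (v t) - dotr u x)).
have d0 t : P t -> 0 <= d t.
  move=> Pt; rewrite mulr_ge0 ?(ltW (w0 _ _))//.
  have [le|/ltW le] := lerP (dotr u x) (dotr u (v t)).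
    by rewrite mulr_ge0 ?subr_ge0 ?ler_expR.
  by rewrite mulr_le0 ?subr_le0 ?ler_expR.
have ds : \sum_(t | P t) d t = 0.
  have : dotr u (\sum_(t | P t) (w t * expR (dotr u (v t))) *: (v t - x)
     - expR (dotr u x) *: \sum_(t | P t) w t *: (v t - x)) = 0.
    by rewrite e1 e2 scaler0 subr0 /dotr big1// => j _; rewrite mxE mulr0.
  move=> e; rewrite -[RHS]e scaler_sumr -sumrB dotr_sum.
  apply: eq_bigr => t _.
  by rewrite scalerA -scalerBl dotrZ dotrB /d; ring.
move=> t Pt; have /eqP := psumr_eq0P d0 ds Pt.
rewrite !mulf_eq0 gt_eqF ?w0//= !subr_eq0 => /orP[|]/eqP//.
exact: expR_inj.
Qed.

(** Minimise the sum of w_t exp(a_t) over the vectors a_t = u . (v_t - x); the equation is the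
    vanishing of the derivative. Compactness comes from the relation that the sum of c_t a_t is 0
    with all c_t positive: upper bounds on the a_t imply lower bounds. *)
Lemma gibbs_exists N (v : 'I_N -> 'rV[R]_n) (w c : 'I_N -> R) :
  (forall t, 0 < w t) -> (forall t, 0 < c t) -> \sum_t c t = 1 ->
  exists u, \sum_t (w t * expR (dotr u (v t))) *: (v t - \sum_t c t *: v t) = 0.
Proof.
move=> w0 c0 c1; set x := \sum_t _.
pose M : 'M[R]_(n, N) := \matrix_(j, t) (v t - x) 0 j.
have ME u t : (u *m M) 0 t = dotr u (v t - x).
  by rewrite mxE; apply: eq_bigr => j _; rewrite !mxE.
have Mc u : \sum_t c t * (u *m M) 0 t = 0.
  under eq_bigr do rewrite ME -dotrZ.
  rewrite -dotr_sum; under eq_bigr do rewrite scalerBr.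
  by rewrite sumrB -scaler_suml c1 scale1r subrr /dotr big1// => j _; rewrite mxE mulr0.
pose F (a : 'rV[R]_N) := \sum_t w t * expR (a 0 t).
pose W := \sum_t w t.
have wW t : w t <= W by rewrite /W (bigD1 t)//= lerDl sumr_ge0// => i _; apply: ltW.
have F0 : F 0 = W by apply: eq_bigr => t _; rewrite mxE expR0 mulr1.
(* Above this value the single term [t] already exceeds F(0) = W. *)
pose hi t := ln (W / w t).
have hiE t : w t * expR (hi t) = W.
  rewrite lnK; first by rewrite mulrCA divff ?mulr1// gt_eqF.
  by rewrite posrE divr_gt0// (lt_le_trans (w0 t)).
have hi0 t : 0 <= hi t by rewrite ln_ge0// ler_pdivlMr// mul1r.
pose H := \sum_t c t * hi t.
(* Membership in the row space of [M] is written as a kernel condition, which is closed. *)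
pose C := [set a : 'rV[R]_N | a *m cokermx M = 0 /\ forall t, a 0 t <= hi t].
have subC a : a *m cokermx M = 0 -> exists u, a = u *m M.
  by move=> /eqP; rewrite -submxE => /submxP.
have lo a t : C a -> - H / c t <= a 0 t.
  move=> [/subC[u ->]] ahi; rewrite ler_pdivrMr// mulrC.
  have HE : H = c t * hi t + \sum_(i | i != t) c i * hi i by rewrite /H (bigD1 t).
  have := Mc u; rewrite (bigD1 t)//= HE.
  have : \sum_(i | i != t) c i * (u *m M) 0 i <= \sum_(i | i != t) c i * hi i.
    by apply: ler_sum => i _; rewrite ler_pM2l.
  have := mulr_ge0 (ltW (c0 t)) (hi0 t); lra.
have mulcont (K : 'M[R]_N) j : continuous (fun a : 'rV[R]_N => (a *m K) 0 j).
  rewrite (_ : (fun _ => _) = (fun a : 'rV[R]_N => \sum_i a 0 i * K i j)); last first.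
    by apply/funext => a; rewrite mxE.
  move=> a; have FF : Filter (nbhs a) := nbhs_filter a.
  apply: (cvg_big (op := +%R)); first by move=> ?; exact: add_continuous.
  by move=> i _; apply: cvgM; [exact: coord_continuous|exact: cvg_cst].
have Ccl : closed C.
  rewrite (_ : C = \bigcap_j [set a | (a *m cokermx M) 0 j = 0] `&`
      \bigcap_t [set a | a 0 t <= hi t]).
    apply: closedI; apply: closed_bigI => j _.
      by have /continuous_closedP/(_ _ (@closed_eq _ 0)) := mulcont (cokermx M) j.
    have /continuous_closedP := @coord_continuous R 1 N 0 j.
    by move=> /(_ _ (@closed_le _ (hi j))).
  apply/seteqP; split=> [a [e h]|a [e h]]; split=> //.
  - by move=> j _ /=; rewrite e mxE.
  - by move=> t _; exact: h.
  - by apply/rowP => j; rewrite (e j)// mxE.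
  - by move=> t; exact: h.
have Cco : compact C.
  apply: (subclosed_compact Ccl
    (@rV_compact R N (fun t => `[- H / c t, hi t]%classic) _)).
    by move=> t; exact: segment_compact.
  by move=> a Ca t /=; rewrite in_itv /= lo//=; exact: Ca.2.
have Fcont : continuous F.
  move=> a; have FF : Filter (nbhs a) := nbhs_filter a.
  apply: (cvg_big (op := +%R)); first by move=> ?; exact: add_continuous.
  move=> t _; apply: cvgM; first exact: cvg_cst.
  apply: cvg_comp; first exact: coord_continuous.
  exact: continuous_expR.
have C0 : C 0 by split=> [|t]; rewrite ?mul0mx// mxE.
have [a] := EVT_min_rV (ex_intro _ 0 C0) Cco (continuous_subspaceT Fcont).
rewrite inE => Ca amin.
have Fmin b : b *m cokermx M = 0 -> F a <= F b.
  move=> bM; have [h|] := pselect (forall t, b 0 t <= hi t).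
    by apply: amin; rewrite inE.
  move=> /existsNP[t /negP]; rewrite -ltNge => ht.
  apply: (le_trans (amin 0 _)); first by rewrite inE.
  rewrite F0 -(hiE t) /F (bigD1 t)//= -[leLHS]addr0 lerD//.
    by rewrite ler_pM2l// ler_expR ltW.
  by apply: sumr_ge0 => i _; rewrite mulr_ge0 ?expR_ge0 ?ltW.
have [u au] := subC _ Ca.1.
have crit u' : \sum_t w t * expR (a 0 t) * dotr u' (v t - x) = 0.
  pose b := u' *m M.
  pose f := \sum_t (fun s : R => w t * expR (a 0 t + s * b 0 t)).
  have fE s : f s = F (a + s *: b).
    by rewrite /f fct_sumE; apply: eq_bigr => t _; rewrite !mxE.
  have df (s : R) : is_derive s 1 f (\sum_t w t * (b 0 t * expR (a 0 t + s * b 0 t))).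
    apply: is_derive_sum => t.
    apply: is_derive_eq.
    by rewrite /GRing.scale /=; ring.
  have d0 : is_derive (0 : R) 1 f 0.
    apply: (@derive1_at_min _ f (-1) 1).
    - lra.
    - by move=> s _; case: (df s).
    - by rewrite in_itv /= ltrN10 ltr01.
    - move=> s _; rewrite !fE scale0r addr0; apply: Fmin.
      rewrite mulmxDl Ca.1 add0r -scalemxAl.
      by rewrite -mulmxA mulmx_coker mulmx0 scaler0.
  have := @derive_val _ _ _ _ _ _ _ (df 0); rewrite (@derive_val _ _ _ _ _ _ _ d0).
  move=> e; rewrite [RHS]e; apply: eq_bigr => t _.
  by rewrite mul0r addr0 -ME -/b; ring.
exists u.
(* The minimisation has exponents u . (v_t - x), the statement u . v_t; they differ by a constant
   factor. *)
have scal t : expR (dotr u (v t)) = expR (dotr u x) * expR (a 0 t).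
  by rewrite au ME dotrB -expRD addrC subrK.
apply/rowP => j; rewrite summxE mxE.
have := crit (\row_i (i == j)%:R).
move=> /(congr1 (fun r => expR (dotr u x) * r)); rewrite mulr0 mulr_sumr => e;
  rewrite -[RHS]e.
apply: eq_bigr => t _; rewrite mxE scal.
by rewrite dotr_delta; ring.
Qed.
End Gibbs.

(** * Minors of two-row matrices *)

Section Minors.
Variables (K : fieldType) (n : nat).
Implicit Types (A B : 'M[K]_(2, n)) (M : 'M[K]_2).

Definition minor A i j := A 0 i * A 1 j - A 0 j * A 1 i.

Lemma minorC A i j : minor A j i = - minor A i j.
Proof. by rewrite /minor opprB. Qed.

Lemma minor_ii A i : minor A i i = 0.
Proof. by rewrite /minor subrr. Qed.

Lemma mul2E m (x : 'M[K]_(m, 2)) A i j : (x *m A) i j = x i 0 * A 0 j + x i 1 * A 1 j.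
Proof. by rewrite mxE big_ord_recl big_ord1 (_ : lift ord0 ord0 = 1)//;
  exact/val_inj. Qed.

Lemma det2E M : \det M = M 0 0 * M 1 1 - M 0 1 * M 1 0.
Proof.
rewrite (expand_det_row M 0) big_ord_recl big_ord1 /cofactor !det_mx11 !mxE /=.
have -> : lift 0 0 = 1 :> 'I_2 by exact/val_inj.
have -> : lift 1 0 = 0 :> 'I_2 by exact/val_inj.
by rewrite expr0 expr1; ring.
Qed.

Lemma minor_mul M A i j : minor (M *m A) i j = \det M * minor A i j.
Proof. by rewrite det2E /minor !mul2E; ring. Qed.

Lemma minor_diag A t i j : minor (A *m diag_mx t) i j = t 0 i * t 0 j * minor A i j.
Proof. by rewrite /minor mul_mx_diag !mxE; ring. Qed.

(** Each entry of column [j] times the minor of [i] and [k] is a combination of the two given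
    minors. A zero column is parallel to everything, so transitivity has to pass through a nonzero
    one. *)
Lemma minor_trans A i j k : minor A i j = 0 -> minor A j k = 0 ->
  (A 0 j != 0) || (A 1 j != 0) -> minor A i k = 0.
Proof.
rewrite /minor => e1 e2.
have h0 : A 0 j * minor A i k = 0.
  rewrite (_ : _ * _ = A 0 k * (A 0 i * A 1 j - A 0 j * A 1 i)
    + A 0 i * (A 0 j * A 1 k - A 0 k * A 1 j)).
    by rewrite e1 e2 !mulr0 addr0.
  by rewrite /minor; ring.
have h1 : A 1 j * minor A i k = 0.
  rewrite (_ : _ * _ = A 1 k * (A 0 i * A 1 j - A 0 j * A 1 i)
    + A 1 i * (A 0 j * A 1 k - A 0 k * A 1 j)).
    by rewrite e1 e2 !mulr0 addr0.
  by rewrite /minor; ring.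
case/orP => [j0|j1].
  by move/eqP: h0; rewrite mulf_eq0 (negbTE j0) => /eqP.
by move/eqP: h1; rewrite mulf_eq0 (negbTE j1) => /eqP.
Qed.

Lemma minor_neq0_col A i j : minor A i j != 0 -> (A 0 i != 0) || (A 1 i != 0).
Proof.
rewrite /minor; apply: contraNT; rewrite negb_or !negbK => /andP[/eqP-> /eqP->].
by rewrite mul0r mulr0 subrr.
Qed.

Lemma ord2P (P : 'I_2 -> Prop) : P 0 -> P 1 -> forall i, P i.
Proof.
move=> P0 P1 [[|[|i]] hi]//.
  by rewrite (_ : Ordinal hi = 0)//; exact/val_inj.
by rewrite (_ : Ordinal hi = 1)//; exact/val_inj.
Qed.

Lemma rank2P A : reflect (exists i j, minor A i j != 0) (\rank A == 2).
Proof.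
apply: (iffP idP) => [rA|[i [j m0]]].
  have fA : row_free A by [].
  apply: contrapT => h.
  have h' i j : minor A i j = 0.
    by apply/eqP/negPn/negP => m0; apply: h; exists i, j.
  have inj (x : 'rV[K]_2) : x *m A = 0 -> x = 0.
    by move=> xA; apply: (row_free_inj fA); rewrite mul0mx.
  have A0 i : A 0 i = 0.
    (* When all minors vanish, the row (- A 1 i, A 0 i) kills [A]; this forces the top row of [A] to
       be 0. *)
    have /(congr1 (fun x : 'rV_2 => x 0 1)) : (\row_k (if k == 0 then - A 1 i else A
      0 i)) = 0 :> 'rV[K]_2.
      apply: inj; apply/rowP => j; rewrite mul2E !mxE /=.
      by rewrite -(h' i j) /minor; ring.
    by rewrite !mxE.
  have /(congr1 (fun x : 'rV_2 => x 0 0)) : (\row_k (k == 0)%:R) = 0 :> 'rV[K]_2.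
    by apply: inj; apply/rowP => j; rewrite mul2E !mxE /= A0; ring.
  by rewrite !mxE /= => /eqP; rewrite oner_eq0.
rewrite -[_ == _]/(row_free A); apply: inj_row_free => x xA.
have e k : x 0 0 * A 0 k + x 0 1 * A 1 k = 0 by rewrite -mul2E xA mxE.
have x0 : x 0 0 * minor A i j = 0.
  rewrite (_ : _ * _ = A 1 j * (x 0 0 * A 0 i + x 0 1 * A 1 i)
    - A 1 i * (x 0 0 * A 0 j + x 0 1 * A 1 j)); last by rewrite /minor; ring.
  by rewrite !e !mulr0 subr0.
have x1 : x 0 1 * minor A i j = 0.
  rewrite (_ : _ * _ = A 0 i * (x 0 0 * A 0 j + x 0 1 * A 1 j)
    - A 0 j * (x 0 0 * A 0 i + x 0 1 * A 1 i)); last by rewrite /minor; ring.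
  by rewrite !e !mulr0 subr0.
move: x0 x1 => /eqP + /eqP; rewrite !mulf_eq0 (negbTE m0) !orbF => /eqP x0 /eqP x1.
by apply/rowP; apply: ord2P; rewrite mxE.
Qed.

(** Normalising the columns [a] and [b] to the identity turns every entry into a ratio of minors, so
    [A] and [B] share one normal form. *)
Lemma minor_prop A B c : c != 0 -> \rank A = 2 ->
  (forall i j, minor B i j = c * minor A i j) ->
  exists2 M, M \in unitmx & B = M *m A.
Proof.
move=> c0 /eqP/rank2P[a [b m0]] h.
have hB : minor B a b != 0 by rewrite h mulf_neq0.
pose C (X : 'M[K]_(2, n)) : 'M[K]_2 := \matrix_(i, k) X i (if k == 0 then a else b).
have dC X : \det (C X) = minor X a b by rewrite det2E !mxE.
have uC X : minor X a b != 0 -> C X \in unitmx by rewrite unitmxE dC unitfE.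
pose N (X : 'M[K]_(2, n)) : 'M[K]_(2, n) := invmx (C X) *m X.
have NE X : minor X a b != 0 -> N X =
    \matrix_(i, j) (if i == 0 then minor X j b / minor X a b else minor X a j / minor
      X a b).
  move=> hX; apply: (canLR (mulKmx (uC X hX))).
  apply/matrixP => i j; rewrite mul2E !mxE /=.
  apply: (mulfI hX); rewrite mulrDr !mulrA.
  move: i; apply: ord2P; rewrite /minor; field; exact: hX.
exists (C B *m invmx (C A)); first by rewrite unitmx_mul unitmx_inv !uC.
rewrite -mulmxA -/(N A) (_ : N A = N B); first by rewrite mulmxA mulmxV ?mul1mx// uC.
rewrite !NE//; apply/matrixP => i j; rewrite !mxE !h.
by case: ifP => _; rewrite -mulf_div divff// mul1r.
Qed.

End Minors.

(** * Frames and the planes they span *)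

Section Frames.
Variables (R : realType) (n : nat).
Implicit Types (A B : 'M[R[i]]_(2, n)) (M : 'M[R[i]]_2) (L : {vspace 'rV[R[i]]_n}).
Implicit Types (I : {set 'I_n}) (t : 'rV[R[i]]_n).

Lemma row_spanP A (v : 'rV[R[i]]_n) :
  reflect (exists x : 'rV_2, v = x *m A) (v \in row_span A).
Proof.
have rE (x : 'rV_2) : x *m A = x 0 0 *: row 0 A + x 0 1 *: row 1 A.
  by apply/rowP => j; rewrite mul2E !mxE.
rewrite /row_span span_cons span_seq1.
apply: (iffP memv_addP) => [[_ /vlineP[a ->] [_ /vlineP[b ->] ->]]|[x ->]].
  exists (\row_k (if k == 0 then a else b)).
  by rewrite rE !mxE.
exists (x 0 0 *: row 0 A); first exact: memvZ (memv_line _).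
by exists (x 0 1 *: row 1 A) => //; exact: memvZ (memv_line _).
Qed.

Lemma dim_row_span A : \rank A = 2 -> \dim (row_span A) = 2.
Proof.
move=> rA; suff : free [tuple of [:: row 0 A; row 1 A]].
  by rewrite /free /= => /eqP.
apply/freeP => k; rewrite big_ord_recl big_ord1 /= => e.
have fA : row_free A by rewrite /row_free rA.
have /rowP h : (\row_i k i) = 0.
  apply: (row_free_inj fA); rewrite mul0mx; apply/rowP => j.
  have := congr1 (fun v : 'rV_n => v 0 j) e; rewrite mul2E !mxE.
  by rewrite (_ : lift ord0 ord0 = 1)//; exact/val_inj.
by move=> i; have := h i; rewrite !mxE.
Qed.

Definition basis_frame L : 'M[R[i]]_(2, n) := \matrix_(i, j) (vbasis L)`_i 0 j.

Lemma row_span_basis L : \dim L = 2 -> row_span (basis_frame L) = L.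
Proof.
move=> dL; have := vbasisP L; have := size_tuple (vbasis L).
rewrite /row_span /basis_frame; case: (vbasis L) => -[|a [|b []]] //=; rewrite ?dL//.
move=> i0 _ /andP[/eqP <- _]; congr <<_>>%VS; congr [:: _; _].
  by apply/rowP => j; rewrite !mxE.
by apply/rowP => j; rewrite !mxE.
Qed.

Lemma rank_basis_frame L : \dim L = 2 -> \rank (basis_frame L) = 2.
Proof.
move=> dL; apply/eqP; rewrite eqn_leq rank_leq_row/= leqNgt; apply/negP => rA.
have [x x0 xA] : exists2 x : 'rV_2, x != 0 & x *m basis_frame L = 0.
  have : kermx (basis_frame L) != 0.
    by rewrite kermx_eq0 /row_free neq_ltn rA.
  move=> /rowV0Pn[x xk x0]; exists x => //; exact/sub_kermxP.
have /andP[_ fL] := vbasisP L.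
move: x0; apply/negP; rewrite negbK; apply/eqP.
have := freeP fL (fun i => x 0 (cast_ord dL i)).
have -> : \sum_(i < \dim L) x 0 (cast_ord dL i) *: (vbasis L)`_i = 0.
  apply: etrans xA; apply/rowP => j.
  rewrite summxE mxE (reindex (cast_ord (esym dL))) /=; last first.
    by exists (cast_ord dL) => i _; rewrite ?cast_ordK ?cast_ordKV.
  by apply: eq_bigr => i _; rewrite !mxE cast_ordKV.
move=> /(_ erefl) h; apply/rowP => k; rewrite mxE.
by have := h (cast_ord (esym dL) k); rewrite cast_ordKV.
Qed.

(** Injectivity of the Pluecker embedding; [c] is the determinant of the change of basis. *)
Lemma row_span_eq A B : \rank A = 2 -> \rank B = 2 ->
  row_span A = row_span B <->
  exists2 c, c != 0 & forall i j, minor B i j = c * minor A i j.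
Proof.
move=> rA rB; split=> [e|[c c0 h]].
  have [N NE] : exists N, B = N *m A.
    have hx k : exists x : 'rV_2, row k B = x *m A.
      apply/row_spanP; rewrite e; apply/row_spanP; exists (delta_mx 0 k).
      by rewrite -rowE.
    have [f fE] := choice hx; exists (\matrix_k f k).
    by apply/row_matrixP => k; rewrite row_mul rowK -fE.
  exists (\det N); last by move=> i j; rewrite NE minor_mul.
  apply/negP => /eqP dN; move/eqP/rank2P: rB => [i [j]].
  by rewrite NE minor_mul dN mul0r eqxx.
have [N uN ->] := minor_prop c0 rA h.
apply/vspaceP => v; apply/row_spanP/row_spanP => -[x ->].
  by exists (x *m invmx N); rewrite mulmxA mulmxKV.
by exists (x *m N); rewrite mulmxA.
Qed.

Lemma torus_act_row_span t A : torus_act t (row_span A) = row_span (A *m diag_mx t).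
Proof.
rewrite /torus_act /row_span limg_span /= !lfunE /= /mulmxr.
by rewrite !row_mul.
Qed.

Lemma torus_act_mul t u L : torus_act t (torus_act u L) = torus_act (\row_i (u 0 i *
  t 0 i)) L.
Proof.
apply/vspaceP => v; rewrite /torus_act -limg_comp; congr (v \in (_ @: _)%VS).
apply/lfunP => w; rewrite comp_lfunE !lfunE /= /mulmxr -mulmxA mulmx_diag.
by congr (_ *m diag_mx _); apply/rowP => i; rewrite !mxE.
Qed.

Definition pl A I : R[i] := if enum I is [:: i; j] then minor A i j else 0.

Lemma pluecker_basis L I : pluecker L I = pl (basis_frame L) I.
Proof.
rewrite /pluecker /pl /minor; case: (enum I) => [|i [|j []]]//.
by rewrite !mxE; ring.
Qed.

Lemma card2P I : #|I| = 2 ->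
  exists i j, [/\ i != j, I = [set i; j]%SET & forall A, pl A I = minor A i j].
Proof.
move=> cI; have := enum_uniq I; have := cardE I; rewrite cI /pl.
have := mem_enum I; case: (enum I) => [|i [|j []]]//= mI _.
rewrite inE andbT => ij; exists i, j; split=> //.
by apply/setP => k; rewrite -mI !inE.
Qed.

Lemma pl_card A I : #|I| != 2 -> pl A I = 0.
Proof. by rewrite cardE /pl; case: (enum I) => [|? [|? []]]. Qed.

(** [enum] lists the pair increasingly, so the sign depends on the order of [i] and [j] but not on
    [A]. *)
Lemma pl_pair i j : i != j ->
  (forall A, pl A [set i; j]%SET = minor A i j) \/
  (forall A, pl A [set i; j]%SET = - minor A i j).
Proof.
move=> ij; have [a [b [ab e h]]] := card2P (esym (etrans (esym (congr1 (fun b : bool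
  => b.+1) ij)) (esym (cards2 i j)))).
move/setP: e => e.
have := e i; have := e j; rewrite !inE !eqxx /= orbT => /esym.
case/orP => /eqP ja /esym/orP[]/eqP ia; subst.
- by rewrite eqxx in ij.
- by right=> A; rewrite h minorC.
- by left=> A; rewrite h.
- by rewrite eqxx in ij.
Qed.

Lemma pl_eq0 A i j : i != j -> (pl A [set i; j]%SET == 0) = (minor A i j == 0).
Proof. by move=> /pl_pair[] ->; rewrite ?oppr_eq0. Qed.

(** The bases of the matroid of the columns. *)
Definition sig A : {set {set 'I_n}} := [set I | pl A I != 0]%SET.

Lemma pair_sig A i j : i != j -> ([set i; j]%SET \in sig A) = (minor A i j != 0).
Proof. by move=> ij; rewrite inE pl_eq0. Qed.

Lemma sigP A I : I \in sig A ->
  exists i j, [/\ i != j, I = [set i; j]%SET & minor A i j != 0].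
Proof.
rewrite inE => pI; have /eqP/card2P[i [j [ij e h]]] : #|I| == 2.
  by apply: contraNT pI => /(pl_card A) ->.
by exists i, j; split=> //; rewrite -h.
Qed.

Lemma pluecker_row_span A : \rank A = 2 ->
  exists2 c, c != 0 & forall I, pluecker (row_span A) I = c * pl A I.
Proof.
move=> rA; have dA := dim_row_span rA.
have [c c0 h] : exists2 c, c != 0 &
    forall i j, minor (basis_frame (row_span A)) i j = c * minor A i j.
  by apply/row_span_eq; rewrite ?rank_basis_frame ?row_span_basis.
exists c => // I; rewrite pluecker_basis.
have [/card2P[i [j [_ _ e]]]|cI] := eqVneq #|I| 2; first by rewrite !e.
by rewrite !pl_card// mulr0.
Qed.

Lemma row_spanE L : \dim L = 2 -> exists2 A, \rank A = 2 & L = row_span A.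
Proof.
by move=> dL; exists (basis_frame L); rewrite ?rank_basis_frame ?row_span_basis.
Qed.

Lemma stratum_row_span sigma A : \rank A = 2 ->
  stratum sigma (row_span A) <-> sigma = sig A.
Proof.
move=> rA; have [c c0 h] := pluecker_row_span rA; split=> [[_ e]|->].
  by apply/setP => I; rewrite inE -e h mulf_eq0 (negbTE c0).
split; first exact: dim_row_span.
by move=> I; rewrite inE h mulf_eq0 (negbTE c0).
Qed.

Lemma is_stratumP sigma :
  is_stratum R sigma <-> exists2 A, \rank A = 2 & sigma = sig A.
Proof.
split=> [[L sL]|[A rA e]].
  have [A rA LA] := row_spanE sL.1; exists A => //.
  by apply/(stratum_row_span _ rA); rewrite -LA.
by exists (row_span A); apply/stratum_row_span.
Qed.

Lemma sq_absM (z w : R[i]) : sq_abs (z * w) = sq_abs z * sq_abs w.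
Proof. by case: z w => a b [c d]; rewrite /sq_abs /=; ring. Qed.

Lemma sq_abs_ge0 (z : R[i]) : 0 <= sq_abs z.
Proof. by rewrite addr_ge0 ?sqr_ge0. Qed.

Lemma sq_abs_eq0 (z : R[i]) : (sq_abs z == 0) = (z == 0).
Proof.
case: z => a b; rewrite /sq_abs paddr_eq0 ?sqr_ge0//= !sqrf_eq0.
by rewrite eq_complex.
Qed.

Lemma sq_absR (r : R) : sq_abs r%:C%C = r ^+ 2.
Proof. by rewrite /sq_abs /= expr0n addr0. Qed.

Lemma sq_abs1 : sq_abs (1 : R[i]) = 1.
Proof. by rewrite /sq_abs /=; ring. Qed.

Lemma sq_abs_gt0 (z : R[i]) : (0 < sq_abs z) = (z != 0).
Proof. by rewrite lt_neqAle sq_abs_ge0 andbT eq_sym sq_abs_eq0. Qed.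

Lemma moment_map_row_span A : \rank A = 2 ->
  moment_map (row_span A) = (\sum_(I in sig A) sq_abs (pl A I))^-1 *:
    \sum_(I in sig A) sq_abs (pl A I) *: Lambda R I.
Proof.
move=> rA; have [c c0 h] := pluecker_row_span rA.
have c0' : sq_abs c != 0 by rewrite sq_abs_eq0.
have sup I : #|I| == 2 -> I \notin sig A -> sq_abs (pl A I) = 0.
  by move=> _; rewrite inE negbK -sq_abs_eq0 => /eqP.
have subs I : I \in sig A -> #|I| == 2.
  by rewrite inE; apply: contraNT => /(pl_card A) ->.
rewrite /moment_map; under eq_bigr do rewrite h sq_absM.
rewrite -mulr_sumr; under [X in _ *: X]eq_bigr do rewrite h sq_absM -scalerA.
rewrite -scaler_sumr scalerA invfM mulrAC mulVf// mul1r.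
congr (_^-1 *: _).
  rewrite (bigID (mem (sig A))) /= [X in _ + X]big1 ?addr0; last first.
    by move=> I /andP[/sup h1 /h1].
  by apply: eq_bigl => I; case: (boolP (I \in sig A)) => [/subs->|]; rewrite ?andbF.
rewrite (bigID (mem (sig A))) /= [X in _ + X]big1 ?addr0; last first.
  by move=> I /andP[/sup h1 /h1 ->]; rewrite scale0r.
by apply: eq_bigl => I; case: (boolP (I \in sig A)) => [/subs->|]; rewrite ?andbF.
Qed.

End Frames.

(** * Chambers *)

Section Chambers.
Variables (R : realType) (n : nat).
Implicit Types (A : 'M[R[i]]_(2, n)) (x : 'rV[R]_n) (S : {set 'I_n}).

Definition csum x S : R := \sum_(i in S) x 0 i.

(** Mumford's stability criterion for weighted points of the projective line, 1 being half of the
    total weight. *)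
Definition pstable x A : Prop :=
  (forall i, exists j, minor A i j != 0) /\
  forall S, (forall i j, i \in S -> j \in S -> minor A i j = 0) -> csum x S < 1.

(** The hyperplanes [csum x S = 1] are the walls; off them stability and semistability agree. *)
Definition generic_point x : Prop :=
  [/\ forall i, 0 < x 0 i < 1, \sum_i x 0 i = 2 & forall S, csum x S != 1].

Lemma sum_pairs A (V : nmodType) (F : 'I_n * 'I_n -> V) :
  \sum_(p | minor A p.1 p.2 != 0) F p =
  \sum_(I in sig A) \sum_(p | (minor A p.1 p.2 != 0) && ([set p.1; p.2]%SET == I)) F p.
Proof.
apply: partition_big => p m0; rewrite pair_sig//.
by apply: contraNneq m0 => ->; rewrite minor_ii.
Qed.

(* Brewer's sampling weights: a probability on the pairs of non-parallel columns
   for which column [i] is drawn with probability [x 0 i].                     *)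
Lemma brewer x A : (forall i, 0 < x 0 i) -> \sum_i x 0 i = 2 -> pstable x A ->
  exists c : {set 'I_n} -> R, [/\ forall I, I \in sig A -> 0 < c I,
    \sum_(I in sig A) c I = 1 & x = \sum_(I in sig A) c I *: Lambda R I].
Proof.
move=> x0 x2 [nol iso].
(* The weight of the parallel class of [i]. *)
pose X i := \sum_(j | minor A i j == 0) x 0 j.
have XS i : X i = csum x [set j | minor A i j == 0]%SET.
  by apply: eq_bigl => j; rewrite inE.
have col i : (A 0 i != 0) || (A 1 i != 0).
  by have [j /minor_neq0_col] := nol i.
have par i j k : minor A i j = 0 -> (minor A i k == 0) = (minor A j k == 0).
  move=> ij; apply/eqP/eqP => h.
    by apply: (minor_trans _ h (col i)); rewrite minorC ij oppr0.
  exact: (minor_trans ij h (col j)).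
have X1 i : 0 < 1 - X i.
  rewrite subr_gt0 XS; apply: iso => j k; rewrite !inE => /eqP ij /eqP ik.
  by apply/eqP; rewrite -(par _ _ _ ij) ik.
have XE i j : minor A i j = 0 -> X j = X i.
  by move=> ij; apply: eq_bigl => k; rewrite (par _ _ _ ij).
pose T := \sum_j x 0 j / (1 - X j).
have T0 : 0 < 2 + T.
  by rewrite ltr_pwDl// sumr_ge0// => j _; rewrite divr_ge0 ?ltW.
(* The normaliser is [2 + T] because the sum over the columns not parallel to [i] is (2 - X i) / (1
   - X i) + T - X i / (1 - X i) = 2 + T. *)
pose c i j := x 0 i * x 0 j * ((1 - X i)^-1 + (1 - X j)^-1) / (2 + T).
have cpos i j : 0 < c i j.
  by rewrite /c divr_gt0// mulr_gt0 ?mulr_gt0// addr_gt0 ?invr_gt0.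
have cC i j : c i j = c j i by rewrite /c [x 0 i * _]mulrC [_^-1 + _]addrC.
have row i : \sum_(j | minor A i j != 0) c i j = x 0 i.
  rewrite -mulr_suml; apply: (canLR (mulfK _)); first by rewrite gt_eqF.
  under eq_bigr do rewrite mulrDr mulrAC -!mulrA.
  rewrite big_split /= -!mulr_sumr -mulrDr; congr (_ * _).
  have -> : \sum_(j | minor A i j != 0) x 0 j = 2 - X i.
    rewrite -x2 [\sum_j x 0 j](bigID (fun j => minor A i j == 0)) /=.
    by rewrite addrAC subrr add0r.
  have -> : \sum_(j | minor A i j != 0) x 0 j / (1 - X j) = T - X i / (1 - X i).
    rewrite /T [in RHS](bigID (fun j => minor A i j == 0)) /=.
    rewrite [in X in _ = X + _ - _](eq_bigr (fun j => x 0 j / (1 - X i))); last first.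
      by move=> j /eqP /XE ->.
    by rewrite -mulr_suml -/(X i) addrAC subrr add0r.
  by have := X1 i; move: (X i) => y y1; field; rewrite gt_eqF.
pose P (p : 'I_n * 'I_n) := minor A p.1 p.2 != 0.
have rows (F : 'I_n -> R) : \sum_(p | P p) c p.1 p.2 * F p.1 = \sum_i x 0 i * F i.
  rewrite -(pair_big_dep xpredT (fun i j => minor A i j != 0) (fun i j => c i j * F
    i)) /=.
  by apply: eq_bigr => i _; rewrite -mulr_suml row.
have cols (F : 'I_n -> R) : \sum_(p | P p) c p.1 p.2 * F p.2 = \sum_i x 0 i * F i.
  rewrite -rows [in RHS](reindex_inj (h := fun p => (p.2, p.1))) /=; last first.
    by move=> [a b] [a' b'] [-> ->].
  by apply: eq_big => [p|p _]; rewrite /P /= ?[c p.2 _]cC// minorC oppr_eq0.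
(* Over ordered pairs the [c i j] add up to the total weight 2; halving them gives a probability on
   unordered pairs. *)
exists (fun I => \sum_(p | P p && ([set p.1; p.2]%SET == I)) c p.1 p.2 / 2); split.
- move=> I /sigP[i [j [ij IE mij]]].
  rewrite (bigD1 (i, j)) /=; last by rewrite /P /= mij IE eqxx.
  apply: ltr_pwDl; first by rewrite divr_gt0.
  by apply: sumr_ge0 => p _; rewrite divr_ge0 ?ltW.
- rewrite -sum_pairs -mulr_suml.
  have := rows (fun=> 1); rewrite (eq_bigr (fun p => c p.1 p.2)); last by move=> p _;
    rewrite mulr1.
  by move=> ->; under eq_bigr do rewrite mulr1; rewrite x2 divff.
- apply/rowP => k.
  rewrite (eq_bigr (fun I => \sum_(p | P p && ([set p.1; p.2]%SET == I))
     (c p.1 p.2 / 2) *: Lambda R [set p.1; p.2]%SET)); last first.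
    by move=> I _; rewrite scaler_suml; apply: eq_bigr => p /andP[_ /eqP->].
  rewrite -sum_pairs summxE.
  rewrite (eq_bigr (fun p => 2^-1 * (c p.1 p.2 * (p.1 == k)%:R + c p.1 p.2 * (p.2 ==
    k)%:R))).
    rewrite -mulr_sumr big_split /=.
    rewrite (rows (fun i => (i == k)%:R)) (cols (fun i => (i == k)%:R)).
    rewrite (bigD1 k)//= eqxx big1; last by move=> i /negbTE ->; rewrite mulr0.
    by rewrite mulr1 addr0; field.
  move=> p Pp; rewrite !mxE !inE ![k == _]eq_sym.
  have : p.1 != p.2 by apply: contraNneq Pp => ->; rewrite minor_ii.
  have [->|_] := eqVneq p.1 k; have [->|_] := eqVneq p.2 k; rewrite ?eqxx//= => _;
    rewrite ?(addr0, add0r, mulr0, mulr1) //=; by field.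
Qed.

(** Brewer's weights are positive at every vertex, which gives the relative interior and not just
    the polytope. *)
Lemma pstable_rel_interior x A : (forall i, 0 < x 0 i) -> \sum_i x 0 i = 2 ->
  pstable x A -> rel_interior (matroid_polytope (sig A)) x.
Proof.
move=> x0 x2 /(brewer x0 x2)[c [c0 c1 {1}->]].
exact: (rel_interior_combo (P := fun I => I \in sig A) _ c0 c1).
Qed.

Lemma matroid_polytope_ind (Q : set 'rV[R]_n) A :
  (forall x y (t : R), 0 <= t <= 1 -> Q x -> Q y -> Q (t *: x + (1 - t) *: y)) ->
  (forall i j, i != j -> minor A i j != 0 -> Q (Lambda R [set i; j]%SET)) ->
  matroid_polytope (sig A) `<=` Q.
Proof.
move=> cQ h; apply: conv_hull_ind => // _ [I /= /sigP[i [j [ij -> m0]]] <-].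
exact: h.
Qed.

Lemma Lambda_polytope A i j : minor A i j != 0 ->
  matroid_polytope (sig A) (Lambda R [set i; j]%SET).
Proof.
move=> m0; apply: conv_hull_sub; exists [set i; j]%SET => //=.
by rewrite pair_sig//; apply: contraNneq m0 => ->; rewrite minor_ii.
Qed.

Lemma csum_conv x y (t : R) S :
  csum (t *: x + (1 - t) *: y) S = t * csum x S + (1 - t) * csum y S.
Proof. by rewrite /csum !mulr_sumr -big_split; apply: eq_bigr => i _; rewrite !mxE. Qed.

Lemma csum_Lambda i j S : i != j ->
  csum (Lambda R [set i; j]%SET) S = (i \in S)%:R + (j \in S)%:R.
Proof.
move=> ij; rewrite /csum big_mkcond /= (bigD1 i)//= (bigD1 j)/= 1?eq_sym//.
rewrite big1 => [|k /andP[/negbTE ki /negbTE kj]].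
  rewrite !mxE !inE !eqxx orbT addr0.
  by case: (i \in S); case: (j \in S).
by rewrite !mxE !inE ki kj; case: ifP.
Qed.

Lemma csumT x : csum x [set: 'I_n]%SET = \sum_i x 0 i.
Proof. by apply: eq_bigl => i; rewrite inE. Qed.

Lemma csumC x S : \sum_i x 0 i = 2 -> csum x (~: S)%SET = 2 - csum x S.
Proof.
move=> <-; rewrite (bigID (mem S)) /= /csum addrAC subrr add0r.
by apply: eq_bigl => i; rewrite inE.
Qed.

Lemma csum1 x i : csum x [set i]%SET = x 0 i.
Proof. by rewrite /csum big_set1. Qed.

Lemma csum_sub x S S' : (forall i, 0 < x 0 i) -> S \subset S' -> csum x S <= csum x S'.
Proof.
move=> x0 SS'; rewrite /csum [leRHS](bigID (mem S)) /=.
have -> : \sum_(i in S' | i \in S) x 0 i = \sum_(i in S) x 0 i.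
  by apply: eq_bigl => i; rewrite andb_idl//; exact: (fintype.subsetP SS').
by rewrite lerDl sumr_ge0// => i _; exact: ltW.
Qed.

Lemma polytope_csum2 x A : matroid_polytope (sig A) x -> \sum_i x 0 i = 2.
Proof.
rewrite -csumT; move: x; apply: matroid_polytope_ind => [x y t _ /= ex ey|i j ij _ /=].
  by rewrite csum_conv ex ey; ring.
by rewrite csum_Lambda// !inE.
Qed.

(** A basis has at most one element among pairwise parallel columns, so the bound holds at the
    vertices. *)
Lemma polytope_csum_iso x A S :
  (forall i j, i \in S -> j \in S -> minor A i j = 0) ->
  matroid_polytope (sig A) x -> csum x S <= 1.
Proof.
move=> iso; move: x; apply: matroid_polytope_ind => [x y t /andP[t0 t1] /= ex ey|i j
  ij m0 /=].
  by rewrite csum_conv; nra.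
rewrite csum_Lambda//; case: (boolP (i \in S)) => iS; case: (boolP (j \in S)) => jS;
  rewrite ?addr0 ?add0r ?lexx ?ler01//.
by rewrite iso ?eqxx in m0.
Qed.

Lemma polytope_coord_ge0 x A i : matroid_polytope (sig A) x -> 0 <= x 0 i.
Proof.
move: x; apply: matroid_polytope_ind => [x y t /andP[t0 t1] /= ex ey|j k _ _ /=].
  by rewrite !mxE addr_ge0 ?mulr_ge0 ?subr_ge0.
by rewrite mxE ler0n.
Qed.

Lemma polytope_coord_loop x A i : (forall j, minor A i j = 0) ->
  matroid_polytope (sig A) x -> x 0 i = 0.
Proof.
move=> loop; move: x; apply: matroid_polytope_ind => [x y t _ /= ex ey|j k jk m0 /=].
  by rewrite !mxE ex ey; ring.
rewrite mxE !inE; case: eqVneq => [e|_]; first by rewrite -e loop eqxx in m0.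
by case: eqVneq => [e|//]; rewrite minorC -e loop oppr0 eqxx in m0.
Qed.

Lemma polytope_pstable x A : generic_point x ->
  matroid_polytope (sig A) x -> pstable x A.
Proof.
move=> [x01 x2 xS] Px; split.
  move=> i; apply: contrapT => h.
  have : x 0 i = 0.
    apply: polytope_coord_loop Px => j; apply/eqP/negPn/negP => m0.
    by apply: h; exists j.
  by have /andP[+ _] := x01 i => /[swap] ->; rewrite ltxx.
by move=> S iso; rewrite lt_neqAle xS; exact: polytope_csum_iso Px.
Qed.

Definition chamber_of x : set {set {set 'I_n}} :=
  [set sigma | is_stratum R sigma /\ rel_interior (matroid_polytope sigma) x].

Lemma chamber_ofP x sigma : generic_point x -> chamber_of x sigma <->
  exists A, [/\ \rank A = 2, sigma = sig A & pstable x A].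
Proof.
move=> gx; split=> [[/is_stratumP[A rA ->] [Px _]]|[A [rA -> st]]].
  by exists A; split=> //; exact: polytope_pstable.
split; first by apply/is_stratumP; exists A.
by case: gx => x01 x2 _; apply: pstable_rel_interior => // i; case/andP: (x01 i).
Qed.

(** A test configuration for the sign of [csum x S - 1]: the columns of [S] coincide and there is no
    other coincidence, as [i.+1] is never 0. *)
Definition parallel_frame S : 'M[R[i]]_(2, n) :=
  \matrix_(k, i) (if k == 0 then 1 else if i \in S then 0 else i.+1%:R).

Lemma minor_parallel_frame S i j :
  (minor (parallel_frame S) i j == 0) = (i == j) || ((i \in S) && (j \in S)).
Proof.
rewrite /minor !mxE /= !mul1r subr_eq0.
case: (boolP (i \in S)) => iS; case: (boolP (j \in S)) => jS /=.
- by rewrite eqxx orbT.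
- rewrite pnatr_eq0 orbF /=; apply/esym/negbTE; apply: contraNneq jS => <-//.
- rewrite eq_sym pnatr_eq0 orbF /=; apply/esym/negbTE; apply: contraNneq iS => ->//.
- by rewrite orbF eqr_nat eqSS eq_sym.
Qed.

Lemma parallel_frame_pstable x S : generic_point x -> csum x S < 1 ->
  (forall i, exists j, minor (parallel_frame S) i j != 0) /\
  pstable x (parallel_frame S).
Proof.
move=> [x01 x2 xS] S1.
have x0 i : 0 < x 0 i by case/andP: (x01 i).
have nol i : exists j, minor (parallel_frame S) i j != 0.
  (* A set of weight less than 1 containing the parallel class of [i] omits some column, which is
     then not parallel to [i]. *)
  have [S' S'1 iS'] : exists2 S', csum x S' < 1 & forall j, (minor (parallel_frame S)
    i j == 0) -> j \in S'.
    have [iS|iS] := boolP (i \in S).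
      by exists S => // j; rewrite minor_parallel_frame iS => /orP[/eqP<-|].
    exists [set i]%SET; first by rewrite csum1; case/andP: (x01 i).
    by move=> j; rewrite minor_parallel_frame (negbTE iS) orbF inE eq_sym.
  have : csum x (~: S')%SET != 0 by rewrite csumC// gt_eqF// subr_gt0; lra.
  apply: contraNP => h; rewrite /csum big1// => j; rewrite inE => /negP jS'.
  by case: jS'; apply: iS'; apply/negPn/negP => m0; apply: h; exists j.
split=> //; split=> // S' iso.
have [SS|] := boolP (S' \subset S); first exact: le_lt_trans (csum_sub _ SS) S1.
move=> /fintype.subsetPn[i iS' iS].
rewrite (_ : S' = [set i]%SET) ?csum1; first by case/andP: (x01 i).
apply/setP => j; rewrite inE; apply/idP/eqP => [jS'|->//].
have /eqP := iso _ _ iS' jS'.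
by rewrite minor_parallel_frame (negbTE iS) orbF => /eqP.
Qed.

(** If [csum x0 S < 1], the stratum of [parallel_frame S] is in the chamber, so [x] lies in the
    relative interior of a polytope on which [csum S] is at most 1. Equality is excluded with a
    vertex that misses [S]. Sets of weight above 1 are reached by complementation. *)
Lemma chamber_sign x0 x : generic_point x0 -> chamber (chamber_of x0) x ->
  generic_point x /\ forall S, csum x0 S < 1 -> csum x S < 1.
Proof.
move=> gx0 cx; have [x01 x02 x0S] := gx0.
have rel S : csum x0 S < 1 ->
    rel_interior (matroid_polytope (sig (parallel_frame S))) x.
  move=> S1; apply: cx; apply/chamber_ofP => //.
  have [nol st] := parallel_frame_pstable gx0 S1.
  exists (parallel_frame S); split=> //; apply/eqP/rank2P.
  have [k _] : exists k : 'I_n, true.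
    apply: contrapT => h; move: x02; rewrite big1 => [/eqP|i _]; first by rewrite
      eq_sym pnatr_eq0.
    by case: h; exists i.
  by have [j] := nol k; exists k, j.
have S0 : csum x0 finset.set0 < 1 by rewrite /csum big_set0.
have x2 := polytope_csum2 (rel _ S0).1.
have sgn S : csum x0 S < 1 -> csum x S < 1.
  move=> S1; have rx := rel _ S1.
  have : csum x S <= 1.
    apply: polytope_csum_iso rx.1 => i j iS jS.
    by apply/eqP; rewrite minor_parallel_frame iS jS orbT.
  rewrite le_eqVlt => /orP[/eqP e|//].
  (* The complement of [S] has weight above 1 and each column has weight below 1, so two columns are
     available. *)
  have [a [b [ab aS bS]]] : exists a b, [/\ a != b, a \notin S & b \notin S].
    have cS : 1 < csum x0 (~: S)%SET by rewrite csumC//; lra.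
    have [a aS] : exists a, a \notin S.
      apply: contrapT => h; move: cS; rewrite /csum big1 ?ltr10// => i.
      by rewrite inE => iS; case: h; exists i.
    have [b [ba bS]] : exists b, b != a /\ b \notin S.
      apply: contrapT => h; move: cS; rewrite (_ : (~: S)%SET = [set a]%SET).
        by rewrite csum1; case/andP: (x01 a) => _ /lt_trans/[apply]; rewrite ltxx.
      apply/setP => b; rewrite !inE; apply/idP/eqP => [bS|->//].
      by apply: contrapT => /eqP ba; apply: h; exists b.
    by exists a, b; rewrite eq_sym.
  have m0 : minor (parallel_frame S) a b != 0.
    by rewrite minor_parallel_frame (negbTE ab) (negbTE aS).
  (* Moving away from a vertex disjoint from [S] increases [csum S], beyond 1 if it equals 1 at
     [x]. *)
  have [t t0 /(polytope_csum_iso (S := S))] := rel_interior_push rx (Lambda_polytope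
    m0).
  have -> : x + t *: (x - Lambda R [set a; b]%SET) =
     (1 + t) *: x + (1 - (1 + t)) *: Lambda R [set a; b]%SET.
    by apply/rowP => k; rewrite !mxE; ring.
  rewrite csum_conv csum_Lambda// (negbTE aS) (negbTE bS) e => h.
  have : (1 + t) * 1 + (1 - (1 + t)) * (0%:R + 0%:R) <= 1.
    apply: h => i j iS jS; by apply/eqP; rewrite minor_parallel_frame iS jS orbT.
  by rewrite addr0 mulr0; lra.
split=> //; split=> //.
- move=> i; apply/andP; split; last by rewrite -csum1 sgn// csum1; case/andP: (x01 i).
  have rx := rel _ S0; have := polytope_coord_ge0 i rx.1.
  rewrite le_eqVlt => /orP[/eqP e|//].
  have [j m0] := (parallel_frame_pstable gx0 S0).1 i.
  (* If coordinate [i] were 0, moving away from a vertex involving [i] would make it negative. *)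
  have [t t0 /(polytope_coord_ge0 i)] := rel_interior_push rx (Lambda_polytope m0).
  by rewrite !mxE -e !inE eqxx /=; lra.
- move=> S; have [S1|] := ltP (csum x0 S) 1; first by rewrite lt_eqF// sgn.
  rewrite le_eqVlt eq_sym (negbTE (x0S S))/= => S1.
  have := sgn (~: S)%SET; rewrite !csumC// => h.
  by rewrite gt_eqF//; have := h _; lra.
Qed.

Lemma pstable_chamber x0 x A : generic_point x0 -> chamber (chamber_of x0) x ->
  pstable x A <-> pstable x0 A.
Proof.
move=> gx0 cx; have [gx sgn] := chamber_sign gx0 cx.
have [_ x2 _] := gx; have [_ x02 x0S] := gx0.
split=> -[nol iso]; split=> // S /iso; last exact: sgn.
move=> S1; have := x0S S; rewrite neq_lt => /orP[//|S2].
have := sgn (~: S)%SET; rewrite !csumC// => h; have := h _; lra.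
Qed.

(** A polytope whose relative interior meets the chamber at [y] comes from a frame stable at [y],
    hence at [x], so its stratum already belongs to the collection. *)
Lemma is_chamber_of x : generic_point x -> is_chamber R (chamber_of x).
Proof.
move=> gx; split.
- by move=> sigma [].
- by exists x => sigma [].
- move=> sigma st nin; rewrite -subset0 => y [cy [Py _]]; apply: nin.
  move/is_stratumP: st => [A rA e]; rewrite e in Py *.
  apply/chamber_ofP => //; exists A; split=> //.
  apply/(pstable_chamber _ gx cy); apply: polytope_pstable => //.
  exact: (chamber_sign gx cy).1.
Qed.

Lemma generic_rel_interior x : generic_point x -> rel_interior (@hypersimplex R n) x.
Proof.
move=> [x01 x2 _]; split.
  by split=> // i; case/andP: (x01 i) => /ltW-> /ltW->.
have aff y : affine_hull (@hypersimplex R n) y -> \sum_i y 0 i = 2.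
  move: y; apply: smallest_sub; last by move=> z [].
  move=> u v t eu ev /=; rewrite -csumT csum_conv !csumT eu ev; ring.
have FF : Filter (nbhs x) := nbhs_filter x.
have nb : \forall y \near x, forall i, 0 < (y : 'rV[R]_n) 0 i < 1.
  apply: (@filter_forall _ _ (fun i (y : 'rV[R]_n) => 0 < y 0 i < 1) _ FF) => i.
  have cont : (fun y : 'rV[R]_n => y 0 i) @ x --> x 0 i by exact: coord_continuous.
  have /andP[h0 h1] := x01 i.
  have l := cvgr_gt _ cont _ h0; have r := cvgr_lt _ cont _ h1.
  by apply: filterS2 (l _) (r _) => y -> ->.
apply: filterS nb => y y01 /aff y2; split=> // i.
by case/andP: (y01 i) => /ltW-> /ltW->.
Qed.

Lemma chamber_of_hypersimplex x : generic_point x ->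
  chamber (chamber_of x) `<=` rel_interior (@hypersimplex R n).
Proof. by move=> gx y cy; apply: generic_rel_interior; exact: (chamber_sign gx cy).1.
  Qed.

End Chambers.

(** * The fibres of the moment map *)

Section MomentMap.
Variables (R : realType) (n : nat).
Local Notation subspace := {vspace 'rV[R[i]]_n}.
Implicit Types (A : 'M[R[i]]_(2, n)) (x u : 'rV[R]_n) (t : 'rV[R[i]]_n) (L : subspace).

Lemma gibbs_exists_fin (T : finType) (P : {set T}) (v : T -> 'rV[R]_n) (w c : T -> R) :
  (forall i, i \in P -> 0 < w i) -> (forall i, i \in P -> 0 < c i) ->
  \sum_(i in P) c i = 1 ->
  exists u, \sum_(i in P) (w i * expR (dotr u (v i))) *:
    (v i - \sum_(i in P) c i *: v i) = 0.
Proof.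
move=> w0 c0; rewrite big_enum_val => c1; rewrite (big_enum_val (fun i => c i *: v i)).
have [u uE] := gibbs_exists (N := #|P|) (v \o enum_val)
   (fun i => w0 _ (enum_valP i)) (fun i => c0 _ (enum_valP i)) c1.
by exists u; rewrite [LHS]big_enum_val.
Qed.

Lemma moment_mapP A x : \rank A = 2 ->
  moment_map (row_span A) = x <->
  \sum_(I in sig A) sq_abs (pl A I) *: (Lambda R I - x) = 0.
Proof.
move=> rA; rewrite moment_map_row_span//.
set W := \sum_(I in sig A) sq_abs (pl A I).
have W0 : W != 0.
  rewrite gt_eqF//; move/eqP/rank2P: rA => [i [j m0]].
  have ij : i != j by apply: contraNneq m0 => ->; rewrite minor_ii.
  have hI : [set i; j]%SET \in sig A by rewrite pair_sig.
  rewrite /W (bigD1 _ hI) /= ltr_pwDl//.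
    by rewrite sq_abs_gt0; move: hI; rewrite inE.
  by apply: sumr_ge0 => I _; exact: sq_abs_ge0.
have -> : \sum_(I in sig A) sq_abs (pl A I) *: (Lambda R I - x) =
   \sum_(I in sig A) sq_abs (pl A I) *: Lambda R I - W *: x.
  by rewrite /W scaler_suml -sumrB; apply: eq_bigr => I _; rewrite scalerBr.
split=> [<-|/eqP].
  by rewrite scalerA divff// scale1r subrr.
by rewrite subr_eq0 => /eqP ->; rewrite scalerA mulVf// scale1r.
Qed.

Lemma moment_map_polytope A : \rank A = 2 ->
  matroid_polytope (sig A) (moment_map (row_span A)).
Proof.
move=> rA; rewrite moment_map_row_span// scaler_sumr.
under eq_bigr do rewrite scalerA.
have W0 : 0 < \sum_(I in sig A) sq_abs (pl A I).
  move/eqP/rank2P: rA => [i [j m0]].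
  have ij : i != j by apply: contraNneq m0 => ->; rewrite minor_ii.
  have hI : [set i; j]%SET \in sig A by rewrite pair_sig.
  rewrite (bigD1 _ hI) /= ltr_pwDl//.
    by rewrite sq_abs_gt0; move: hI; rewrite inE.
  by apply: sumr_ge0 => I _; exact: sq_abs_ge0.
apply: conv_hull_sum.
- by move=> I _; rewrite mulr_ge0 ?sq_abs_ge0// invr_ge0 ltW.
- by move=> I hI; exists I.
- by rewrite -mulr_sumr mulVf// gt_eqF.
Qed.

Lemma rank_diag A t : (forall i, t 0 i != 0) -> \rank A = 2 -> \rank (A *m diag_mx t)
  = 2.
Proof.
move=> t0 /eqP/rank2P[i [j m0]]; apply/eqP/rank2P; exists i, j.
by rewrite minor_diag !mulf_neq0.
Qed.

Lemma sig_diag A t : (forall i, t 0 i != 0) -> sig (A *m diag_mx t) = sig A.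
Proof.
move=> t0; apply/setP => I; rewrite !inE.
have [/(card2P R)[i [j [_ _ e]]]|cI] := eqVneq #|I| 2; last by rewrite !pl_card.
by rewrite !e minor_diag !mulf_eq0 (negbTE (t0 i)) (negbTE (t0 j)).
Qed.

Lemma compact_torus_neq0 t : compact_torus t -> forall i, t 0 i != 0.
Proof. by move=> ct i; rewrite -sq_abs_eq0 (ct i) oner_neq0. Qed.

Section Orbits.
Variable D : set 'rV[R[i]]_n.
Hypothesis D1 : D (const_mx 1).
Hypothesis DM : forall t u : 'rV[R[i]]_n, D t -> D u -> D (\row_i (u 0 i * t 0 i)).
Hypothesis DV : forall t, D t -> D (\row_i (t 0 i)^-1).
Hypothesis D0 : forall t, D t -> forall i, t 0 i != 0.

Lemma torus_act1 L : torus_act (const_mx 1) L = L.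
Proof.
apply/vspaceP => v; rewrite /torus_act (_ : linfun _ = \1%VF) ?lim1g//.
by apply/lfunP => w; rewrite !lfunE /= /mulmxr diag_const_mx mulmx1.
Qed.

(** Stated for a group [D] so as to serve both the complex and the compact torus. *)
Lemma orbit_torus_eq L L' :
  orbit_of (@torus_act R n) D L = orbit_of (@torus_act R n) D L' <->
  exists2 t, D t & L' = torus_act t L.
Proof.
split=> [e|[t Dt ->]].
  have : orbit_of (@torus_act R n) D L' L' by exists (const_mx 1) => //; rewrite
    torus_act1.
  by rewrite -e => -[t Dt <-]; exists t.
apply/seteqP; split=> _ [u Du <-].
  exists (\row_i (((\row_i (t 0 i)^-1) : 'rV_n) 0 i * u 0 i)).
    by apply: DM => //; exact: DV.
  rewrite torus_act_mul; congr torus_act; apply/rowP => i; rewrite !mxE.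
  by rewrite mulrA divff ?mul1r// D0.
by rewrite torus_act_mul; exists (\row_i (t 0 i * u 0 i)) => //; exact: DM.
Qed.

Lemma mem_orbit_torus L : orbit_of (@torus_act R n) D L L.
Proof. by exists (const_mx 1) => //; exact: torus_act1. Qed.

End Orbits.

Lemma orbit_complex_eq L L' :
  orbit_of (@torus_act R n) (@complex_torus R n) L =
  orbit_of (@torus_act R n) (@complex_torus R n) L' <->
  exists2 t, complex_torus t & L' = torus_act t L.
Proof.
apply: orbit_torus_eq => //.
- by move=> i; rewrite mxE oner_neq0.
- by move=> t u ht hu i; rewrite mxE mulf_neq0.
- by move=> t ht i; rewrite mxE invr_neq0.
Qed.

Lemma compact_torus1 : @compact_torus R n (const_mx 1).
Proof. by move=> i; rewrite mxE sq_abs1. Qed.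

Lemma orbit_compact_eq L L' :
  orbit_of (@torus_act R n) (@compact_torus R n) L =
  orbit_of (@torus_act R n) (@compact_torus R n) L' <->
  exists2 t, compact_torus t & L' = torus_act t L.
Proof.
apply: orbit_torus_eq => //; last exact: compact_torus_neq0.
- exact: compact_torus1.
- by move=> t u ht hu i; rewrite mxE sq_absM ht hu mulr1.
- move=> t ht i; rewrite mxE -[LHS]mulr1 -(ht i) -sq_absM mulVf.
    by rewrite sq_abs1 ht.
  exact: compact_torus_neq0.
Qed.

Lemma moment_map_compact A t : \rank A = 2 -> compact_torus t ->
  moment_map (torus_act t (row_span A)) = moment_map (row_span A).
Proof.
move=> rA ct; have t0 := compact_torus_neq0 ct.
rewrite torus_act_row_span !moment_map_row_span ?rank_diag// sig_diag//.
have e I : sq_abs (pl (A *m diag_mx t) I) = sq_abs (pl A I).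
  have [/(card2P R)[i [j [_ _ h]]]|cI] := eqVneq #|I| 2; last by rewrite !pl_card.
  by rewrite !h minor_diag !sq_absM !ct !mul1r.
by congr (_^-1 *: _); apply: eq_bigr => I _; rewrite e.
Qed.

Lemma complexify_orbit L :
  complexify (orbit_of (@torus_act R n) (@compact_torus R n) L) =
  orbit_of (@torus_act R n) (@complex_torus R n) L.
Proof.
apply/seteqP; split=> [M [_ [t ct <-]]|M hM].
  rewrite (_ : orbit_of _ _ (torus_act t L) = orbit_of (@torus_act R n)
    (@complex_torus R n) L)//.
  by apply/esym/orbit_complex_eq; exists t => //; exact: compact_torus_neq0.
by exists L => //; apply: mem_orbit_torus; exact: compact_torus1.
Qed.

Lemma moment_fibreP x (O : set subspace) :
  moment_fibre x O <-> exists A, [/\ \rank A = 2, moment_map (row_span A) = x &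
    O = orbit_of (@torus_act R n) (@compact_torus R n) (row_span A)].
Proof.
have orb A : \rank A = 2 ->
    let O := orbit_of (@torus_act R n) (@compact_torus R n) (row_span A) in
    exists2 t, compact_torus t & xget 0%VS O = torus_act t (row_span A).
  move=> rA O'; have [|t ct e] := @xgetPex _ 0%VS O'; last by exists t.
  by exists (row_span A); apply: mem_orbit_torus; exact: compact_torus1.
split=> [[[L dL <-] /= mO]|[A [rA mA ->]]].
  have [A rA LA] := row_spanE dL; exists A; rewrite LA in mO *; split=> //.
  have [t ct e] := orb A rA.
  by rewrite -mO /moment_map_hat e moment_map_compact.
split; first by exists (row_span A) => //; exact: dim_row_span.
have [t ct e] := orb A rA.
by rewrite /= /moment_map_hat e moment_map_compact.
Qed.

(** With u_i = ln |t_i|^2 the torus action becomes an exponential reweighting of the vertices. *)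
Lemma sq_abs_diag A t I : (forall i, t 0 i != 0) -> I \in sig A ->
  sq_abs (pl (A *m diag_mx t) I) =
  sq_abs (pl A I) * expR (dotr (\row_i ln (sq_abs (t 0 i))) (Lambda R I)).
Proof.
move=> t0 /sigP[i [j [ij IE m0]]].
have [a [b [ab IE' e]]] : exists a b, [/\ a != b, I = [set a; b]%SET &
    forall A, pl A I = minor A a b] by apply: (card2P R); rewrite IE cards2 ij.
rewrite !e minor_diag !sq_absM mulrC; congr (_ * _).
rewrite /dotr (bigD1 a)//= (bigD1 b)/= 1?eq_sym// big1 => [|k /andP[/negbTE ka
  /negbTE kb]].
  rewrite IE' !mxE !inE !eqxx orbT !mulr1 addr0 expRD.
  by rewrite !lnK// posrE sq_abs_gt0.
by rewrite !mxE IE' !inE ka kb mulr0.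
Qed.

(** Uniqueness of the exponential weights makes |t_i t_j| constant over the nonzero minors, so the
    moduli of [t] act on the plane as a scalar and its phases [s] have the same effect as [t]. *)
Lemma moment_map_inj A t : \rank A = 2 -> (forall i, t 0 i != 0) ->
  moment_map (torus_act t (row_span A)) = moment_map (row_span A) ->
  exists2 s, compact_torus s & torus_act t (row_span A) = torus_act s (row_span A).
Proof.
move=> rA t0; rewrite !torus_act_row_span => /(moment_mapP _ (rank_diag t0 rA)).
rewrite sig_diag//.
under eq_bigr => I hI do rewrite sq_abs_diag//.
set u := \row_i _ => e2.
have /(moment_mapP _ rA) e1 : moment_map (row_span A) = moment_map (row_span A) by [].
have w0 I : I \in sig A -> 0 < sq_abs (pl A I) by rewrite sq_abs_gt0 inE.
have eq := gibbs_unique w0 e1 e2.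
set k := dotr u _ in eq.
pose rho i := Num.sqrt (sq_abs (t 0 i)).
have rho2 i : rho i ^+ 2 = sq_abs (t 0 i) by rewrite sqr_sqrtr ?sq_abs_ge0.
have rho0 i : 0 < rho i by rewrite sqrtr_gt0 sq_abs_gt0.
have rhoC i : (rho i)%:C%C != 0 by rewrite -sq_abs_eq0 sq_absR rho2 sq_abs_eq0.
pose s : 'rV[R[i]]_n := \row_i (t 0 i / (rho i)%:C%C).
have sq1 i : sq_abs ((rho i)%:C%C^-1) = (sq_abs (t 0 i))^-1.
  apply: (mulfI (x := sq_abs (t 0 i))); first by rewrite sq_abs_eq0.
  rewrite divff ?sq_abs_eq0// -[X in X * _]rho2 -sq_absR -sq_absM divff//.
  exact: sq_abs1.
have cs : compact_torus s.
  by move=> i; rewrite mxE sq_absM sq1 divff// sq_abs_eq0.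
exists s => //; apply: esym; rewrite torus_act_row_span.
apply/row_span_eq; rewrite ?rank_diag//; first exact: compact_torus_neq0.
exists (expR (k / 2))%:C%C.
  by rewrite -sq_abs_eq0 sq_absR sqrf_eq0 gt_eqF ?expR_gt0.
move=> i j; rewrite !minor_diag !mxE.
have [->|m0] := eqVneq (minor A i j) 0; first by rewrite !mulr0.
have ij : i != j by apply: contraNneq m0 => ->; rewrite minor_ii.
have hI : [set i; j]%SET \in sig A by rewrite pair_sig.
have rr : rho i * rho j = expR (k / 2).
  apply/eqP; rewrite -(eqrXn2 (n := 2)) ?mulr_ge0 ?expR_ge0 ?ltW//.
  rewrite exprMn !rho2 -expRM_natl mulrCA divff// mulr1 -(eq _ hI).
  have : sq_abs (pl (A *m diag_mx t) [set i; j]%SET) = sq_abs (t 0 i) * sq_abs (t 0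
    j) * sq_abs (pl A [set i; j]%SET).
    by case: (pl_pair R ij) => h; rewrite !h minor_diag -!sq_absM// mulrN.
  rewrite sq_abs_diag// mulrC => /(mulIf _) -> //.
  by rewrite sq_abs_eq0 pl_eq0.
rewrite -rr rmorphM /=; field.
by rewrite !rhoC.
Qed.

Lemma moment_map_surj A x : \rank A = 2 -> (forall i, 0 < x 0 i) ->
  \sum_i x 0 i = 2 -> pstable x A ->
  exists2 t, complex_torus t & moment_map (torus_act t (row_span A)) = x.
Proof.
move=> rA x0 x2 /(brewer x0 x2)[c [c0 c1 xE]].
have w0 I : I \in sig A -> 0 < sq_abs (pl A I) by rewrite sq_abs_gt0 inE.
have [u uE] := gibbs_exists_fin (@Lambda R n) w0 c0 c1.
(* The half is there because |t_i|^2 has to be exp(u_i). *)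
pose t : 'rV[R[i]]_n := \row_i (expR (u 0 i / 2))%:C%C.
have tE i : sq_abs (t 0 i) = expR (u 0 i).
  by rewrite mxE sq_absR -expRM_natl mulrCA divff// mulr1.
have t0 i : t 0 i != 0 by rewrite -sq_abs_eq0 tE gt_eqF ?expR_gt0.
exists t => //; rewrite torus_act_row_span; apply/moment_mapP; first exact: rank_diag.
rewrite sig_diag//; under eq_bigr => I hI do rewrite sq_abs_diag//.
rewrite (_ : \row_i ln (sq_abs (t 0 i)) = u); first by rewrite {1}xE.
by apply/rowP => i; rewrite mxE tE expRK.
Qed.

(** [c] is the determinant of a change of frame and [t] the torus element. *)
Definition torus_equiv A A' := exists (t : 'I_n -> R[i]) c, [/\ forall i, t i != 0,
  c != 0 & forall i j, minor A' i j = c * t i * t j * minor A i j].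

Lemma orbit_complex_equiv A A' : \rank A = 2 -> \rank A' = 2 ->
  orbit_of (@torus_act R n) (@complex_torus R n) (row_span A) =
  orbit_of (@torus_act R n) (@complex_torus R n) (row_span A') <-> torus_equiv A A'.
Proof.
move=> rA rA'; split.
  move=> /orbit_complex_eq[t t0]; rewrite torus_act_row_span.
  move=> /esym/(row_span_eq (rank_diag t0 rA) rA')[c c0 h].
  by exists (t 0), c; split=> // i j; rewrite h minor_diag !mulrA.
move=> [t [c [t0 c0 h]]]; apply/orbit_complex_eq; exists (\row_i t i).
  by move=> i; rewrite mxE.
apply/esym; rewrite torus_act_row_span; apply/row_span_eq => //.
  by apply: rank_diag => // i; rewrite mxE.
by exists c => // i j; rewrite h minor_diag !mxE !mulrA.
Qed.

Definition pstable_frames x : set 'M[R[i]]_(2, n) := [set A | \rank A = 2 /\ pstable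
  x A].

Lemma polyfun_minor i j : polyfun (@entry_coord R n) (fun A => minor A i j).
Proof.
have e k l : polyfun (@entry_coord R n) (fun A => A k l).
  by apply: polyfun_coord; exists k, l.
apply: polyfun_add; first exact: polyfun_mul (e _ _) (e _ _).
rewrite (_ : (fun _ => _) = (fun A : 'M[R[i]]_(2, n) => -1 * (A 0 j * A 1 i))).
  by apply: polyfun_mul; [exact: polyfun_cst|exact: polyfun_mul (e _ _) (e _ _)].
by apply/funext => A; rewrite mulN1r.
Qed.

Lemma polyfun_prod (S : Type) (K : fieldType) (coord : set (S -> K)) (J : finType)
    (P : pred J) (f : J -> S -> K) :
  (forall k, P k -> polyfun coord (f k)) ->
  polyfun coord (fun s => \prod_(k | P k) f k s).
Proof.
move=> h; rewrite (_ : (fun _ => _) = (fun s => (\big[(fun a b s => a s * b s)/(fun=>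
  1)]_(k | P k) f k) s)).
  rewrite (_ : (fun _ => _) = \big[(fun a b s => a s * b s)/(fun=> 1)]_(k | P k) f k)//.
  apply: (big_ind (polyfun coord)) => //; first exact: polyfun_cst.
  by move=> a b; exact: polyfun_mul.
apply/funext => s; elim/big_rec2: _ => // k a b _ -> //.
Qed.

(* Stability is preserved when more minors become nonzero. *)
Lemma zopen_pstable_frames x : zopen (zariski (@frames R n) (@entry_coord R n))
  (pstable_frames x).
Proof.
split=> [A []//|A [rA [nol iso]]].
exists (fun B => \prod_(p : 'I_n * 'I_n | minor A p.1 p.2 != 0) minor B p.1 p.2).
split.
- by apply: polyfun_prod => p _; exact: polyfun_minor.
- by apply/prodf_neq0 => p.
- move=> B rB /prodf_neq0 h; split=> //; split.
    by move=> i; have [j m0] := nol i; exists j; exact: (h (i, j)).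
  move=> S isoB; apply: iso => i j iS jS; apply/eqP/negPn/negP => m0.
  by have := h (i, j) m0; rewrite /= isoB ?eqxx.
Qed.

Lemma chamber_strata x0 A : generic_point x0 -> \rank A = 2 ->
  (\bigcup_(sigma in chamber_of x0) stratum sigma) (row_span A) <-> pstable x0 A.
Proof.
move=> gx rA; split=> [[sigma /(chamber_ofP _ gx)[B [rB -> stB]]]|stA].
  move=> /(stratum_row_span _ rA) /setP e.
  have me i j : (minor B i j == 0) = (minor A i j == 0).
    have [->|ij] := eqVneq i j; first by rewrite !minor_ii.
    by have := e [set i; j]%SET; rewrite !pair_sig// => /negb_inj.
  case: stB => nol iso; split=> [i|S isoS].
    by have [j] := nol i; rewrite me; exists j.
  by apply: iso => i j iS jS; apply/eqP; rewrite me isoS.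
exists (sig A); last exact/stratum_row_span.
by apply/chamber_ofP => //; exists A.
Qed.

(** Row span, restriction to stable planes, quotient by the complex torus and transport to the fibre
    each preserve presentations. The transport needs exactly one compact orbit of the fibre in each
    stable complex orbit: existence is [moment_map_surj], uniqueness [moment_map_inj]. *)
Theorem orbit_space_presented x0 x : generic_point x0 -> chamber (chamber_of x0) x ->
  exists q : 'M[R[i]]_(2, n) -> set subspace,
    presented (orbit_space_variety (chamber_of x0) x) (@frames R n) (@entry_coord R n)
      (pstable_frames x0) q /\
    forall A A', pstable_frames x0 A -> pstable_frames x0 A' ->
      q A = q A' <-> torus_equiv A A'.
Proof.
move=> gx0 cx; have [gx sgn] := chamber_sign gx0 cx.
have [x01 x2 _] := gx; have xpos i : 0 < x 0 i by case/andP: (x01 i).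
pose orbC := orbit_of (@torus_act R n) (@complex_torus R n).
have pG : presented (grassmannian R n) (@frames R n) (@entry_coord R n) (@frames R n)
  (@row_span R n).
  exact: (presented_quotient _ (presented_zariski _ _)).
pose U : set subspace := \bigcup_(sigma in chamber_of x0) stratum sigma.
have FE : (@frames R n) `&` (@row_span R n) @^-1` U = pstable_frames x0.
  by apply/seteqP; split=> A [rA] /(chamber_strata gx0 rA).
have oU : zopen (grassmannian R n) U.
  split; last first.
    by move: (zopen_pstable_frames x0); rewrite -FE.
  move=> L [sigma _ [dL _]]; have [A rA ->] := row_spanE dL.
  by exists A.
have pS := presented_subspace pG oU; rewrite FE in pS.
have pP := presented_quotient orbC pS.
have pts y : points (parameter_space R (chamber_of x0)) y <->
    exists2 A, pstable_frames x0 A & y = orbC (row_span A).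
  have [_ e _ _] := pP; rewrite -/(parameter_space R _) in e.
  by rewrite e; split=> [[A ? <-]|[A ? ->]]; exists A.
(* The inverse of [complexify] on the fibre. *)
pose r y := xget set0 [set O : set subspace | moment_fibre x O /\ complexify O = y].
have rP y : points (parameter_space R (chamber_of x0)) y ->
    moment_fibre x (r y) /\ complexify (r y) = y.
  move=> /pts[A [rA st] ->].
  have /moment_map_surj := (pstable_chamber A gx0 cx).2 st.
  move=> /(_ rA xpos x2)[t t0 mt].
  have [|] := @xgetPex _ set0 [set O : set subspace | moment_fibre x O /\ complexify
    O = orbC (row_span A)].
    exists (orbit_of (@torus_act R n) (@compact_torus R n) (torus_act t (row_span A))).
    split.
      apply/moment_fibreP; exists (A *m diag_mx t).
      by rewrite rank_diag// -torus_act_row_span.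
    by rewrite complexify_orbit; apply/esym/orbit_complex_eq; exists t.
  by [].
have pT := @presented_transport _ _ _ _ _ _ _ _ _ (moment_fibre x) (@complexify R n)
  r pP.
exists (r \o (orbC \o @row_span R n)); split; last first.
  move=> A A' FA FA'; rewrite -orbit_complex_equiv; [|exact: FA.1|exact: FA'.1].
  split=> [e|e]; last by rewrite /= /orbC e.
  have pA B : pstable_frames x0 B -> points (parameter_space R (chamber_of x0)) (orbC
    (row_span B)).
    by move=> FB; apply/pts; exists B.
  by rewrite -/orbC -(rP _ (pA _ FA)).2 -(rP _ (pA _ FA')).2; congr complexify.
apply: pT; last exact: rP.
- move=> O /moment_fibreP[A [rA mA ->]]; rewrite complexify_orbit; apply/pts.
  exists A => //; split=> //; apply/(pstable_chamber A gx0 cx).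
  by apply: polytope_pstable => //; rewrite -mA; exact: moment_map_polytope.
- move=> O O'; rewrite !inE => /moment_fibreP[A [rA mA ->]] /moment_fibreP[A' [rA'
  mA' ->]].
  rewrite !complexify_orbit => /orbit_complex_eq[t t0 e].
  apply/orbit_compact_eq; rewrite e; apply: moment_map_inj => //.
  by rewrite -e mA mA'.
Qed.

End MomentMap.

(** * Permutohedra and their toric varieties *)

Section Permutohedron.
Variables (R : realType) (m : nat).
Implicit Types (s : 'S_m.+1) (a b : 'rV[int]_m.+1) (k l : nat).
Implicit Types (i j : 'I_m.+1) (r : 'I_m).

Definition vert s : 'rV[int]_m.+1 := \row_i (s i).+1%:Z.
Definition unit_vec i : 'rV[int]_m.+1 := \row_j (j == i)%:Z.
Local Notation lat := (lattice_point_of_dilate (@permutohedron R m)).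
Local Notation "v %:V" := (map_mx (intr : int -> R) v) (at level 2, format "v %:V").

(** Weights of total mass [k] on the vertices are additive in [k] and need no division by [k]. *)
Lemma latP k a : lat k a <-> exists mu : 'S_m.+1 -> R,
  [/\ forall s, 0 <= mu s, \sum_s mu s = k%:R & a%:V = \sum_s mu s *: (vert s)%:V].
Proof.
have PE : @permutohedron R m = conv_hull [set (vert t)%:V | t in [set t | xpredT t]].
  congr conv_hull; apply/seteqP; split=> _ [s _ <-]; exists s => //;
  by apply/rowP => i; rewrite !mxE -?pmulrn.
rewrite /lattice_point_of_dilate PE; split.
  move=> [x /conv_hull_combo[c [c0 c1 ->]] ->]; exists (fun s => k%:R * c s); split.
  - by move=> s; rewrite mulr_ge0 ?c0.
  - by rewrite -mulr_sumr c1 mulr1.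
  - by rewrite scaler_sumr; apply: eq_bigr => s _; rewrite scalerA.
move=> [mu [mu0 mu1 ->]]; have [k0|k0] := posnP k.
  exists (vert 1%g)%:V; first by apply: conv_hull_sub; exists 1%g.
  rewrite k0 scale0r big1// => s _; rewrite k0 in mu1.
  by rewrite (psumr_eq0P _ mu1) ?scale0r.
have k0' : k%:R != 0 :> R by rewrite pnatr_eq0 -lt0n.
exists (\sum_s (k%:R^-1 * mu s) *: (vert s)%:V).
  apply: conv_hull_sum; [|by move=> s _; exists s|].
  - by move=> s _; rewrite mulr_ge0 ?invr_ge0.
  - by rewrite -mulr_sumr mu1 mulVf.
by rewrite scaler_sumr; apply: eq_bigr => s _; rewrite scalerA mulVKf.
Qed.

Lemma lat_vert s : lat 1 (vert s).
Proof.
apply/latP; exists (fun t => (t == s)%:R); split=> [t||].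
- by rewrite ler0n.
- by rewrite (bigD1 s)//= eqxx big1 ?addr0// => t /negbTE ->.
- rewrite (bigD1 s)//= eqxx big1 ?addr0 ?scale1r// => t /negbTE ->.
  by rewrite scale0r.
Qed.

Lemma lat_add k l a b : lat k a -> lat l b -> lat (k + l) (a + b).
Proof.
move=> /latP[mu [mu0 mu1 ea]] /latP[nu [nu0 nu1 eb]].
apply/latP; exists (fun s => mu s + nu s); split=> [s||].
- by rewrite addr_ge0.
- by rewrite big_split /= mu1 nu1 natrD.
- by rewrite map_mxD ea eb -big_split /=; apply: eq_bigr => s _; rewrite scalerDl.
Qed.

Lemma lat0 : lat 0 0.
Proof.
apply/latP; exists (fun=> 0); split=> //; first by rewrite big1.
by rewrite map_mx0 big1// => s _; rewrite scale0r.
Qed.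

Lemma lat_mul k a n : lat k a -> lat (n * k) (a *+ n).
Proof.
move=> h; elim: n => [|n IH]; first by rewrite mul0n mulr0n; exact: lat0.
by rewrite mulSn mulrS; exact: lat_add.
Qed.

Lemma lat_root s i j : (s i <= s j)%N -> lat 1 (vert s + unit_vec i - unit_vec j).
Proof.
rewrite leq_eqVlt => /orP[/eqP/val_inj/perm_inj ->|ij].
  by rewrite addrK; exact: lat_vert.
have ne : i != j by apply: contraTneq ij => ->; rewrite ltnn.
pose s' := (tperm i j * s)%g.
have s's : s' != s.
  apply: contraTneq ij => /permP/(_ i); rewrite permM tpermL => ->.
  by rewrite ltnn.
pose d : R := (s j)%:R - (s i)%:R.
have d1 : 1 <= d by rewrite /d lerBrDr addrC natr1 ler_nat.
have d0 : 0 < d by rewrite (lt_le_trans _ d1).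
(* Exchanging the values at [i] and [j] moves [vert s] by d (e_i - e_j), so mass 1 / d at the
   exchanged vertex moves it by one unit. *)
apply/latP; exists (fun t => (t == s)%:R * (1 - d^-1) + (t == s')%:R * d^-1); split=>
  [t||].
- have v0 : 0 <= d^-1 by rewrite invr_ge0 ltW.
  have v1 : 0 <= 1 - d^-1 by rewrite subr_ge0 invf_le1.
  by rewrite addr_ge0 ?mulr_ge0 ?ler0n.
- have delta u : \sum_(t : 'S_m.+1) (t == u)%:R = 1 :> R.
    by rewrite (bigD1 u)//= eqxx big1 ?addr0// => t /negbTE ->.
  by rewrite big_split /= -!mulr_suml !delta !mul1r subrK.
- rewrite (bigD1 s)//= (bigD1 s')//= !eqxx [s == s']eq_sym (negbTE s's).
  rewrite big1 => [|t /andP[/negbTE-> /negbTE->]]; last by rewrite !mul0r addr0 scale0r.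
  apply/rowP => k; rewrite !mxE permM !mul0r !mul1r addr0 add0r.
  rewrite !rmorphB !rmorphD /= -!pmulrn.
  have [->|ki] := eqVneq k i.
    rewrite tpermL (negbTE ne) mulr1n mulr0n.
    rewrite -![in (_.+1)%:R]natr1; rewrite /d in d0 *.
    by field; rewrite gt_eqF.
  have [->|kj] := eqVneq k j.
    rewrite tpermR mulr1n mulr0n -![in (_.+1)%:R]natr1; rewrite /d in d0 *.
    by field; rewrite gt_eqF.
  by rewrite tpermD 1?eq_sym// mulr0n; ring.
Qed.

Lemma lat_linear_ge (w : 'I_m.+1 -> int) (B : int) k a :
  (forall s, B <= \sum_i w i * (s i).+1%:Z) -> lat k a -> k%:Z * B <= \sum_i w i * a
    0 i.
Proof.
move=> h /latP[mu [mu0 mu1 ea]]; rewrite -(ler_int R) rmorphM rmorph_sum /=.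
have -> : \sum_i (w i * a 0 i)%:~R = \sum_s mu s * (\sum_i w i * (s i).+1%:Z)%:~R :> R.
  under [RHS]eq_bigr do rewrite rmorph_sum mulr_sumr.
  rewrite exchange_big /=; apply: eq_bigr => i _; rewrite rmorphM /=.
  move/rowP/(_ i): ea; rewrite mxE => ->; rewrite summxE mulr_sumr.
  by apply: eq_bigr => s _; rewrite !mxE rmorphM /= mulrCA.
rewrite -[k%:~R]/(k%:R) -mu1 mulr_suml; apply: ler_sum => s _.
by rewrite ler_wpM2l// ler_int.
Qed.

Lemma lat_coord k a i : lat k a -> k%:Z <= a 0 i <= k%:Z * m.+1%:Z.
Proof.
have sumi (w : int) (F : 'I_m.+1 -> int) : \sum_j (if j == i then w else 0) * F j = w
  * F i.
  rewrite (bigD1 i)//= eqxx big1 ?addr0// => j /negbTE ->.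
  by rewrite mul0r.
move=> h; apply/andP; split.
  have := @lat_linear_ge (fun j => if j == i then 1 else 0) 1 k a _ h.
  rewrite sumi mulr1 mul1r; apply=> s; rewrite sumi mul1r; lia.
have := @lat_linear_ge (fun j => if j == i then -1 else 0) (- m.+1%:Z) k a _ h.
rewrite sumi mulrN mulN1r lerN2; apply=> s; rewrite sumi mulN1r lerN2.
by rewrite lez_nat.
Qed.

Lemma lat_sum k a : lat k a -> \sum_i a 0 i = k%:Z * \sum_(i < m.+1) i.+1%:Z.
Proof.
have e s : \sum_i (s i).+1%:Z = \sum_(i < m.+1) i.+1%:Z.
  by rewrite [RHS](reindex_perm s).
move=> h; apply/eqP; rewrite eq_le; apply/andP; split; last first.
  have := @lat_linear_ge (fun=> 1) (\sum_(i < m.+1) i.+1%:Z) k a _ h.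
  under [X in _ <= X]eq_bigr do rewrite mul1r; apply=> s.
  by under [leRHS]eq_bigr do rewrite mul1r; rewrite e.
have := @lat_linear_ge (fun=> -1) (- \sum_(i < m.+1) i.+1%:Z) k a _ h.
under [X in _ <= X]eq_bigr do rewrite mulN1r.
rewrite sumrN mulrN lerN2; apply=> s.
by under [leRHS]eq_bigr do rewrite mulN1r; rewrite sumrN e.
Qed.

End Permutohedron.

(** * Polynomial functions along curves *)

Lemma poly_nonroot (K : numFieldType) (p : {poly K}) : p != 0 -> exists x, p.[x] != 0.
Proof.
move=> p0; apply: contrapT => h.
pose rs : seq K := [seq k%:R | k <- iota 0 (size p)].
have : (size rs < size p)%N.
  apply: max_poly_roots => //.
    apply/allP => x _; rewrite /root; apply/negPn/negP => px; apply: h.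
    by exists x.
  by rewrite map_inj_uniq ?iota_uniq// => i j /eqP; rewrite eqr_nat => /eqP.
by rewrite size_map size_iota ltnn.
Qed.

Lemma polyfun_curve (K : fieldType) (S : Type) (coord : set (S -> K)) (h : K -> S) f :
  (forall c, coord c -> exists p : {poly K}, forall t, c (h t) = p.[t]) ->
  polyfun coord f -> exists p : {poly K}, forall t, f (h t) = p.[t].
Proof.
move=> hc; elim=> {f} [c|c /hc//|f g _ [p hp] _ [q hq]|f g _ [p hp] _ [q hq]].
- by exists c%:P => t; rewrite hornerC.
- by exists (p + q) => t; rewrite hornerD hp hq.
- by exists (p * q) => t; rewrite hornerM hp hq.
Qed.

(** * The affine charts of the toric variety at the vertices *)

Section Cone.
Variables (R : realType) (m : nat).
Implicit Types (s : 'S_m.+1) (a b : 'rV[int]_m.+1) (k l q : nat).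
Implicit Types (i j : 'I_m.+1) (r : 'I_m) (g : nat -> 'rV[int]_m.+1 -> R[i]).
Local Notation lat := (lattice_point_of_dilate (@permutohedron R m)).
Local Notation cone := (polytope_cone (@permutohedron R m)).

(** For 0 < q <= m this is the lattice distance to a facet through the vertex [s], scaled by [k];
    these facets correspond to the sets of the [q] smallest values of [s]. The slacks are the
    exponents of the chart at [s]. *)
Definition slack s k a q : int := \sum_(i | (s i < q)%N) (a 0 i - k%:Z * (s i).+1%:Z).

Lemma prefix_sum_min s s' q :
  \sum_(i | (s i < q)%N) (s i).+1%:Z <= \sum_(i | (s i < q)%N) (s' i).+1%:Z.
Proof.
(* After subtracting [q], the indices with [t i < q] carry exactly the nonpositive terms of [t]: no
   other selection of terms of [t] has a smaller sum, and that sum does not depend on [t]. *)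
have e (t : 'S_m.+1) : \sum_(i | (t i < q)%N) ((t i).+1%:Z - q%:Z) =
    \sum_(i < m.+1 | (i < q)%N) (i.+1%:Z - q%:Z).
  by rewrite [RHS](reindex_perm t).
have : \sum_(i | (s' i < q)%N) ((s' i).+1%:Z - q%:Z) <=
       \sum_(i | (s i < q)%N) ((s' i).+1%:Z - q%:Z).
  rewrite big_mkcond [leRHS]big_mkcond; apply: ler_sum => i _.
  case: (ltnP (s' i) q) => h1; case: (ltnP (s i) q) => h2 //; clear -h1 h2.
    by lia.
  by lia.
by rewrite e -(e s) !sumrB lerD2r.
Qed.

Lemma slack_ge0 s k a q : lat k a -> 0 <= slack s k a q.
Proof.
move=> h; rewrite /slack sumrB -mulr_sumr subr_ge0.
have := @lat_linear_ge R m (fun i => (s i < q)%N%:Z) (\sum_(i | (s i < q)%N) (s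
  i).+1%:Z) k a.
have wE (F : 'I_m.+1 -> int) : \sum_i (s i < q)%N%:Z * F i = \sum_(i | (s i < q)%N) F i.
  by rewrite [RHS]big_mkcond; apply: eq_bigr => i _; case: ifP; rewrite ?mul1r ?mul0r.
by rewrite wE; apply=> // s'; rewrite wE; exact: prefix_sum_min.
Qed.

Lemma slackD s k l a b q : slack s (k + l) (a + b) q = slack s k a q + slack s l b q.
Proof.
by rewrite /slack -big_split /=; apply: eq_bigr => i _; rewrite mxE PoszD; ring.
Qed.

Lemma slack00 s q : slack s 0 0 q = 0.
Proof. by rewrite /slack big1// => i _; rewrite mxE mul0r subr0. Qed.

Lemma slack_vert s q : slack s 1 (vert s) q = 0.
Proof. by rewrite /slack big1// => i _; rewrite mxE mul1r subrr. Qed.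

Lemma slack0 s k a : slack s k a 0 = 0.
Proof. by rewrite /slack big1. Qed.

Lemma slackT s k a : lat k a -> slack s k a m.+1 = 0.
Proof.
move=> h; rewrite /slack (eq_bigl xpredT) => [|i]; last by rewrite ltn_ord.
rewrite sumrB -mulr_sumr (lat_sum h) [\sum_i (s i).+1%:Z](_ : _ = \sum_(i < m.+1)
  i.+1%:Z) ?subrr//.
by rewrite [RHS](reindex_perm s).
Qed.

Lemma slackS s k a i : slack s k a (s i).+1 = slack s k a (s i) + (a 0 i - k%:Z * (s
  i).+1%:Z).
Proof.
rewrite /slack (bigD1 i)//= addrC; congr (_ + _); apply: eq_bigl => j.
by rewrite ltnS [RHS]ltn_neqAle -(inj_eq (@perm_inj _ s)) andbC.
Qed.

Definition lo s r : 'I_m.+1 := (s^-1)%g (widen_ord (leqnSn m) r).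
Definition hi s r : 'I_m.+1 := (s^-1)%g (lift ord0 r).

Lemma s_lo s r : s (lo s r) = r :> nat. Proof. by rewrite permKV. Qed.
Lemma s_hi s r : s (hi s r) = r.+1 :> nat. Proof. by rewrite permKV. Qed.

Lemma eq_lo s r i : (i == lo s r) = (s i == widen_ord (leqnSn m) r).
Proof. by rewrite /lo; apply/eqP/eqP => [->|<-]; rewrite ?permKV ?permK. Qed.

Lemma eq_hi s r i : (i == hi s r) = (s i == lift ord0 r).
Proof. by rewrite /hi; apply/eqP/eqP => [->|<-]; rewrite ?permKV ?permK. Qed.

(** The adjacent vertex, obtained by exchanging two consecutive values of [s]. *)
Definition edge s r := vert s + unit_vec (lo s r) - unit_vec (hi s r).

Lemma lat_edge s r : lat 1 (edge s r).
Proof. by apply: lat_root; rewrite s_lo s_hi. Qed.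

(** The edge directions at a vertex form a basis of the zero-sum lattice, with the slacks as
    coordinates. Copies of the vertex are added on both sides so that all multiplicities are natural
    numbers and a point of the cone can be evaluated. *)
Lemma chart_decomposition s k a : lat k a ->
  let n r := absz (slack s k a r.+1) in
  a + vert s *+ \sum_r n r = vert s *+ k + \sum_r edge s r *+ n r.
Proof.
move=> h n; apply/rowP => i.
have nE r : (n r)%:Z = slack s k a r.+1 by rewrite gez0_abs// slack_ge0.
have mulE (v : 'rV[int]_m.+1) N : (v *+ N) 0 i = N%:Z * v 0 i.
  by rewrite mulmxnE -mulr_natl natz.
rewrite !mxE !mulE summxE -[X in X + _ = _](subrK (k%:Z * vert s 0 i)).
have PoszS : (\sum_r n r)%N%:Z = \sum_(r < m) slack s k a r.+1.
  by rewrite (big_morph Posz PoszD (erefl _)); apply: eq_bigr => r _; exact: nE.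
rewrite addrAC [RHS]addrC; congr (_ + _).
under [RHS]eq_bigr do rewrite mulE nE !mxE -[_ - _]addrA mulrDr.
rewrite big_split /= -mulr_suml PoszS addrC; congr (_ + _); first by rewrite mxE.
under eq_bigr do rewrite mulrBr.
rewrite sumrB.
(* The sum telescopes: coordinate [i] gains the slack at [s i + 1] from the edge where it is low and
   loses the slack at [s i] from the edge where it is high. The boundary slacks vanish. *)
have -> : \sum_(r < m) slack s k a r.+1 * (i == lo s r)%:Z = slack s k a (s i).+1.
  transitivity (\sum_(r < m.+1) slack s k a r.+1 * (s i == r)%:Z).
    rewrite big_ord_recr /= slackT// mul0r addr0; apply: eq_bigr => r _.
    by rewrite eq_lo.
  by rewrite (bigD1 (s i))//= eqxx mulr1 big1 ?addr0// => r; rewrite eq_sym =>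
    /negbTE ->; rewrite mulr0.
have -> : \sum_(r < m) slack s k a r.+1 * (i == hi s r)%:Z = slack s k a (s i).
  transitivity (\sum_(r < m.+1) slack s k a r * (s i == r)%:Z).
    rewrite big_ord_recl /= slack0 mul0r add0r; apply: eq_bigr => r _.
    by rewrite eq_hi.
  by rewrite (bigD1 (s i))//= eqxx mulr1 big1 ?addr0// => r; rewrite eq_sym =>
    /negbTE ->; rewrite mulr0.
by rewrite slackS mxE; ring.
Qed.

Lemma cone_mul g k l a b : cone g -> lat k a -> lat l b -> g (k + l)%N (a + b) = g k
  a * g l b.
Proof. by case=> _ + _ _ ha hb; apply. Qed.

Lemma cone_exp g k a n : cone g -> lat k a -> g (n * k)%N (a *+ n) = g k a ^+ n.
Proof.
move=> cg h; elim: n => [|n IH]; first by case: cg => g0 _ _ _; rewrite mul0n mulr0n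
  expr0.
by rewrite mulSn mulrS exprS -IH; apply: cone_mul => //; exact: lat_mul.
Qed.

Lemma cone_prod g (J : finType) (k : J -> nat) (a : J -> 'rV[int]_m.+1) :
  cone g -> (forall c, lat (k c) (a c)) ->
  lat (\sum_c k c)%N (\sum_c a c) /\
  g (\sum_c k c)%N (\sum_c a c) = \prod_c g (k c) (a c).
Proof.
move=> cg h; elim/big_rec3: _ => [|j x y z _ [lyz e]].
  by split; [exact: lat0|case: cg].
by split; [exact: lat_add|rewrite cone_mul// e].
Qed.

(** Evaluate the decomposition and cancel powers of the value at the vertex. *)
Lemma cone_chart g s k a : cone g -> g 1%N (vert s) != 0 -> lat k a ->
  g k a = g 1%N (vert s) ^+ k *
    \prod_r (g 1%N (edge s r) / g 1%N (vert s)) ^+ `|slack s k a r.+1|%N.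
Proof.
move=> cg v0 h; pose n r := `|slack s k a r.+1|%N.
have : a + vert s *+ \sum_r n r = vert s *+ k + \sum_r edge s r *+ n r.
  exact: (chart_decomposition s h).
move=> /(congr1 (g (k + \sum_r n r)%N)).
rewrite -{1}[in LHS](muln1 (\sum_r n r)%N).
rewrite cone_mul//; last by apply: lat_mul; exact: lat_vert.
rewrite cone_exp//; last exact: lat_vert.
have hl r : lat (n r) (edge s r *+ n r).
  by rewrite -[X in lat X _]muln1; apply: lat_mul; exact: lat_edge.
have [ls es] := cone_prod cg hl.
rewrite cone_mul//; last by rewrite -[X in lat X _]muln1; apply: lat_mul; exact:
  lat_vert.
rewrite es -[X in g X (vert s *+ k)]muln1 cone_exp//; last exact: lat_vert.
move=> e; apply: (mulIf (x := g 1%N (vert s) ^+ \sum_r n r)); first by rewrite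
  expf_neq0.
rewrite e -mulrA; congr (_ * _).
rewrite -prodrXr -big_split /=; apply: eq_bigr => r _.
rewrite -exprMn mulfVK// -[X in g X _]muln1 cone_exp//; exact: lat_edge.
Qed.

Definition chart_point s (c : R[i]) (x : 'I_m -> R[i]) : nat -> 'rV[int]_m.+1 -> R[i] :=
  fun k a => if `[< lat k a >] then c ^+ k * \prod_r x r ^+ `|slack s k a r.+1|%N
    else 0.

Lemma chart_point_cone s c x : c != 0 -> cone (chart_point s c x).
Proof.
move=> c0; split.
- rewrite /chart_point asboolT; last exact: lat0.
  by rewrite expr0 mul1r big1// => r _; rewrite slack00 expr0.
- move=> k l a b ha hb; rewrite /chart_point !asboolT//; last exact: lat_add.
  rewrite exprD mulrACA -big_split /=; congr (_ * _); apply: eq_bigr => r _.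
  rewrite -exprD; congr (_ ^+ _); rewrite slackD.
  by have := slack_ge0 s r.+1 ha; have := slack_ge0 s r.+1 hb; lia.
- by move=> k a h; rewrite /chart_point asboolF.
- exists 1%N, (vert s); split=> //; rewrite /chart_point asboolT; last exact: lat_vert.
  by rewrite big1 ?mulr1 ?expf_neq0// => r _; rewrite slack_vert expr0.
Qed.

Lemma cone_chart_point g s : cone g -> g 1%N (vert s) != 0 ->
  g = chart_point s (g 1%N (vert s)) (fun r => g 1%N (edge s r) / g 1%N (vert s)).
Proof.
move=> cg v0; apply/funext => k; apply/funext => a; rewrite /chart_point.
case: asboolP => h; first exact: cone_chart.
by case: cg => _ _ + _; apply.
Qed.

Definition grading_orbit g := orbit_of (@grading_act R m.+1) [set c | c != 0] g.

Lemma grading_orbit_eq g g' : grading_orbit g = grading_orbit g' <->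
  exists2 c, c != 0 & g' = grading_act c g.
Proof.
have act1 h : grading_act 1 h = h :> (nat -> 'rV[int]_m.+1 -> R[i]).
  by apply/funext => k; apply/funext => a; rewrite /grading_act expr1n mul1r.
have actM c d h : grading_act c (grading_act d h) = grading_act (c * d) h :> (nat ->
  'rV[int]_m.+1 -> R[i]).
  by apply/funext => k; apply/funext => a; rewrite /grading_act exprMn mulrA.
split=> [e|[c c0 ->]].
  have : grading_orbit g' g' by exists 1; [rewrite /= oner_neq0|rewrite act1].
  by rewrite -e => -[c c0 <-]; exists c.
apply/seteqP; split=> _ [d d0 <-].
  exists (d / c); first by rewrite /= mulf_neq0 ?invr_neq0.
  by rewrite actM divfK.
by exists (d * c); [rewrite /= mulf_neq0|rewrite actM].
Qed.

Lemma chart_orbit_eq g g' s : cone g -> cone g' ->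
  g 1%N (vert s) != 0 -> g' 1%N (vert s) != 0 ->
  (forall r, g 1%N (edge s r) / g 1%N (vert s) = g' 1%N (edge s r) / g' 1%N (vert s)) ->
  grading_orbit g = grading_orbit g'.
Proof.
move=> cg cg' v0 v0' e; apply/grading_orbit_eq.
exists (g' 1%N (vert s) / g 1%N (vert s)); first by rewrite mulf_neq0 ?invr_neq0.
rewrite [LHS](cone_chart_point cg' v0'); apply/funext => k; apply/funext => a.
rewrite /chart_point; case: asboolP => h; last first.
  by case: cg => _ _ gout _; rewrite /grading_act (gout _ _ h) mulr0.
rewrite /grading_act (cone_chart cg v0 h) mulrA -exprMn divfK//; congr (_ * _).
by apply: eq_bigr => r _; rewrite e.
Qed.

(** Spread [a] over the [M] vertices with total mass [k]. Some vertex has mass at least 1 / M, so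
    removing it from [M] copies of [a] stays in the cone, and its value divides the nonzero
    [g k a ^+ M]. *)
Lemma cone_vertex g : cone g -> exists s, g 1%N (vert s) != 0.
Proof.
move=> cg; have [_ _ gout [k [a [k0 ga]]]] := cg.
have ha : lat k a by apply: contrapT => /gout h; rewrite h eqxx in ga.
have /latP[mu [mu0 mu1 aE]] := ha.
pose M := #|{: 'S_m.+1}|.
have M0 : (0 < M)%N by apply/card_gt0P; exists 1%g.
have [s hs] : exists s, 1 <= M%:R * mu s.
  apply: contrapT => h.
  have : \sum_s M%:R * mu s < \sum_(s : 'S_m.+1) 1.
    apply: ltr_sum; last by move=> s _; rewrite ltNge; apply/negP => ?; apply: h;
      exists s.
    by apply/hasP; exists 1%g => //; rewrite mem_index_enum.
  rewrite -mulr_sumr mu1 sumr_const -/M -natrM ltr_nat.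
  by rewrite -{2}[M]muln1 ltn_pmul2l// ltnS leqNgt k0.
exists s; apply: contraTneq ga => v0.
have hb : lat (M * k).-1 (a *+ M - vert s).
  apply/latP; exists (fun t => M%:R * mu t - (t == s)%:R); split.
  - move=> t; rewrite subr_ge0; have [->//|_] := eqVneq t s.
    by rewrite mulr_ge0.
  - rewrite sumrB -mulr_sumr mu1 (bigD1 s)//= eqxx big1 => [|t /negbTE->//].
    rewrite addr0 -natrM -{1}[(M * k)%N]prednK ?muln_gt0 ?M0//.
    by rewrite -natr1 addrK.
  - rewrite map_mxB raddfMn /= aE; under eq_bigr do rewrite scalerBl.
    rewrite sumrB; congr (_ - _).
      by rewrite -scaler_nat scaler_sumr; apply: eq_bigr => t _; rewrite scalerA.
    rewrite (bigD1 s)//= eqxx scale1r big1 ?addr0// => t /negbTE ->.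
    by rewrite scale0r.
have := cone_mul cg (lat_vert R s) hb; rewrite v0 mul0r.
rewrite add1n prednK ?muln_gt0 ?M0// addrC subrK cone_exp// => /eqP.
by rewrite expf_eq0 => /andP[_ ->].
Qed.

(** Shift all chart coordinates by [t]: [f] becomes a nonzero polynomial in [t], and only finitely
    many [t] hit its zeros or annul a coordinate. *)
Lemma cone_torus_dense g f : cone g -> polyfun (@cone_coord R m.+1) f -> f g != 0 ->
  exists g', [/\ cone g', f g' != 0 & forall k a, lat k a -> g' k a != 0].
Proof.
move=> cg pf f0; have [s v0] := cone_vertex cg.
set c := g 1%N (vert s) in v0; pose x r := g 1%N (edge s r) / c.
have gE : g = chart_point s c x by exact: cone_chart_point.
pose h t := chart_point s c (fun r => x r + t).
have [|p hp] := @polyfun_curve _ _ _ h f _ pf.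
  move=> _ [k [a ->]]; rewrite /h /chart_point; case: asboolP => _; last first.
    by exists 0 => t; rewrite horner0.
  exists ((c ^+ k)%:P * \prod_r ((x r)%:P + 'X) ^+ `|slack s k a r.+1|%N) => t.
  rewrite hornerM hornerC horner_prod; congr (_ * _); apply: eq_bigr => r _.
  by rewrite horner_exp hornerD hornerC hornerX.
have p0 : p != 0.
  apply: contraNneq f0 => p0; have := hp 0; rewrite p0 horner0 => <-.
  apply/eqP; congr (f _); rewrite gE /h; congr chart_point; apply/funext => r.
  by rewrite addr0.
have [t] : exists t, (p * \prod_r ((x r)%:P + 'X)).[t] != 0.
  apply: poly_nonroot; rewrite mulf_neq0//; apply/prodf_neq0 => r _.
  by rewrite addrC -[_%:P]opprK -polyCN polyXsubC_eq0.
rewrite hornerM mulf_eq0 negb_or horner_prod => /andP[pt /prodf_neq0 xt].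
exists (h t); split; [exact: chart_point_cone|by rewrite hp|].
move=> k a la; rewrite /h /chart_point asboolT// mulf_neq0 ?expf_neq0//.
apply/prodf_neq0 => r _; rewrite expf_neq0//.
by have := xt r isT; rewrite hornerD hornerC hornerX.
Qed.

Lemma toric_presented :
  presented (toric_variety (@permutohedron R m)) cone (@cone_coord R m.+1) cone
    grading_orbit.
Proof. exact: (presented_quotient _ (presented_zariski _ _)). Qed.

End Cone.

(** * Frames as configurations of points *)

Section Configurations.
Variables (R : realType) (m : nat).
Local Notation C := R[i].
Implicit Types (A : 'M[C]_(2, m.+3)) (p q : 'I_m.+1 -> C) (i j : 'I_m.+1).
Implicit Types (a : 'rV[int]_m.+1) (s : 'S_m.+1).
Local Notation lat := (lattice_point_of_dilate (@permutohedron R m)).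
Local Notation cone := (polytope_cone (@permutohedron R m)).

(** The last two columns serve as references, sent to 0 and infinity; the others carry the
    coordinates z_i. *)
Definition light i : 'I_m.+3 := lift ord_max (lift ord_max i).
Definition heavy0 : 'I_m.+3 := lift ord_max ord_max.
Definition heavy1 : 'I_m.+3 := ord_max.

Lemma pointP (P : 'I_m.+3 -> Prop) :
  (forall i, P (light i)) -> P heavy0 -> P heavy1 -> forall k, P k.
Proof.
move=> Pl P0 P1 l; case: (unliftP ord_max l) => [k ->|-> //].
by case: (unliftP (ord_max : 'I_m.+2) k) => [i|] ->; [exact: (Pl i)|exact: P0].
Qed.

Definition frame p q : 'M[C]_(2, m.+3) := \matrix_(k, j)
  match unlift ord_max j with
  | Some j' => match unlift ord_max j' with
               | Some i => if k == 0 then p i else q i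
               | None => (k == 0)%:R
               end
  | None => (k != 0)%:R
  end.

Lemma frame_light p q i k : frame p q k (light i) = if k == 0 then p i else q i.
Proof. by rewrite mxE /light !liftK. Qed.
Lemma frame_heavy0 p q k : frame p q k heavy0 = (k == 0)%:R.
Proof. by rewrite mxE /heavy0 liftK unlift_none. Qed.
Lemma frame_heavy1 p q k : frame p q k heavy1 = (k != 0)%:R.
Proof. by rewrite mxE /heavy1 unlift_none. Qed.

Definition frameE := (frame_light, frame_heavy0, frame_heavy1).

(** Minors instead of normalised entries, so that the coordinates are polynomial on all frames. *)
Definition pcoord A i := minor A (light i) heavy1.
Definition qcoord A i := minor A heavy0 (light i).
Definition wcoord A := minor A heavy0 heavy1.

Lemma pcoord_frame p q i : pcoord (frame p q) i = p i.
Proof. by rewrite /pcoord /minor !frameE /=; ring. Qed.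
Lemma qcoord_frame p q i : qcoord (frame p q) i = q i.
Proof. by rewrite /qcoord /minor !frameE /=; ring. Qed.
Lemma wcoord_frame p q : wcoord (frame p q) = 1.
Proof. by rewrite /wcoord /minor !frameE /=; ring. Qed.

(** The three-term Pluecker relation: once [wcoord A] is nonzero, the coordinates determine the
    remaining minors. *)
Lemma minor_light A i j :
  wcoord A * minor A (light i) (light j) = pcoord A i * qcoord A j - pcoord A j *
    qcoord A i.
Proof. by rewrite /wcoord /pcoord /qcoord /minor; ring. Qed.

Lemma frame_equiv A : wcoord A != 0 -> torus_equiv A (frame (pcoord A) (qcoord A)).
Proof.
move=> W0; pose t (j : 'I_m.+3) := if unlift ord_max j is Some j' then
  if unlift ord_max j' is Some _ then 1 else (wcoord A)^-1 else (wcoord A)^-1.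
have tl i : t (light i) = 1 by rewrite /t /light !liftK.
have t0 : t heavy0 = (wcoord A)^-1 by rewrite /t /heavy0 liftK unlift_none.
have t1 : t heavy1 = (wcoord A)^-1 by rewrite /t /heavy1 unlift_none.
exists t, (wcoord A); split=> //.
  by apply: pointP => [i||]; rewrite ?tl ?t0 ?t1 ?oner_neq0 ?invr_neq0.
have e01 : minor A heavy0 heavy1 = wcoord A by [].
move=> j k; move: j k; apply: pointP => [i||]; apply: pointP => [j||];
  rewrite ?minor_ii ?mulr0// ?tl ?t0 ?t1 ?mulr1 ?divff ?mul1r//.
- by rewrite minor_light {1}/minor !frameE.
- by rewrite minorC -/(qcoord _ _) qcoord_frame minorC.
- exact: pcoord_frame.
- exact: qcoord_frame.
- by rewrite -/(wcoord _) wcoord_frame mulVf.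
- by rewrite minorC -/(pcoord _ _) pcoord_frame minorC.
- by rewrite minorC -/(wcoord _) wcoord_frame [minor A _ _]minorC -/(wcoord _) mulrN
  mulVf.
Qed.

(** [t] rescales the columns, while [c] and [d] form a diagonal matrix, which fixes 0 and infinity:
    z is multiplied by d / c. *)
Definition config_equiv p q p' q' := exists (t : 'I_m.+1 -> C) c d,
  [/\ forall i, t i != 0, c != 0, d != 0 &
      forall i, p' i = c * t i * p i /\ q' i = d * t i * q i].

Lemma config_frame_equiv p q p' q' : config_equiv p q p' q' ->
  torus_equiv (frame p q) (frame p' q').
Proof.
move=> [u [c [d [u0 c0 d0 h]]]].
pose t (j : 'I_m.+3) := if unlift ord_max j is Some j' then
  if unlift ord_max j' is Some i then u i else c^-1 else d^-1.
have tl i : t (light i) = u i by rewrite /t /light !liftK.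
have t0 : t heavy0 = c^-1 by rewrite /t /heavy0 liftK unlift_none.
have t1 : t heavy1 = d^-1 by rewrite /t /heavy1 unlift_none.
exists t, (c * d); split; last first.
  move=> j k; move: j k; apply: pointP => [i||]; apply: pointP => [j||];
    rewrite ?tl ?t0 ?t1 /minor ?frameE /= ?(h _).1 ?(h _).2; field; rewrite ?c0 ?d0//.
- by rewrite mulf_neq0.
- by apply: pointP => [i||]; rewrite ?tl ?t0 ?t1 ?invr_neq0.
Qed.

Lemma torus_equiv_config A A' : torus_equiv A A' ->
  config_equiv (pcoord A) (qcoord A) (pcoord A') (qcoord A').
Proof.
move=> [t [c [t0 c0 h]]]; exists (fun i => t (light i)), (c * t heavy1), (c * t heavy0).
split=> //; rewrite ?mulf_neq0// => i; rewrite /pcoord /qcoord !h.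
by split; ring.
Qed.

Lemma torus_equiv_pstable x A A' : torus_equiv A A' ->
  pstable_frames x A -> pstable_frames x A'.
Proof.
move=> [t [c [t0 c0 h]]] [rA [nol iso]].
have e (k l : 'I_m.+3) : (minor A' k l == 0) = (minor A k l == 0).
  by rewrite h !mulf_eq0 (negbTE c0) !(negbTE (t0 _)).
split.
  by move/eqP/rank2P: rA => [i [j m0]]; apply/eqP/rank2P; exists i, j; rewrite e.
split=> [i|S isoS]; first by have [j m0] := nol i; exists j; rewrite e.
by apply: iso => i j iS jS; apply/eqP; rewrite -e isoS.
Qed.

(* The monomial z^a in z_i = q_i / p_i, made homogeneous in each (p_i : q_i) and
   divided by the common factors of all the monomials of degree k.              *)
Definition monomial_point p q : nat -> 'rV[int]_m.+1 -> C := fun k a =>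
  if `[< lat k a >] then
    \prod_i (q i ^+ `|(a 0 i - k%:Z)%R|%N * p i ^+ `|(k%:Z * m.+1%:Z - a 0 i)%R|%N)
  else 0.

Lemma monomial_point_vert p q s : monomial_point p q 1 (vert s) =
  \prod_i (q i ^+ s i * p i ^+ (m - s i)).
Proof.
rewrite /monomial_point asboolT; last exact: lat_vert.
apply: eq_bigr => i _; rewrite mxE.
have := ltn_ord (s i); move: (nat_of_ord (s i)) => u um.
by congr (_ ^+ _ * _ ^+ _); lia.
Qed.

Lemma monomial_point_cone p q s : monomial_point p q 1 (vert s) != 0 ->
  cone (monomial_point p q).
Proof.
move=> s0; split.
- rewrite /monomial_point asboolT; last exact: lat0.
  by rewrite big1// => i _; rewrite mxE mul0r subrr !expr0 mulr1.
- move=> k l a b ha hb; rewrite /monomial_point !asboolT//; last exact: lat_add.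
  rewrite -big_split /=; apply: eq_bigr => i _.
  have := lat_coord i ha; have := lat_coord i hb; rewrite mxE.
  move: (a 0 i) (b 0 i) => x y /andP[y0 y1] /andP[x0 x1].
  rewrite mulrACA -!exprD; congr (_ ^+ _ * _ ^+ _); rewrite ?PoszD; lia.
- by move=> k a h; rewrite /monomial_point asboolF.
- by exists 1%N, (vert s).
Qed.

(** Moving a unit of exponent from [j] to [i] multiplies the monomial by z_i / z_j; cross-multiplied
    because these entries may be 0. *)
Lemma monomial_point_ratio p q k a i j : lat k a ->
  lat k (a + unit_vec i - unit_vec j) ->
  monomial_point p q k (a + unit_vec i - unit_vec j) * (q j * p i) =
  monomial_point p q k a * (q i * p j).
Proof.
move=> ha; have [->|ij] := eqVneq i j; first by rewrite addrK.
move=> hb; rewrite /monomial_point !asboolT//.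
have ji : j != i by rewrite eq_sym.
have := lat_coord i ha; have := lat_coord i hb.
have := lat_coord j ha; have := lat_coord j hb.
rewrite !(bigD1 (P := xpredT) i)//= !(bigD1 (P := fun k => k != i) j)//=.
rewrite !mxE !eqxx (negbTE ij) (negbTE ji).
have -> : \prod_(l < m.+1 | (l != i) && (l != j))
    (q l ^+ `|((a + unit_vec i - unit_vec j) 0 l - k%:Z)%R|%N *
     p l ^+ `|(k%:Z * m.+1%:Z - (a + unit_vec i - unit_vec j) 0 l)%R|%N) =
  \prod_(l < m.+1 | (l != i) && (l != j))
    (q l ^+ `|(a 0 l - k%:Z)%R|%N * p l ^+ `|(k%:Z * m.+1%:Z - a 0 l)%R|%N).
  apply: eq_bigr => l /andP[/negbTE li /negbTE lj]; rewrite !mxE li lj.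
  by rewrite addr0 subr0.
move: (a 0 i) (a 0 j) (\prod_(l < m.+1 | _) _) => x y T.
move=> /andP[y0 y1] /andP[y2 y3] /andP[x0 x1] /andP[x2 x3].
(* The coordinate bounds keep the differences nonnegative, so each absolute value changes by exactly
   one. *)
have -> : `|(x + 1 - 0 - k%:Z)%R|%N = `|(x - k%:Z)%R|%N.+1 by lia.
have -> : `|(k%:Z * m.+1%:Z - x)%R|%N = `|(k%:Z * m.+1%:Z - (x + 1 - 0))%R|%N.+1 by lia.
have -> : `|(y - k%:Z)%R|%N = `|(y + 0 - 1 - k%:Z)%R|%N.+1 by lia.
have -> : `|(k%:Z * m.+1%:Z - (y + 0 - 1))%R|%N = `|(k%:Z * m.+1%:Z - y)%R|%N.+1 by lia.
by rewrite !exprS; ring.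
Qed.

(** Each t_i occurs with exponent (a_i - k) + (k (m + 1) - a_i) = k m. Lattice points of degree [k]
    have coordinate sum proportional to [k], so the exponents of [c] and [d] are proportional to [k]
    too, and the effect is a grading action. *)
Lemma monomial_point_equiv p q p' q' : config_equiv p q p' q' ->
  grading_orbit (monomial_point p q) = grading_orbit (monomial_point p' q').
Proof.
move=> [t [c [d [t0 c0 d0 h]]]]; apply/grading_orbit_eq.
exists ((\prod_i t i) ^+ m * d ^+ (\sum_(i < m.+1) i) * c ^+ (\sum_(i < m.+1) (m - i))).
  by rewrite !mulf_neq0 ?expf_neq0//; apply/prodf_neq0.
apply/funext => k; apply/funext => a; rewrite /grading_act /monomial_point.
case: asboolP => ha; last by rewrite mulr0.
have sumE (F : 'I_m.+1 -> nat) (f : 'I_m.+1 -> int) : (forall i, (F i)%:Z = f i) ->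
    ((\sum_i F i)%N%:Z = \sum_i f i).
  by move=> e; rewrite (big_morph Posz PoszD (erefl _)); apply: eq_bigr.
have e1 : (\sum_(i < m.+1) `|(a 0 i - k%:Z)%R|%N = (\sum_(i < m.+1) i) * k)%N.
  apply/eqP; rewrite -eqz_nat PoszM (sumE _ (fun i => a 0 i - k%:Z)); last first.
    by move=> i; have := lat_coord i ha; lia.
  rewrite (sumE _ (fun i : 'I_m.+1 => i.+1%:Z - 1)) => [|i]; last by lia.
  rewrite !sumrB (lat_sum ha) !sumr_const !card_ord mulrBl mulrC; apply/eqP.
  by rewrite -[k%:Z *+ _]mulr_natr -[1 *+ _]mulr_natr !natz; ring.
have e2 : (\sum_(i < m.+1) `|(k%:Z * m.+1%:Z - a 0 i)%R|%N = (\sum_(i < m.+1) (m -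
  i)) * k)%N.
  apply/eqP; rewrite -eqz_nat PoszM (sumE _ (fun i => k%:Z * m.+1%:Z - a 0 i)); last
    first.
    by move=> i; have := lat_coord i ha; lia.
  rewrite (sumE _ (fun i : 'I_m.+1 => m.+1%:Z - i.+1%:Z)) => [|i]; last by have :=
    ltn_ord i; lia.
  rewrite !sumrB (lat_sum ha) !sumr_const !card_ord; apply/eqP.
  by rewrite -[(k%:Z * _) *+ _]mulr_natr -[m.+1%:Z *+ _]mulr_natr !natz; ring.
rewrite !exprMn -!exprM -e1 -e2 mulnC exprM -!prodrXl.
rewrite -!prodrXr -!big_split /=; apply: eq_bigr => i _.
rewrite (h i).1 (h i).2; have := lat_coord i ha.
move: (a 0 i) => x /andP[x0 x1].
have -> : t i ^+ k ^+ m = t i ^+ `|(x - k%:Z)%R|%N * t i ^+ `|(k%:Z * m.+1%:Z - x)%R|%N.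
  by rewrite -exprM -exprD; congr (_ ^+ _); lia.
by rewrite !exprMn; ring.
Qed.

Lemma polyfun_frame (S : Type) (coord : set (S -> C)) (p q : S -> 'I_m.+1 -> C) c :
  (forall i, polyfun coord (fun t => p t i)) ->
  (forall i, polyfun coord (fun t => q t i)) ->
  @entry_coord R m.+3 c -> polyfun coord (c \o (fun t => frame (p t) (q t))).
Proof.
move=> hp hq [k [l ->]]; rewrite /comp /=; move: l; apply: pointP => [i||].
- by under eq_fun do rewrite frame_light; case: (k == 0).
- by under eq_fun do rewrite frame_heavy0; exact: polyfun_cst.
- by under eq_fun do rewrite frame_heavy1; exact: polyfun_cst.
Qed.

Lemma polyfun_exp (S : Type) (K : fieldType) (coord : set (S -> K)) f k :
  polyfun coord f -> polyfun coord (fun t => f t ^+ k).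
Proof.
move=> pf; elim: k => [|k IH]; first exact: polyfun_cst.
by under eq_fun do rewrite exprS; exact: polyfun_mul.
Qed.

Lemma polyfun_monomial_point c : @cone_coord R m.+1 c ->
  polyfun (@entry_coord R m.+3)
    (c \o (fun A => monomial_point (pcoord A) (qcoord A))).
Proof.
move=> [k [a ->]]; rewrite /comp /monomial_point /=.
case: asboolP => _; last exact: polyfun_cst.
apply: polyfun_prod => i _; apply: polyfun_mul; apply: polyfun_exp;
exact: polyfun_minor.
Qed.

End Configurations.

(** * Projective space *)

Section ProjectiveChamber.
Variables (R : realType) (m : nat).
Local Notation C := R[i].
Local Notation n := m.+3.
Implicit Types (A : 'M[C]_(2, n)) (p q y : 'I_m.+1 -> C) (i j : 'I_m.+1).
Implicit Types (a : 'rV[int]_m.+1) (s : 'S_m.+1) (S : {set 'I_n}).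
Local Notation lat := (lattice_point_of_dilate (@permutohedron R m)).
Local Notation cone := (polytope_cone (@permutohedron R m)).
Local Notation heavy1 := (heavy1 m).
Local Notation heavy0 := (heavy0 m).

Let big : R := m.+2%:R / m.+3%:R.
Let small : R := m.+4%:R / (m.+3%:R * m.+2%:R).

(** Here [heavy0] has the small weight, like the light columns. The point is that big < 1 < big +
    small with total 2: nothing meets [heavy1], any m + 1 of the other columns may coincide since (m
    + 1) small = 2 - (big + small) < 1, and all m + 2 may not since 2 - big > 1. *)
Definition projective_weight : 'rV[R]_n := \row_j (if j == heavy1 then big else small).
Local Notation x0 := projective_weight.

Let n0 : 0 < m.+3%:R :> R. Proof. by rewrite ltr0n. Qed.
Let n1 : 0 < m.+2%:R :> R. Proof. by rewrite ltr0n. Qed.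
Let nE : m.+3%:R = m.+2%:R + 1 :> R. Proof. by rewrite -natr1. Qed.
Let nE' : m.+4%:R = m.+2%:R + 2 :> R. Proof. by rewrite -!natr1; ring. Qed.
Let n2 : 2 <= m.+2%:R :> R. Proof. by rewrite ler_nat. Qed.

Let sumw : big + m.+2%:R * small = 2.
Proof. by rewrite /big /small nE' nE; field; apply/andP; split; rewrite gt_eqF//;
  lra. Qed.

Let small0 : 0 < small.
Proof. by rewrite /small divr_gt0 ?mulr_gt0// ltr0n. Qed.

Let big0 : 0 < big. Proof. by rewrite divr_gt0. Qed.

Let big1' : big < 1.
Proof. by rewrite /big ltr_pdivrMr// mul1r nE; lra. Qed.

Let bs : 1 < big + small.
Proof.
have -> : big + small = 1 + 2 / (m.+3%:R * m.+2%:R).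
  by rewrite /big /small nE' nE; field; apply/andP; split; rewrite gt_eqF//; lra.
by rewrite ltrDl divr_gt0// mulr_gt0.
Qed.

Lemma csum_light S : heavy1 \notin S -> csum x0 S = #|S|%:R * small.
Proof.
move=> h; rewrite mulr_natl -sumr_const; apply: eq_bigr => j jS.
by rewrite mxE; case: eqVneq => // e; rewrite -e jS in h.
Qed.

Lemma csum_heavy1 S : heavy1 \in S -> csum x0 S = 2 - #|~: S|%:R * small.
Proof.
have x2 : \sum_i x0 0 i = 2.
  rewrite (bigD1 heavy1)//= mxE eqxx -sumw; congr (_ + _).
  rewrite (eq_bigr (fun=> small)) => [|j /negbTE h]; last by rewrite mxE h.
  by rewrite sumr_const mulr_natl cardC1 card_ord.
move=> h; rewrite -csum_light ?inE ?h// csumC//; ring.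
Qed.

Let light_lt1 k : (k <= m.+1)%N -> k%:R * small < 1.
Proof.
move=> km; have : k%:R <= m.+1%:R :> R by rewrite ler_nat.
have : m.+2%:R = m.+1%:R + 1 :> R by rewrite natr1.
by have := bs; have := sumw; have := small0; nra.
Qed.

Let light_gt1 : 1 < m.+2%:R * small.
Proof. by have := sumw; have := big1'; lra. Qed.

Lemma card_light S : heavy1 \notin S -> (#|S| <= m.+2)%N.
Proof.
move=> h; have : S \subset (~: [set heavy1])%SET.
  by apply/fintype.subsetP => j jS; rewrite !inE; apply: contraNneq h => <-.
by move/subset_leq_card; rewrite cardsC1 card_ord.
Qed.

Lemma projective_weight_generic : generic_point x0.
Proof.
have sm1 : small < 1 by have := light_lt1 (k := 1) isT; rewrite mul1r.
split.
- by move=> i; rewrite mxE; case: ifP; rewrite ?small0 ?sm1 ?big0 ?big1'.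
- have := @csum_heavy1 [set: 'I_n]%SET; rewrite inE csumT => -> //.
  by rewrite finset.setCT cards0 mul0r subr0.
- have key S : heavy1 \notin S -> csum x0 S != 1.
    move=> h; rewrite csum_light//; have := card_light h.
    rewrite leq_eqVlt => /orP[/eqP ->|lt]; first by rewrite gt_eqF.
    by rewrite lt_eqF// light_lt1.
  move=> S; have [h|h] := boolP (heavy1 \in S); last exact: key.
  have hC : heavy1 \notin (~: S)%SET by rewrite inE h.
  have := key _ hC; rewrite csum_light// csum_heavy1//.
  by apply: contra => /eqP e; apply/eqP; lra.
Qed.

(** With [heavy1] at infinity there remain m + 2 points of the affine line, not all equal, up to
    affine maps: a projective space of dimension [m]. *)
Lemma projective_pstableP A : pstable x0 A <->
  (forall j : 'I_n, j != heavy1 -> minor A j heavy1 != 0) /\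
  exists j k : 'I_n, [/\ j != heavy1, k != heavy1 & minor A j k != 0].
Proof.
split=> [[nol iso]|[h [j [k [jh kh m0]]]]]; split.
- move=> j jh; apply/negP => /eqP m0.
  have : csum x0 [set j; heavy1]%SET < 1.
    apply: iso => k l; rewrite !inE => /orP[]/eqP-> /orP[]/eqP->; rewrite ?minor_ii//.
    by rewrite minorC m0 oppr0.
  rewrite /csum big_setU1 ?inE//= big_set1 !mxE eqxx (negbTE jh) => lt.
  by have := bs; rewrite addrC => /lt_trans/(_ lt); rewrite ltxx.
- apply: contrapT => h; have hS : heavy1 \notin (~: [set heavy1])%SET by rewrite !inE
  eqxx.
  have : csum x0 (~: [set heavy1])%SET < 1.
    apply: iso => j k; rewrite !inE => jh kh; apply/eqP/negPn/negP => m0.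
    by apply: h; exists j, k.
  by rewrite csum_light// cardsC1 card_ord => /(lt_trans light_gt1); rewrite ltxx.
- move=> l; have [->|lh] := eqVneq l heavy1; last by exists heavy1; exact: h.
  by exists j; rewrite minorC oppr_eq0 h.
- move=> S iso; have [hS|hS] := boolP (heavy1 \in S).
    have -> : S = [set heavy1]%SET.
      apply/setP => l; rewrite inE; apply/idP/eqP => [lS|->//].
      by apply/eqP; apply: contraT => /h; rewrite iso ?eqxx.
    by rewrite csum1 mxE eqxx.
  rewrite csum_light//; apply: light_lt1.
  have := card_light hS; rewrite leq_eqVlt => /orP[/eqP cS|//].
  have SE : S = (~: [set heavy1])%SET.
    apply/eqP; rewrite eqEcard cardsC1 card_ord cS leqnn andbT.
    by apply/fintype.subsetP => l lS; rewrite !inE; apply: contraNneq hS => <-.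
  by move: m0; rewrite iso ?eqxx// SE !inE.
Qed.

Lemma frame1_pstable y i : y i != 0 -> pstable_frames x0 (frame (fun=> 1) y).
Proof.
move=> y0; split.
  by apply/eqP/rank2P; exists heavy0, heavy1; rewrite -/(wcoord _) wcoord_frame
    oner_neq0.
apply/projective_pstableP; split.
  apply: pointP => [k||]; rewrite ?eqxx// => _.
    by rewrite -/(pcoord _ _) pcoord_frame oner_neq0.
  by rewrite -/(wcoord _) wcoord_frame oner_neq0.
exists heavy0, (light i); split.
- by rewrite eq_sym neq_lift.
- by rewrite eq_sym neq_lift.
- by rewrite -/(qcoord _ _) qcoord_frame.
Qed.

Lemma projective_pcoord A i : pstable_frames x0 A -> pcoord A i != 0.
Proof. by move=> [_ /projective_pstableP[h _]]; apply: h; rewrite eq_sym neq_lift. Qed.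

Lemma projective_wcoord A : pstable_frames x0 A -> wcoord A != 0.
Proof. by move=> [_ /projective_pstableP[h _]]; apply: h; rewrite eq_sym neq_lift. Qed.

Definition top s : 'I_m.+1 := (s^-1)%g ord_max.

Lemma s_top s : s (top s) = m :> nat. Proof. by rewrite permKV. Qed.

Definition proj_coord s (g : nat -> 'rV[int]_m.+1 -> C) i : C :=
  g 1%N (vert s + unit_vec i - unit_vec (top s)).

Lemma lat_proj_coord s i : lat 1 (vert s + unit_vec i - unit_vec (top s)).
Proof. by apply: lat_root; rewrite s_top -ltnS. Qed.

Lemma proj_coord_top s g : proj_coord s g (top s) = g 1%N (vert s).
Proof. by rewrite /proj_coord addrK. Qed.

(** Both sides are the value of [g] at one lattice point of degree 2. *)
Lemma proj_coord_prop g s s' i j : cone g ->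
  proj_coord s g i * proj_coord s' g j = proj_coord s g j * proj_coord s' g i.
Proof.
move=> cg; rewrite /proj_coord -!cone_mul//; try exact: lat_proj_coord.
by congr (g _ _); rewrite addrACA [RHS]addrACA; congr (_ + _); rewrite addrACA
  [RHS]addrACA [unit_vec i + _]addrC.
Qed.

Lemma proj_coord_equiv g s s' : cone g -> g 1%N (vert s) != 0 -> g 1%N (vert s') != 0 ->
  config_equiv (fun=> 1) (proj_coord s g) (fun=> 1) (proj_coord s' g).
Proof.
move=> cg v0 v0'.
have e i : proj_coord s g i * proj_coord s' g (top s) = g 1%N (vert s) * proj_coord
  s' g i.
  by rewrite -proj_coord_top; exact: proj_coord_prop.
have k0 : proj_coord s' g (top s) != 0.
  apply/negP => /eqP k0; have := e (top s'); rewrite k0 mulr0 proj_coord_top =>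
    /esym/eqP.
  by rewrite mulf_eq0 (negbTE v0) (negbTE v0').
exists (fun=> 1), 1, (proj_coord s' g (top s) / g 1%N (vert s)); split.
- by move=> _; rewrite oner_neq0.
- exact: oner_neq0.
- by rewrite mulf_neq0 ?invr_neq0.
- move=> i; rewrite !mulr1; split=> //.
  by apply: (mulfI v0); rewrite -e; field.
Qed.

(** Over the torus the projective coordinates of the monomial point are the z_i up to a common
    factor, so the monomial map is inverse to the projection. *)
Lemma monomial_proj_equiv p q s : (forall i, p i != 0) -> (forall i, q i != 0) ->
  config_equiv p q (fun=> 1) (proj_coord s (monomial_point p q)).
Proof.
move=> p0 q0; set g := monomial_point p q.
have v0 : g 1%N (vert s) != 0.
  by rewrite /g monomial_point_vert; apply/prodf_neq0 => i _; rewrite mulf_neq0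
    ?expf_neq0.
have e i := monomial_point_ratio p q (lat_vert R s) (lat_proj_coord s i).
exists (fun i => (p i)^-1), 1, (g 1%N (vert s) * p (top s) / q (top s)); split.
- by move=> i; rewrite invr_neq0.
- exact: oner_neq0.
- by rewrite !mulf_neq0 ?invr_neq0.
- move=> i; split; first by rewrite mul1r mulVf.
  apply: (mulIf (x := q (top s) * p i)); first by rewrite mulf_neq0.
  by rewrite /proj_coord e -/g; field; rewrite p0 q0.
Qed.

(** The chart coordinates are recovered from the projective ones, which gives injectivity over the
    torus. *)
Lemma cone_torus_ratio g s r : cone g -> g 1%N (vert s) != 0 ->
  proj_coord s g (hi s r) != 0 ->
  g 1%N (edge s r) / g 1%N (vert s) = proj_coord s g (lo s r) / proj_coord s g (hi s r).
Proof.
move=> cg v0 h0.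
have : g 1%N (edge s r) * proj_coord s g (hi s r) = g 1%N (vert s) * proj_coord s g
  (lo s r).
  rewrite /proj_coord -!cone_mul//; try exact: lat_proj_coord; try exact: lat_edge;
    try exact: lat_vert.
  congr (g _ _); rewrite /edge; apply/rowP => i; rewrite !mxE; ring.
move=> e; apply: (mulIf h0); rewrite divfK// mulrAC e mulrAC divff// mul1r.
by [].
Qed.

Theorem projective_birational (x : 'rV[R]_n) : chamber (chamber_of x0) x ->
  exists phi, birational_morphism (toric_variety (@permutohedron R m))
    (orbit_space_variety (chamber_of x0) x) phi.
Proof.
move=> cx; set omega := chamber_of x0.
have [rho [pY qE]] := orbit_space_presented projective_weight_generic cx.
have pX := toric_presented R m.
pose h s g := frame (fun=> 1) (proj_coord s g) : 'M[C]_(2, n).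
have hF s g : g 1%N (vert s) != 0 -> pstable_frames x0 (h s g).
  by move=> v0; apply: (@frame1_pstable _ (top s)); rewrite proj_coord_top.
(* [phi] is defined through a chosen representative and vertex; another choice changes z only by a
   common scalar. *)
have [phi phiE] : exists phi, forall g s, cone g -> g 1%N (vert s) != 0 ->
    phi (grading_orbit g) = rho (h s g).
  have [phi phiP] : exists phi : set (nat -> 'rV[int]_m.+1 -> C) -> set {vspace
    'rV[C]_n},
      forall O, (exists g s, [/\ cone g, g 1%N (vert s) != 0 & O = grading_orbit g]) ->
      exists g s, [/\ cone g, g 1%N (vert s) != 0, O = grading_orbit g & phi O = rho
        (h s g)].
    have hc O : exists z, (exists g s, [/\ cone g, g 1%N (vert s) != 0 & O =
      grading_orbit g]) ->
        exists g s, [/\ cone g, g 1%N (vert s) != 0, O = grading_orbit g & z = rho (h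
          s g)].
      have [[g [s [cg v0 e]]]|no] := pselect (exists g s, [/\ cone g, g 1%N (vert s)
        != 0 & O = grading_orbit g]).
        by exists (rho (h s g)) => _; exists g, s.
      by exists set0.
    by have [phi hphi] := choice hc; exists phi.
  exists phi => g s cg v0.
  have [g' [s' [cg' v0' e ->]]] := phiP _ (ex_intro _ g (ex_intro _ s (And3 cg v0
    erefl))).
  move/grading_orbit_eq: e => [c c0 gE].
  have v1 : g 1%N (vert s') != 0.
    by move: v0'; rewrite gE /grading_act mulf_eq0 negb_or => /andP[].
  transitivity (rho (h s' g)).
    apply/esym/qE; [exact: hF|exact: hF|apply: config_frame_equiv].
    exists (fun=> 1), 1, c; split=> //; rewrite ?oner_neq0// => i.
    by rewrite !mulr1 gE /proj_coord /grading_act expr1.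
  by apply/qE; [exact: hF|exact: hF|apply: config_frame_equiv; exact: proj_coord_equiv].
have hpoly s c : @entry_coord R n c -> polyfun (@cone_coord R m.+1) (c \o h s).
  apply: polyfun_frame => i; first exact: polyfun_cst.
  by apply: polyfun_coord; exists 1%N, (vert s + unit_vec i - unit_vec (top s)).
have pv k a : polyfun (@cone_coord R m.+1) (fun g => g k a).
  by apply: polyfun_coord; exists k, a.
have lift : local_lift (@cone_coord R m.+1) cone (@grading_orbit R m) (@entry_coord R n)
    (pstable_frames x0) rho phi.
  move=> g cg; have [s v0] := cone_vertex cg.
  exists (fun g : nat -> 'rV[int]_m.+1 -> C => g 1%N (vert s)), (h s); split=> //;
    first exact: hpoly.
  by move=> g' cg' v0'; split; [exact: hF|rewrite (phiE _ s)].
exists phi; split; first exact: (lift_morphism pX pY).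
pose torus (g : nat -> 'rV[int]_m.+1 -> C) := cone g /\ forall k a, lat k a -> g k a
  != 0.
pose U := @grading_orbit R m @` torus.
pose big_frames A := pstable_frames x0 A /\ forall i, qcoord A i != 0.
pose V := rho @` big_frames.
have gc (g g' : nat -> 'rV[int]_m.+1 -> C) : cone g -> torus g' ->
    grading_orbit g' = grading_orbit g -> torus g.
  move=> cg [_ t] /grading_orbit_eq[c c0 e]; split=> // k a la.
  by rewrite e /grading_act mulf_neq0 ?expf_neq0// t.
have UE : cone `&` @grading_orbit R m @^-1` U = torus.
  apply/seteqP; split=> [g [cg [g' tg' e]]|g tg]; first exact: gc e.
  by split; [exact: tg.1|exists g].
have VE : pstable_frames x0 `&` rho @^-1` V = big_frames.
  apply/seteqP; split=> [A [FA [A' [FA' Q'] e]]|A bA]; last first.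
    by split; [exact: bA.1|exists A].
  split=> // i; have /torus_equiv_config[t [c [d [t0 c0 d0 hq]]]] := (qE _ _ FA'
    FA).1 e.
  by rewrite (hq i).2 !mulf_neq0.
have oU : zopen (toric_variety (@permutohedron R m)) U.
  have [_ _ oX _] := pX; apply/oX; split; first by move=> _ [g [cg _] <-]; exists g.
  rewrite UE; split=> [g []//|g [cg t]].
  (* By [cone_chart], nonzero values at one vertex and its neighbours force nonzero values at all
     lattice points. *)
  exists (fun g : nat -> 'rV[int]_m.+1 -> C => g 1%N (vert 1) * \prod_r g 1%N (edge 1
    r)); split.
  - by apply: polyfun_mul => //; apply: polyfun_prod => r _.
  - rewrite mulf_neq0 ?t//; first exact: lat_vert.
    by apply/prodf_neq0 => r _; apply: t; exact: lat_edge.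
  - move=> g' cg'; rewrite mulf_eq0 negb_or => /andP[v0 /prodf_neq0 e0].
    split=> // k a la; rewrite (cone_chart cg' v0 la) mulf_neq0 ?expf_neq0//.
    by apply/prodf_neq0 => r _; rewrite expf_neq0// mulf_neq0 ?invr_neq0 ?e0.
have [oF _ oY _] := pY.
have oV : zopen (orbit_space_variety omega x) V.
  apply/oY; split; first by move=> _ [A [FA _] <-]; exists A.
  rewrite VE (_ : big_frames = pstable_frames x0 `&` [set A | \rank A = 2 /\ forall
    i, qcoord A i != 0]).
    apply: zopen_zariskiI => //; split=> [A []//|A [rA Q0]].
    exists (fun A => \prod_i qcoord A i); split.
    - by apply: polyfun_prod => i _; exact: polyfun_minor.
    - by apply/prodf_neq0 => i _.
    - by move=> B rB /prodf_neq0 Q; split=> // i; exact: Q.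
  apply/seteqP; split=> A; first by move=> [FA Q]; split=> //; split=> //; case: FA.
  by move=> [FA [_ Q]]; split.
have pU := presented_subspace pX oU; rewrite UE in pU.
have pV := presented_subspace pY oV; rewrite VE in pV.
exists U, V; split=> //.
- apply: (presented_zdense pX) => g f cg pf f0.
  have [g' [cg' f0' t]] := cone_torus_dense cg pf f0.
  by exists g'; split=> //; exists g'.
- apply: (presented_zdense pY) => A f FA pf f0.
  have [f' [pf' f'0 hf']] := oF.2 A FA.
  (* At [B] all z_i are 1; along the line [A + t *: B] each open condition becomes the nonvanishing
     of a nonzero polynomial in [t]. *)
  pose B : 'M[C]_(2, n) := frame (fun=> 1) (fun=> 1).
  have curve c : polyfun (@entry_coord R n) c -> exists p : {poly C}, forall t, c (A
    + t *: B) = p.[t].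
    apply: polyfun_curve => _ [k [l ->]]; exists ((A k l)%:P + (B k l) *: 'X) => t.
    by rewrite !mxE hornerD hornerC hornerZ hornerX mulrC.
  have at0 (c : _ -> C) (p : {poly C}) : (forall t, c (A + t *: B) = p.[t]) -> c A !=
    0 -> p != 0.
    by move=> hp; apply: contraNneq => p0; have := hp 0; rewrite p0 horner0 scale0r
      addr0 => ->.
  have [p hp] := curve _ pf; have [p' hp'] := curve _ pf'.
  have [w hw] := curve _ (polyfun_minor R heavy0 heavy1).
  have [u hu] : exists u : 'I_m.+1 -> {poly C}, forall i t, qcoord (A + t *: B) i =
    (u i).[t].
    by have [u hu] := choice (fun i => curve _ (polyfun_minor R heavy0 (light i)));
      exists u.
  have u0 i : u i != 0.
    apply: contra_neq (oner_neq0 C) => ui0.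
    have q0 t : qcoord (A + t *: B) i = 0 by rewrite hu ui0 horner0.
    have QE t : (A 0 heavy0 + t) * (A 1 (light i) + t) - (A 0 (light i) + t) * A 1
      heavy0 = 0.
      rewrite -(q0 t) /qcoord /minor.
      have e k l : (A + t *: B) k l = A k l + t * B k l by rewrite mxE [X in _ + X]mxE.
      by rewrite !e /B !frameE /=; ring.
    have := QE 0; have := QE 1; have := QE (-1).
    move: (A _ _) (A _ _) (A _ _) (A _ _) => a b c d e1 e2 e3.
    (* The second difference at -1, 0, 1 of a quadratic polynomial in [t] with leading coefficient
       1. *)
    have : (2 : C) * 1 = 0.
      transitivity ((d + 1) * (c + 1) - (b + 1) * a
        + ((d + -1) * (c + -1) - (b + -1) * a)
        - 2 * ((d + 0) * (c + 0) - (b + 0) * a)); first by ring.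
      by rewrite e1 e2 e3 mulr0 subr0 addr0.
    by move/eqP; rewrite mulf_eq0 pnatr_eq0 /= => /eqP.
  (* [w] keeps the rank equal to 2, so that nonvanishing of [p'] implies stability; the [u i] put
     the frame over the torus. *)
  have [t] : exists t, (p * p' * w * \prod_i u i).[t] != 0.
    apply: poly_nonroot; rewrite !mulf_neq0 ?(at0 _ _ hp) ?(at0 _ _ hp')//.
      exact: (at0 _ _ hw (projective_wcoord FA)).
    by apply/prodf_neq0.
  rewrite !hornerM !mulf_eq0 !negb_or horner_prod -hp -hp' -hw.
  move=> /andP[/andP[/andP[ft f't] wt] /prodf_neq0 ut].
  have FB : pstable_frames x0 (A + t *: B).
    by apply: hf' => //; apply/eqP/rank2P; exists heavy0, heavy1.
  exists (A + t *: B); split=> //; exists (A + t *: B) => //; split=> // i.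
  by rewrite hu ut.
- apply: (lift_isomorphism (set0 : set (nat -> 'rV[int]_m.+1 -> C)) pU pV).
  + move=> g [cg t]; have v0 := t _ _ (lat_vert R 1).
    exists (fun g : nat -> 'rV[int]_m.+1 -> C => g 1%N (vert 1)), (h 1%g); split=>
      //; first exact: hpoly.
    move=> g' [cg' t'] v0'; split; last by rewrite (phiE _ 1%g).
    split; first exact: hF.
    by move=> i; rewrite qcoord_frame; apply: t'; exact: lat_proj_coord.
  + move=> g g' [cg t] [cg' t']; have v0 := t _ _ (lat_vert R 1); have v0' := t' _ _
    (lat_vert R 1).
    rewrite (phiE _ 1%g)// (phiE _ 1%g)// => /qE/torus_equiv_config.
    move=> /(_ (hF _ _ v0) (hF _ _ v0'))[u [c [d [u0 c0 d0 hu]]]].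
    apply: (chart_orbit_eq cg cg' v0 v0') => r.
    rewrite !cone_torus_ratio//; try by [apply: t; exact: lat_proj_coord|apply: t';
      exact: lat_proj_coord].
    (* The first coordinates are all 1 on both sides, so the column scalings agree and z changes by
       one common factor. *)
    have uE i : u i = c^-1.
      apply: (mulfI c0); have := (hu i).1; rewrite !pcoord_frame mulr1 divff//.
    have yE i : proj_coord 1 g' i = d * c^-1 * proj_coord 1 g i.
      by have := (hu i).2; rewrite !qcoord_frame uE.
    rewrite !yE -mulf_div divff ?mul1r// mulf_neq0 ?invr_neq0//.
  (* The monomial map is polynomial on all frames, so the inverse lifts with [b] equal to 1. *)
  + move=> A [FA Q0]; exists (fun=> 1), (fun A => monomial_point (pcoord A) (qcoord A)).
    split; [exact: polyfun_cst|exact: oner_neq0|exact: polyfun_monomial_point|].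
    move=> {FA Q0} {}A [FA Q0] _; set g := monomial_point _ _.
    have P0 i : pcoord A i != 0 by exact: projective_pcoord.
    have v0 : g 1%N (vert 1) != 0.
      by rewrite /g monomial_point_vert; apply/prodf_neq0 => i _; rewrite mulf_neq0
        ?expf_neq0.
    have cg : cone g by exact: monomial_point_cone v0.
    split; first split=> //.
      move=> k a la; rewrite /g /monomial_point asboolT//; apply/prodf_neq0 => i _.
      by rewrite mulf_neq0 ?expf_neq0.
    rewrite (phiE _ 1%g)//.
    have eA := frame_equiv (projective_wcoord FA).
    have Ff := torus_equiv_pstable eA FA.
    transitivity (rho (frame (pcoord A) (qcoord A))); last exact/esym/qE.
    apply/esym/qE; [by []|exact: hF|].
    by apply: config_frame_equiv; exact: monomial_proj_equiv.
Qed.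

End ProjectiveChamber.

(** * The hexagon *)

Section HexagonalChamber.
Variable R : realType.
Local Notation C := R[i].
Implicit Types (A : 'M[C]_(2, 5)) (p q y : 'I_3 -> C) (i j : 'I_3).
Implicit Types (a : 'rV[int]_3) (s : 'S_3) (S : {set 'I_5}).
Local Notation lat := (lattice_point_of_dilate (@permutohedron R 2)).
Local Notation cone := (polytope_cone (@permutohedron R 2)).
Local Notation heavy1 := (heavy1 2).
Local Notation heavy0 := (heavy0 2).

(** The sums 11/20 + 11/20 and 11/20 + 6/10 exceed 1 while 11/20 + 3/10 and 9/10 do not: the heavy
    columns differ, each meets at most one light column, and the three light columns may
    coincide. *)
Definition hexagonal_weight : 'rV[R]_5 := \row_j (if (j < 3)%N then 3 / 10 else 11 /
  20).
Local Notation x0 := hexagonal_weight.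

Definition light0 : 'I_3 := ord0.
Definition light1 : 'I_3 := lift ord0 ord0.
Definition light2 : 'I_3 := ord_max.

Lemma lightP (P : 'I_3 -> Prop) : P light0 -> P light1 -> P light2 -> forall i, P i.
Proof.
move=> P0 P1 P2 [[|[|[|k]]] hk]//.
- by rewrite (_ : Ordinal hk = light0)//; exact/val_inj.
- by rewrite (_ : Ordinal hk = light1)//; exact/val_inj.
- by rewrite (_ : Ordinal hk = light2)//; exact/val_inj.
Qed.

Lemma csum_hexagonal S : csum x0 S =
  (light light0 \in S)%:R * (3 / 10) + (light light1 \in S)%:R * (3 / 10) +
  (light light2 \in S)%:R * (3 / 10) + (heavy0 \in S)%:R * (11 / 20) +
  (heavy1 \in S)%:R * (11 / 20).
Proof.
have -> : csum x0 S = \sum_j (j \in S)%:R * x0 0 j.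
  by rewrite /csum big_mkcond; apply: eq_bigr => j _; case: ifP; rewrite ?mul1r ?mul0r.
rewrite !big_ord_recl big_ord0 addr0 !addrA !mxE /=.
have -> : light light0 = ord0 :> 'I_5 by exact/val_inj.
have -> : light light1 = lift ord0 ord0 :> 'I_5 by exact/val_inj.
have -> : light light2 = lift ord0 (lift ord0 ord0) :> 'I_5 by exact/val_inj.
have -> : heavy0 = lift ord0 (lift ord0 (lift ord0 ord0)) :> 'I_5 by exact/val_inj.
have -> : heavy1 = lift ord0 (lift ord0 (lift ord0 (lift ord0 ord0))) :> 'I_5 by
  exact/val_inj.
by [].
Qed.

Lemma hexagonal_weight_generic : generic_point x0.
Proof.
split.
- by move=> j; rewrite mxE; case: ifP => _; lra.
- by rewrite -csumT csum_hexagonal !inE /=; lra.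
- move=> S; rewrite csum_hexagonal; apply/eqP.
  by do 5 case: (_ \in S) => /=; lra.
Qed.

Lemma pstable_hexagonalP A : pstable x0 A <->
  [/\ wcoord A != 0, forall i, (pcoord A i != 0) || (qcoord A i != 0),
      forall i j, i != j -> (pcoord A i != 0) || (pcoord A j != 0) &
      forall i j, i != j -> (qcoord A i != 0) || (qcoord A j != 0)].
Proof.
split=> [[nol iso]|[W0 nz hp hq]].
  have W0 : wcoord A != 0.
    apply/negP => /eqP W; have : csum x0 [set heavy0; heavy1]%SET < 1.
      apply: iso => k l; rewrite !inE => /orP[]/eqP-> /orP[]/eqP->; rewrite ?minor_ii//.
      by rewrite minorC -/(wcoord A) W oppr0.
    by rewrite csum_hexagonal !inE /=; lra.
  have big i j (h : 'I_5) : i != j -> h = heavy0 \/ h = heavy1 ->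
      1 < csum x0 [set h; light i; light j]%SET.
    rewrite csum_hexagonal !inE => ij hh; move: ij.
    by case: hh => ->; move: i j; apply: lightP; apply: lightP => //= _; lra.
  have isoC h k l : minor A h k = 0 -> minor A h l = 0 -> minor A k l = 0.
    move=> hk hl; apply: (minor_trans (j := h)) => //; first by rewrite minorC hk oppr0.
    by have [r /minor_neq0_col] := nol h.
  have iso3 h k l : minor A h k = 0 -> minor A h l = 0 -> csum x0 [set h; k; l]%SET < 1.
    move=> hk hl; apply: iso => u v; rewrite !inE => /orP[/orP[]|]/eqP->
      /orP[/orP[]|]/eqP->;
      rewrite ?minor_ii//; try exact: (isoC h);
      by rewrite minorC ?hk ?hl ?oppr0// (isoC h) ?oppr0.
  split=> // [i|i j ij|i j ij]; apply: contraT; rewrite negb_or !negbK => /andP[/eqP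
    e1 /eqP e2].
  - have [l m0] := nol (light i); have : wcoord A * minor A (light i) l != 0.
      by rewrite mulf_neq0.
    move=> {m0}; move: l; apply: pointP => [j||].
    + by rewrite minor_light e1 e2 mul0r mulr0 subrr eqxx.
    + by rewrite minorC -/(qcoord A i) e2 oppr0 mulr0 eqxx.
    + by rewrite -/(pcoord A i) e1 mulr0 eqxx.
  - have := big i j heavy1 ij (or_intror erefl); rewrite ltNge => /negP[]; apply: ltW.
    by apply: iso3; rewrite minorC ?e1 ?e2 -/(pcoord A _) ?e1 ?e2 oppr0.
  - have := big i j heavy0 ij (or_introl erefl); rewrite ltNge => /negP[]; apply: ltW.
    by apply: iso3.
split.
  apply: pointP => [i||].
  - case/orP: (nz i) => h0; first by exists heavy1.
    by exists heavy0; rewrite minorC oppr_eq0.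
  - by exists heavy1.
  - by exists heavy0; rewrite minorC oppr_eq0.
move=> S iso; rewrite csum_hexagonal.
have b01 : ~~ ((heavy0 \in S) && (heavy1 \in S)).
  by apply/negP => /andP[h k]; move: W0; rewrite /wcoord iso ?eqxx.
have b0 i j : i != j -> ~~ [&& heavy0 \in S, light i \in S & light j \in S].
  move=> /hq; rewrite /qcoord => h; apply/negP => /and3P[k0 k1 k2]; move: h.
  by rewrite !iso ?eqxx.
have b1 i j : i != j -> ~~ [&& heavy1 \in S, light i \in S & light j \in S].
  move=> /hp; rewrite /pcoord => h; apply/negP => /and3P[k0 k1 k2]; move: h.
  by rewrite !iso ?eqxx.
have := b0 light0 light1 isT; have := b0 light0 light2 isT; have := b0 light1 light2
  isT.
have := b1 light0 light1 isT; have := b1 light0 light2 isT; have := b1 light1 light2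
  isT.
(* Each of the 32 subsets is excluded by [b01], [b0] or [b1], or has weight below 1. *)
move: b01; case: (light light0 \in S); case: (light light1 \in S);
  case: (light light2 \in S); case: (heavy0 \in S); case: (heavy1 \in S) => //=;
  by move=> _ _ _ _ _ _ _; lra.
Qed.

Lemma two_point_perm i j : i != j -> exists s : 'S_3, s i = 0%N :> nat /\ s j = 2%N
  :> nat.
Proof.
move=> ij; pose s1 : 'S_3 := tperm i light0; pose s2 : 'S_3 := tperm (s1 j) light2.
exists (s1 * s2)%g; rewrite !permM tpermL; split; last by rewrite tpermL.
rewrite tpermD//.
by rewrite -(tpermL i light0) (inj_eq (@perm_inj _ _)) eq_sym.
Qed.

(** The value at the vertex [s] is a product of q_i^(s i) p_i^(2 - s i). It is nonzero once the
    index with q_i = 0, if any, gets the value 0 and the one with p_i = 0 gets the value 2. *)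
Lemma hexagonal_vertex A : pstable x0 A -> exists s,
  monomial_point (pcoord A) (qcoord A) 1 (vert s) != 0.
Proof.
move=> /pstable_hexagonalP[W0 nz hp hq].
have other i : exists j, j != i by move: i; apply: lightP; [exists light1|exists
  light0|exists light0].
have [i [j [ij qi pj]]] : exists i j, [/\ i != j, forall k, k != i -> qcoord A k != 0 &
    forall k, k != j -> pcoord A k != 0].
  have [[j pj]|np] := pselect (exists j, pcoord A j = 0).
    have pj' k : k != j -> pcoord A k != 0 by move=> /hp; rewrite pj eqxx orbF.
    have [[i qi]|nq] := pselect (exists i, qcoord A i = 0).
      exists i, j; split=> //.
        by apply/eqP => e; have := nz i; rewrite qi e pj eqxx.
      by move=> k /hq; rewrite qi eqxx orbF.
    have [i ij] := other j; exists i, j; split=> // k _.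
    by apply/negP => /eqP qk; apply: nq; exists k.
  have [[i qi]|nq] := pselect (exists i, qcoord A i = 0).
    have [j ji] := other i; exists i, j; split; rewrite 1?eq_sym//.
      by move=> k /hq; rewrite qi eqxx orbF.
    by move=> k _; apply/negP => /eqP pk; apply: np; exists k.
  have [j ji] := other light0; exists light0, j; split; rewrite 1?eq_sym//.
    by move=> k _; apply/negP => /eqP qk; apply: nq; exists k.
  by move=> k _; apply/negP => /eqP pk; apply: np; exists k.
have [s [si sj]] := two_point_perm ij; exists s.
rewrite monomial_point_vert; apply/prodf_neq0 => k _; apply: mulf_neq0.
  by have [->|/qi k0] := eqVneq k i; rewrite ?si ?expr0 ?oner_neq0// expf_neq0.
by have [->|/pj k0] := eqVneq k j; rewrite ?sj ?subnn ?expr0 ?oner_neq0// expf_neq0.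
Qed.

Lemma monomial_vertex_neq0 p q s : monomial_point p q 1 (vert s) != 0 ->
  forall i, ((0 < s i)%N -> q i != 0) /\ ((s i < 2)%N -> p i != 0).
Proof.
rewrite monomial_point_vert => /prodf_neq0 h i; have := h i isT.
rewrite mulf_eq0 negb_or => /andP[hq hp].
split=> k0; [apply: contraNneq hq|apply: contraNneq hp] => ->; rewrite expr0n.
  by rewrite gtn_eqF.
by rewrite subn_eq0 leqNgt k0.
Qed.

Lemma edge_middle s : lo s ord_max = hi s ord0 :> 'I_3.
Proof. by rewrite /lo /hi; congr (_ _); exact/val_inj. Qed.

Lemma permP3 s (P : 'I_3 -> Prop) :
  P (lo s (ord0 : 'I_2)) -> P (hi s (ord0 : 'I_2)) -> P (hi s (ord_max : 'I_2)) ->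
  forall i, P i.
Proof.
move=> P0 P1 P2 i; rewrite -(permK s i); move: (s i); apply: lightP.
- by move: P0; rewrite /lo (_ : widen_ord _ _ = light0)//; exact/val_inj.
- by move: P1; rewrite /hi (_ : lift _ _ = light1)//; exact/val_inj.
- by move: P2; rewrite /hi (_ : lift _ _ = light2)//; exact/val_inj.
Qed.

(** Values are listed in increasing order of [s], so that one formula serves all six vertices. *)
Definition three_points (T : Type) s (u v w : T) i :=
  if s i == 0%N :> nat then u else if s i == 1%N :> nat then v else w.

Lemma three_points_lo T s (u v w : T) : three_points s u v w (lo s ord0) = u.
Proof. by rewrite /three_points s_lo. Qed.
Lemma three_points_mid T s (u v w : T) : three_points s u v w (hi s ord0) = v.
Proof. by rewrite /three_points s_hi. Qed.
Lemma three_points_hi T s (u v w : T) : three_points s u v w (hi s ord_max) = w.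
Proof. by rewrite /three_points s_hi. Qed.
Definition three_pointsE := (three_points_lo, three_points_mid, three_points_hi).

Lemma hexagonal_ratio p q s (g := monomial_point p q) (v := vert s) :
  g 1%N v != 0 ->
  [/\ q (hi s ord0) != 0, p (lo s ord0) != 0, p (hi s ord0) != 0, q (hi s ord_max) !=
    0 &
  g 1%N (edge s ord0) / g 1%N v =
    (q (lo s ord0) * p (hi s ord0)) / (q (hi s ord0) * p (lo s ord0)) /\
  g 1%N (edge s ord_max) / g 1%N v =
    (q (hi s ord0) * p (hi s ord_max)) / (q (hi s ord_max) * p (hi s ord0))].
Proof.
move=> v0; have nz := monomial_vertex_neq0 v0.
have q1 : q (hi s ord0) != 0 by apply: (nz _).1; rewrite s_hi.
have p0 : p (lo s ord0) != 0 by apply: (nz _).2; rewrite s_lo.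
have p1 : p (hi s ord0) != 0 by apply: (nz _).2; rewrite s_hi.
have q2 : q (hi s ord_max) != 0 by apply: (nz _).1; rewrite s_hi.
have e0 := monomial_point_ratio p q (lat_vert R s) (lat_edge R s ord0).
have e1 := monomial_point_ratio p q (lat_vert R s) (lat_edge R s ord_max).
rewrite edge_middle in e1; split=> //; split.
  apply: (mulIf (x := g 1%N v * (q (hi s ord0) * p (lo s ord0)))).
    by rewrite !mulf_neq0.
  by rewrite [LHS]mulrA divfK// e0 -/g; field; rewrite q1 p0.
apply: (mulIf (x := g 1%N v * (q (hi s ord_max) * p (hi s ord0)))).
  by rewrite !mulf_neq0.
by rewrite [LHS]mulrA divfK// [edge s ord_max]/edge edge_middle e1 -/g; field;
  rewrite q2 p1.
Qed.

(** The middle point is scaled to z = 1. The lowest is then the first chart coordinate and the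
    highest the inverse of the second, which is stored in [p] because it may vanish. *)
Lemma hexagonal_normal_form p q s (g := monomial_point p q) : g 1%N (vert s) != 0 ->
  config_equiv p q
    (three_points s 1 1 (g 1%N (edge s ord_max) / g 1%N (vert s)))
    (three_points s (g 1%N (edge s ord0) / g 1%N (vert s)) 1 1).
Proof.
move=> v0; have [q1 p0 p1 q2 [-> ->]] := hexagonal_ratio v0.
pose p1' := p (hi s ord0); pose q1' := q (hi s ord0).
exists (three_points s (p (lo s ord0))^-1 p1'^-1 (q1' / (p1' * q (hi s ord_max)))),
  1, (p1' / q1').
split.
- by apply: (@permP3 s); rewrite three_pointsE ?mulf_neq0 ?invr_neq0 ?mulf_neq0.
- exact: oner_neq0.
- by rewrite mulf_neq0 ?invr_neq0.
- by apply: (@permP3 s); rewrite !three_pointsE /p1' /q1'; split; field; rewrite ?q1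
  ?p0 ?p1 ?q2.
Qed.

Theorem hexagonal_isomorphism (x : 'rV[R]_5) : chamber (chamber_of x0) x ->
  exists phi, isomorphism (toric_variety (@permutohedron R 2))
    (orbit_space_variety (chamber_of x0) x) phi.
Proof.
move=> cx.
have [rho [pY rhoE]] := orbit_space_presented hexagonal_weight_generic cx.
have pX := toric_presented R 2.
pose mono A := monomial_point (pcoord A) (qcoord A).
have eqA A : pstable_frames x0 A -> torus_equiv A (frame (pcoord A) (qcoord A)).
  by move=> [_ /pstable_hexagonalP[W0 _ _ _]]; exact: frame_equiv.
have mono_cone A : pstable_frames x0 A -> cone (mono A).
  by move=> [_ /hexagonal_vertex[s v0]]; exact: monomial_point_cone v0.
have mono_rho A A' : pstable_frames x0 A -> pstable_frames x0 A' ->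
    grading_orbit (mono A) = grading_orbit (mono A') <-> rho A = rho A'.
  move=> FA FA'; split; last first.
    by move=> e; apply: monomial_point_equiv; apply: torus_equiv_config; apply/(rhoE
      A A' FA FA').
  move=> /grading_orbit_eq[c c0 e].
  have [s v0] := hexagonal_vertex FA.2.
  have v0' : mono A' 1%N (vert s) != 0.
    by rewrite e /grading_act mulf_neq0 ?expf_neq0.
  have Ff B : pstable_frames x0 B -> pstable_frames x0 (frame (pcoord B) (qcoord B)).
    by move=> FB; exact: torus_equiv_pstable (eqA _ FB) FB.
  (* Stable frames are replaced by their normal form, which only involves the chart coordinates at
     [s]; these are unchanged by the grading. *)
  have step B : pstable_frames x0 B -> mono B 1%N (vert s) != 0 ->
      rho B = rho (frame (three_points s 1 1 (mono B 1%N (edge s ord_max) / mono B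
        1%N (vert s)))
        (three_points s (mono B 1%N (edge s ord0) / mono B 1%N (vert s)) 1 1)).
    move=> FB vB; have eB := config_frame_equiv (hexagonal_normal_form vB).
    transitivity (rho (frame (pcoord B) (qcoord B))).
      by apply/rhoE; [|exact: Ff|exact: eqA].
    by apply/rhoE => //; [exact: Ff|exact: torus_equiv_pstable eB (Ff _ FB)].
  rewrite (step _ FA v0) (step _ FA' v0') e /grading_act !expr1.
  by rewrite -!mulf_div divff// !mul1r.
(* [phi] is the inverse of the monomial map, well defined by [mono_rho]. *)
have [phi phiE] : exists phi, forall A, pstable_frames x0 A ->
    phi (grading_orbit (mono A)) = rho A.
  have hc O : exists z, forall A, pstable_frames x0 A -> O = grading_orbit (mono A)
    -> z = rho A.
    have [[A [FA e]]|no] := pselect (exists A, pstable_frames x0 A /\ O =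
      grading_orbit (mono A)).
      by exists (rho A) => A' FA' e'; apply: (mono_rho _ _ FA FA').1; rewrite -e.
    by exists set0 => A FA e; case: no; exists A.
  by have [phi hphi] := choice hc; exists phi => A FA; apply: hphi.
(* The normal form with denominators cleared: z is edge / vertex, 1 and vertex / edge, all
   polynomial in [g]. *)
pose h s (g : nat -> 'rV[int]_3 -> C) : 'M[C]_(2, 5) :=
  frame (three_points s (g 1%N (vert s)) 1 (g 1%N (edge s ord_max)))
    (three_points s (g 1%N (edge s ord0)) 1 (g 1%N (vert s))).
have pc s g i : pcoord (h s g) i = three_points s (g 1%N (vert s)) 1 (g 1%N (edge s
  ord_max)) i.
  exact: pcoord_frame.
have qc s g i : qcoord (h s g) i = three_points s (g 1%N (edge s ord0)) 1 (g 1%N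
  (vert s)) i.
  exact: qcoord_frame.
have one := oner_neq0 C.
have hF s g : g 1%N (vert s) != 0 -> pstable_frames x0 (h s g).
  move=> v0; split.
    by apply/eqP/rank2P; exists heavy0, heavy1; rewrite -/(wcoord _) wcoord_frame.
  apply/pstable_hexagonalP; split.
  - by rewrite wcoord_frame.
  - by apply: (@permP3 s); rewrite pc qc !three_pointsE ?v0 ?one ?orbT.
  - move=> i j; rewrite !pc; move: i j.
    by apply: (@permP3 s); apply: (@permP3 s); rewrite ?eqxx// !three_pointsE ?v0
      ?one ?orbT.
  - move=> i j; rewrite !qc; move: i j.
    by apply: (@permP3 s); apply: (@permP3 s); rewrite ?eqxx// !three_pointsE ?v0
      ?one ?orbT.
(* [h s] is a section of the monomial map: both points have the same coordinates in the chart at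
   [s]. *)
have horb s g : cone g -> g 1%N (vert s) != 0 ->
    grading_orbit (mono (h s g)) = grading_orbit g.
  move=> cg v0.
  have vZ : mono (h s g) 1%N (vert s) != 0.
    rewrite /mono monomial_point_vert; apply/prodf_neq0 => i _; rewrite pc qc.
    move: i; apply: (@permP3 s); rewrite !three_pointsE ?s_lo ?s_hi ?subnn ?expr0
      ?expr1n ?mulr1 ?mul1r;
      by rewrite ?expf_neq0.
  have [_ _ _ _ [r0 r1]] := hexagonal_ratio vZ.
  have cZ : cone (mono (h s g)) by apply: mono_cone; exact: hF.
  apply: (chart_orbit_eq cZ cg vZ v0); apply: ord2P.
    rewrite -[0]/(ord0) [LHS]r0 !pc !qc !three_pointsE.
    by rewrite mulr1 mul1r.
  have -> : 1 = ord_max :> 'I_2 by exact/val_inj.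
  by rewrite [LHS]r1 !pc !qc !three_pointsE mul1r mulr1.
exists phi; apply: (lift_isomorphism (set0 : set (nat -> 'rV[int]_3 -> C)) pX pY).
- move=> g cg; have [s v0] := cone_vertex cg.
  have ev k a : polyfun (@cone_coord R 3) (fun g => g k a) by apply: polyfun_coord;
    exists k, a.
  exists (fun g : nat -> 'rV[int]_3 -> C => g 1%N (vert s)), (h s); split=> //.
    move=> c; apply: polyfun_frame; apply: (@permP3 s); under eq_fun do rewrite
      three_pointsE;
      by [exact: ev|exact: polyfun_cst].
  move=> g' cg' v0'; have Fh := hF _ _ v0'; split=> //.
  by rewrite -(horb s g' cg' v0') (phiE _ Fh).
- move=> g g' cg cg'; have [s v0] := cone_vertex cg; have [s' v0'] := cone_vertex cg'.
  rewrite -(horb s g cg v0) -(horb s' g' cg' v0').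
  rewrite (phiE _ (hF _ _ v0)) (phiE _ (hF _ _ v0')).
  exact: (mono_rho _ _ (hF _ _ v0) (hF _ _ v0')).2.
- move=> A FA; exists (fun=> 1), mono; split.
  + exact: polyfun_cst.
  + exact: one.
  + exact: polyfun_monomial_point.
  + by move=> B FB _; split; [exact: mono_cone|exact: phiE].
Qed.

End HexagonalChamber.

Theorem corollary9 (R : realType) :
  (exists2 omega : set {set {set 'I_5}},
     is_chamber R omega /\
     chamber omega `<=` rel_interior (@hypersimplex R 5) &
     forall x, chamber omega x ->
       exists phi, isomorphism (toric_variety (@permutohedron R 2))
                               (orbit_space_variety omega x) phi) /\
  (forall n : nat, (6 <= n)%N ->
     exists2 omega : set {set {set 'I_n}},
       is_chamber R omega /\
       chamber omega `<=` rel_interior (@hypersimplex R n) &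
       forall x, chamber omega x ->
         exists phi,
           birational_morphism (toric_variety (@permutohedron R (n - 3)))
                               (orbit_space_variety omega x) phi).
Proof.
split.
  have gx := hexagonal_weight_generic R.
  exists (chamber_of (hexagonal_weight R)); last exact: hexagonal_isomorphism.
  by split; [exact: is_chamber_of|exact: chamber_of_hypersimplex].
(* With [n] equal to [m.+3], the dimension [n - 3] is [m]. *)
case=> [|[|[|m]]]// _; rewrite !subSS subn0.
have gx := projective_weight_generic R m.
exists (chamber_of (projective_weight R m)); last exact: projective_birational.
by split; [exact: is_chamber_of|exact: chamber_of_hypersimplex].
Qed.
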